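(* Fix $1<s_i,\theta_i<\infty$ for $i=1,2,3,4$. Let $\sigma$ and $\nu$ be weights on $\mathbb{R}^n$, and let $\mathbb{X}_\sigma$ and $\mathbb{Y}_\sigma$ be Banach function spaces over $(\mathbb{R}^n,\sigma\,dx)$. Let $T$ be either a linear or a linearizable operator. Assume that for every pair of weights $(\mu,\lambda)$ with $\nu=\mu/\lambda$ such that $(\mu^{\theta_1},\lambda^{\theta_2},\mu^{-\theta_3},\lambda^{-\theta_4})\in A_{s_1}\times A_{s_2}\times A_{s_3}\times A_{s_4}$, $$\|(Tf)\lambda\|_{\mathbb{Y}_\sigma}\le\Psi\big([\mu^{\theta_1}]_{A_{s_1}},[\lambda^{\theta_2}]_{A_{s_2}},[\mu^{-\theta_3}]_{A_{s_3}},[\lambda^{-\theta_4}]_{A_{s_4}}\big)\,\|f\mu\|_{\mathbb{X}_\sigma},$$ where $\Psi:[1,\infty)^4\to[1,\infty)$ is an increasing function of each variable. Then for every $k\ge1$, for every $\mathbf{b}=(b_1,\ldots,b_k)\in\mathcal{BMO}^k$ and for every pair of weights $(\mu,\lambda)$ with $\nu=\mu/\lambda$ such that $(\mu^{\theta_1},\lambda^{\theta_2},\mu^{-\theta_3},\lambda^{-\theta_4})\in A_{s_1}\times A_{s_2}\times A_{s_3}\times A_{s_4}$, $$\begin{aligned}\|(C_{\mathbf{b}}(T)f)\lambda\|_{\mathbb{Y}_\sigma}\le{}&\Big(\frac{2^{\,n+2+2S}\,\theta\,k}{m}\Big)^k\max\big\{[\mu^{\theta_1}]_{A_{s_1}}^{r_1},[\lambda^{\theta_2}]_{A_{s_2}}^{r_2},[\mu^{-\theta_3}]_{A_{s_3}}^{r_3},[\lambda^{-\theta_4}]_{A_{s_4}}^{r_4}\big\}^k\\&\times\Psi\big(2^{t_1}[\mu^{\theta_1}]_{A_{s_1}},2^{t_2}[\lambda^{\theta_2}]_{A_{s_2}},2^{t_3}[\mu^{-\theta_3}]_{A_{s_3}},2^{t_4}[\lambda^{-\theta_4}]_{A_{s_4}}\big)\prod_{j=1}^k\|b_j\|_{\mathcal{BMO}}\,\|f\mu\|_{\mathbb{X}_\sigma},\end{aligned}$$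 where $S=\max_{1\le i\le4}\max\{s_i,s_i'\}$, $m=\min_{1\le i\le4}\min\{1,s_i-1\}$, $\theta=\max\{\theta_1,\theta_2,\theta_3,\theta_4\}$, $r_i=\max\{1,\frac1{s_i-1}\}$ and $t_i=s_i+2\min\{1,s_i-1\}$.
   Context: A weight on $\mathbb{R}^n$ is a measurable $w$ with $0<w<\infty$ a.e. For $1<p<\infty$, $w\in A_p$ if $[w]_{A_p}=\sup_Q\big(\frac1{|Q|}\int_Q w\big)\big(\frac1{|Q|}\int_Q w^{1-p'}\big)^{p-1}<\infty$ (sup over cubes), where $1/p+1/p'=1$. Commutators. For an operator $T$ and measurable functions $\mathbf{b}=(b_1,\ldots,b_k)$, whenever it makes sense, $C_{\mathbf{b}}(T)f(x)=T\big(\prod_{j=1}^k(b_j(x)-b_j(\cdot))f(\cdot)\big)(x)$. A sublinear operator $T$ is linearizable if there are a Banach space $\mathcal{B}$ and a $\mathcal{B}$-valued linear operator $\mathcal{T}$ with $Tf(x)=\|\mathcal{T}f(x)\|_{\mathcal{B}}$; in that case $C_{\mathbf{b}}(T)f(x)=\big\|\mathcal{T}\big(\prod_{j=1}^k(b_j(x)-b_j(\cdot))f(\cdot)\big)(x)\big\|_{\mathcal{B}}$. The estimates are for all functions $f$ for which the objects are defined. $\mathcal{BMO}$ is the space of locally integrable $f$ with $\|f\|_{\mathcal{BMO}}=\sup_Q\|f-f_Q\|_{\exp L,Q}<\infty$, where $f_Q=\frac1{|Q|}\int_Qf$ and $\|g\|_{\exp L,Q}=\inf\{\lambda>0:\frac1{|Q|}\int_Q(e^{|g|/\lambda}-1)\,dx\le1\}$.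 Let $\mathbb{M}$ be the set of (classes of) measurable functions on $\mathbb{R}^n$. A Banach function space over $(\mathbb{R}^n,\sigma\,dx)$ is $\mathbb{X}_\sigma=\{f\in\mathbb{M}:\|f\|_{\mathbb{X}_\sigma}<\infty\}$, where $\|\cdot\|=\|\cdot\|_{\mathbb{X}_\sigma}:\mathbb{M}\to[0,\infty]$ satisfies: (1) $\|f\|=\||f|\|$, and $\|f\|=0$ iff $f=0$ a.e.; (2) $\|f+g\|\le\|f\|+\|g\|$; (3) $\|\lambda f\|=|\lambda|\|f\|$; (4) $|f|\le|g|$ a.e. implies $\|f\|\le\|g\|$; (5) $|f_j|\uparrow|f|$ a.e. implies $\|f_j\|\uparrow\|f\|$; (6) if $\sigma(E)=\int_E\sigma\,dx<\infty$ then $\|\mathbf{1}_E\|<\infty$ and $\int_E|f|\,\sigma\,dx\le C_E\|f\|$. Functions not in the space have norm $+\infty$. *)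

(* Defs.v *)
From HB Require Import structures.
From mathcomp Require Import all_boot all_order all_algebra.
From mathcomp Require Import complex.
From mathcomp Require Import all_classical all_reals all_analysis.
Set Implicit Arguments.
Unset Strict Implicit.
Unset Printing Implicit Defensive.
Import Order.TTheory GRing.Theory Num.Theory.
Import numFieldNormedType.Exports.
Local Open Scope classical_set_scope.
Local Open Scope ring_scope.

Section LebesgueMeasure.
Variable R : realType.

(* A point of R^n; the sigma-algebra of n.-tuple is the product one, i.e.
   the Borel sets of R^n. *)
Definition Rn (n : nat) := n.-tuple (measurableTypeR R).

HB.instance Definition _ n := Measurable.on (Rn n).

Definition Rn_cons n (p : measurableTypeR R * Rn n) : Rn n.+1 :=
  [tuple of p.1 :: p.2].

Definition Rn_uncons n (x : Rn n.+1) : measurableTypeR R * Rn n :=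
  (tnth x ord0, [tuple of behead x]).

Lemma Rn_consK n : cancel (@Rn_cons n) (@Rn_uncons n).
Proof. by case=> a x; congr pair; exact/val_inj. Qed.

Lemma measurable_Rn_cons n : measurable_fun setT (@Rn_cons n).
Proof.
exact: (measurable_cons (@measurable_fst _ _ _ _) (@measurable_snd _ _ _ _)).
Qed.

Lemma measurable_Rn_uncons n : measurable_fun setT (@Rn_uncons n).
Proof.
apply: measurable_fun_pair; first exact: measurable_tnth.
exact: measurable_behead.
Qed.

Section Step.
Variables (mu : {sigma_finite_measure set (measurableTypeR R) -> \bar R}).
Variables (n : nat) (nu : {sigma_finite_measure set (Rn n) -> \bar R}).

Definition product_cons : set (Rn n.+1) -> \bar R :=
  pushforward (mu \x nu)%E (@Rn_cons n).

Let product_cons0 : product_cons set0 = 0%E.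
Proof. by rewrite /product_cons /pushforward preimage_set0 measure0. Qed.

Let product_cons_ge0 A : (0 <= product_cons A)%E.
Proof. by rewrite /product_cons /pushforward; exact: measure_ge0. Qed.

Let measurable_preimage (A : set (Rn n.+1)) :
  measurable A -> measurable (@Rn_cons n @^-1` A).
Proof. by move=> mA; rewrite -[X in measurable X]setTI; exact: measurable_Rn_cons. Qed.

Let product_cons_sigma_additive : semi_sigma_additive product_cons.
Proof.
move=> F mF tF mUF; rewrite /product_cons /pushforward preimage_bigcup.
apply: measure_semi_sigma_additive.
- by move=> i; exact: measurable_preimage.
- apply/trivIsetP => /= i j _ _ ij; rewrite -preimage_setI.
  by move/trivIsetP : tF => /(_ _ _ _ _ ij) ->//; rewrite preimage_set0.
- by rewrite -preimage_bigcup; exact: measurable_preimage.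
Qed.

HB.instance Definition _ := isMeasure.Build _ _ _ product_cons
  product_cons0 product_cons_ge0 product_cons_sigma_additive.

Let product_cons_sigma_finite : sigma_finite setT product_cons.
Proof.
have /sigma_finiteP[F [TF ndF Foo]] := sigma_finiteT mu.
have /sigma_finiteP[G [TG ndG Goo]] := sigma_finiteT nu.
exists (fun i => @Rn_uncons n @^-1` (F i `*` G i)).
  rewrite -preimage_bigcup (_ : \bigcup_i _ = setT) ?preimage_setT//.
  apply/seteqP; split=> // -[x y] _.
  have [i _ Fx] : (\bigcup_i F i) x by rewrite -TF.
  have [j _ Gy] : (\bigcup_j G j) y by rewrite -TG.
  exists (maxn i j) => //; split.
  - by move: x Fx; exact/subsetPset/ndF/leq_maxl.
  - by move: y Gy; exact/subsetPset/ndG/leq_maxr.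
move=> k; have [mF Fk] := Foo k; have [mG Gk] := Goo k; split.
  rewrite -[X in measurable X]setTI; apply: measurable_Rn_uncons => //.
  exact: measurableX.
rewrite /product_cons /pushforward -comp_preimage.
rewrite (_ : _ \o _ = id) ?preimage_id; last exact/funext/Rn_consK.
by rewrite product_measure1E// lte_mul_pinfty// ge0_fin_numE.
Qed.

HB.instance Definition _ := Measure_isSigmaFinite.Build _ _ _ product_cons
  product_cons_sigma_finite.

End Step.

Fixpoint lebesgue_Rn (n : nat) : {sigma_finite_measure set (Rn n) -> \bar R} :=
  match n with
  | 0 => \d_([tuple] : Rn 0)
  | m.+1 => product_cons (@lebesgue_measure R) (lebesgue_Rn m)
  end.

Lemma lebesgue_Rn_box n (A : 'I_n -> set (measurableTypeR R)) :
  (forall i, measurable (A i)) ->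
  lebesgue_Rn n [set x | forall i, A i (tnth x i)] =
  (\prod_(i < n) lebesgue_measure (A i))%E.
Proof.
elim: n A => [|n IHn] A mA.
  by rewrite big_ord0 /= diracE mem_set// => -[].
rewrite big_ord_recl -(IHn (fun i => A (lift ord0 i)))// /= /product_cons.
rewrite /pushforward -product_measure1E//; last first.
  rewrite [X in measurable X](_ : _ = \bigcap_(i in [set: 'I_n])
    (fun x : Rn n => tnth x i) @^-1` A (lift ord0 i)); last first.
    by apply/seteqP; split=> x /= H i; [move=> _; exact: H|exact: H].
  apply: fin_bigcap_measurable => // i _.
  by rewrite -[X in measurable X]setTI; exact: measurable_tnth.
congr (_ _); apply/seteqP; split=> -[a x] /=.
  move=> H; split; first by have := H ord0.
  by move=> i; have := H (lift ord0 i); rewrite tnthS.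
by move=> [Aa H] i; case: (unliftP ord0 i) => [j|] ->//; rewrite tnthS.
Qed.

End LebesgueMeasure.

Section Definitions.
Variables (R : realType) (n : nat).
Local Notation C := R[i].
Local Notation Rn := (Rn R n).
Local Notation leb := (@lebesgue_Rn R n).
Implicit Types (Q : set Rn) (w mu lambda nu sigma : Rn -> R) (f g : Rn -> C).

Definition cabs (z : C) : R := complex.Re `|z|.

(* The set M of the theory: functions are complex valued, and classes modulo
   null sets are handled through representatives. *)
Definition cmeasurable f : Prop :=
  measurable_fun setT (fun x => complex.Re (f x)) /\
  measurable_fun setT (fun x => complex.Im (f x)).

(* Closed cubes with sides parallel to the axes. *)
Definition is_cube Q : Prop :=
  exists (a : 'I_n -> R) (l : R), 0 < l /\
    Q = [set x | forall i, a i <= (tnth x i : R) <= a i + l].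

Definition avg Q (h : Rn -> \bar R) : \bar R :=
  ((fine (leb Q))^-1%:E * \int[leb]_(x in Q) h x)%E.

(* p' with 1/p + 1/p' = 1 *)
Definition dual_exponent (p : R) : R := (1 - p^-1)^-1.

Definition weight w : Prop :=
  measurable_fun setT w /\ {ae leb, forall x, 0 < w x}.

Definition Ap_const (p : R) w : \bar R :=
  ereal_sup [set (avg Q (fun x => (w x)%:E) *
    avg Q (fun x => (w x `^ (1 - dual_exponent p))%:E) `^ (p - 1))%E
    | Q in is_cube].

Definition Ap (p : R) w : Prop := weight w /\ (Ap_const p w < +oo)%E.

Definition cmean Q f : C :=
  Complex (fine (avg Q (fun x => (complex.Re (f x))%:E)))
          (fine (avg Q (fun x => (complex.Im (f x))%:E))).

Definition expL_norm Q f : \bar R :=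
  ereal_inf [set l%:E | l in [set l : R | 0 < l /\
    (avg Q (fun x => (expR (cabs (f x) / l) - 1)%:E) <= 1)%E]].

Definition bmo_norm f : \bar R :=
  ereal_sup [set expL_norm Q (fun x => f x - cmean Q f)%R | Q in is_cube].

Definition locally_integrable_Rn f : Prop :=
  cmeasurable f /\
  forall Q, is_cube Q -> leb.-integrable Q (fun x => (cabs (f x))%:E).

Definition bmo f : Prop :=
  locally_integrable_Rn f /\ (bmo_norm f < +oo)%E.

(* The norm of a Banach function space over (R^n, sigma dx); the space itself
   consists of the measurable f with bfs_norm f < +oo. *)
Record banach_function_space sigma := BanachFunctionSpace {
  bfs_norm :> (Rn -> C) -> \bar R ;
  bfs_ge0 : forall f, cmeasurable f -> (0 <= bfs_norm f)%E ;
  bfs_abs : forall f, cmeasurable f -> bfs_norm f = bfs_norm (fun x => `|f x|) ;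
  bfs_eq0 : forall f, cmeasurable f ->
    bfs_norm f = 0%E <-> {ae leb, forall x, f x = 0} ;
  bfs_triangle : forall f g, cmeasurable f -> cmeasurable g ->
    (bfs_norm (fun x => f x + g x)%R <= bfs_norm f + bfs_norm g)%E ;
  bfs_homogeneous : forall (a : C) f, cmeasurable f ->
    bfs_norm (fun x => a * f x)%R = ((cabs a)%:E * bfs_norm f)%E ;
  bfs_monotone : forall f g, cmeasurable f -> cmeasurable g ->
    {ae leb, forall x, cabs (f x) <= cabs (g x)} ->
    (bfs_norm f <= bfs_norm g)%E ;
  bfs_fatou : forall (F : nat -> Rn -> C) f,
    (forall j, cmeasurable (F j)) -> cmeasurable f ->
    {ae leb, forall x,
      nondecreasing_seq (fun j => cabs (F j x)) /\
      (fun j => cabs (F j x)) @ \oo --> cabs (f x)} ->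
    nondecreasing_seq (fun j => bfs_norm (F j)) /\
    (fun j => bfs_norm (F j)) @ \oo --> bfs_norm f ;
  bfs_local : forall E : set Rn, measurable E ->
    (\int[leb]_(x in E) (sigma x)%:E < +oo)%E ->
    (bfs_norm (fun x => (\1_E x)%:C%C) < +oo)%E /\
    exists CE : R, 0 < CE /\ forall f, cmeasurable f ->
      (\int[leb]_(x in E) (cabs (f x) * sigma x)%:E <= CE%:E * bfs_norm f)%E
}.

(* The functions on which an operator is defined: a linear space of measurable
   functions, stable under multiplication by bounded measurable functions. *)
Definition operator_domain (D : set (Rn -> C)) : Prop :=
  [/\ (forall f, D f -> cmeasurable f),
      D (fun=> 0),
      (forall (a : C) f g, D f -> D g -> D (fun x => a * f x + g x)) &
      (forall h f, cmeasurable h -> (exists M : R, forall x, cabs (h x) <= M) ->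
        D f -> D (fun x => h x * f x))].

Definition linear_on (D : set (Rn -> C)) (V : lmodType C)
    (T : (Rn -> C) -> Rn -> V) : Prop :=
  forall (a : C) f g, D f -> D g ->
    forall x, T (fun y => a * f y + g y) x = a *: T f x + T g x.

Definition linear_operator (D : set (Rn -> C))
    (T : (Rn -> C) -> Rn -> C) : Prop :=
  (forall f, D f -> cmeasurable (T f)) /\ @linear_on D C^o T.

(* Such a T is automatically sublinear. *)
Definition linearizable (D : set (Rn -> C))
    (T : (Rn -> C) -> Rn -> C) : Prop :=
  (forall f, D f -> cmeasurable (T f)) /\
  exists (B : completeNormedModType C) (calT : (Rn -> C) -> Rn -> B),
    linear_on D calT /\ forall f, D f -> forall x, T f x = `|calT f x|.

(* The function y |-> prod_j (b_j(x) - b_j(y)) f(y) *)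
Definition commutator_integrand k (b : 'I_k -> Rn -> C) f (x : Rn) : Rn -> C :=
  fun y => (\prod_(j < k) (b j x - b j y)) * f y.

(* C_b(T)f makes sense *)
Definition commutator_domain (D : set (Rn -> C)) k (b : 'I_k -> Rn -> C) f :
  Prop := cmeasurable f /\ forall x, D (commutator_integrand b f x).

Definition commutator (T : (Rn -> C) -> Rn -> C) k (b : 'I_k -> Rn -> C) f :
  Rn -> C := fun x => T (commutator_integrand b f x) x.

(* For a linearizable operator the definition above is the one through the
   vector-valued linear operator, whatever the choice of the latter. *)
Lemma commutator_linearizable (D : set (Rn -> C)) (T : (Rn -> C) -> Rn -> C)
    (B : completeNormedModType C) (calT : (Rn -> C) -> Rn -> B)
    k (b : 'I_k -> Rn -> C) f :
  (forall g, D g -> forall x, T g x = `|calT g x|) ->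
  commutator_domain D b f ->
  forall x, commutator T b f x = `|calT (commutator_integrand b f x) x|.
Proof. by move=> TE [_ Df] x; exact: TE. Qed.

(* (mu^theta1, lambda^theta2, mu^-theta3, lambda^-theta4) *)
Definition weights4 (theta : 'I_4 -> R) mu lambda (i : 'I_4) : Rn -> R :=
  fun x => match val i with
           | 0 => mu x `^ theta i
           | 1 => lambda x `^ theta i
           | 2 => mu x `^ (- theta i)
           | _ => lambda x `^ (- theta i)
           end.

Definition admissible (s theta : 'I_4 -> R) nu mu lambda : Prop :=
  [/\ weight mu, weight lambda,
      {ae leb, forall x, nu x = mu x / lambda x} &
      forall i, Ap (s i) (weights4 theta mu lambda i)].

Definition Ap_consts (s theta : 'I_4 -> R) mu lambda (i : 'I_4) : R :=
  fine (Ap_const (s i) (weights4 theta mu lambda i)).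

(* Psi maps [1, oo)^4 to [1, oo) and is increasing in each variable; its values
   outside [1, oo)^4 are irrelevant. *)
Definition increasing_ge1 (Psi : ('I_4 -> R) -> R) : Prop :=
  (forall u, (forall i, 1 <= u i) -> 1 <= Psi u) /\
  forall (i : 'I_4) u v, (forall j, 1 <= u j) ->
    (forall j, j != i -> u j = v j) -> u i <= v i -> Psi u <= Psi v.

End Definitions.

(* Main.v *)
Require Import Defs.
From HB Require Import structures.
From mathcomp Require Import all_boot all_order all_algebra.
From mathcomp Require Import separable cyclotomic.
From mathcomp Require Import complex ring lra.
From mathcomp Require Import all_classical all_reals all_analysis measurable_realfun.

(** The commutator is a mixed derivative of conjugated operators: as a power
    series in z_1, ..., z_k,
      exp (sum_j z_j b_j(x)) T (exp (- sum_j z_j b_j) f) (x)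
        = T (exp (sum_j z_j (b_j(x) - b_j)) f) (x)
    has the coefficient C_b(T)f(x) at z_1 ... z_k.  Cauchy's formula on the torus
    |z_j| = rho_j therefore bounds the norm of C_b(T)f by the product of the
    rho_j^-1 times the largest norm of the conjugated operators.  These are
    controlled by the hypothesis on T, used with the weights mu e^(Re z.b) and
    lambda e^(Re z.b) in place of mu and lambda: the quotient is still nu, so only
    their admissibility is at stake.

    Admissibility holds when the rho_j are small.  An A_p weight satisfies a reverse
    Hoelder inequality whose conjugate exponent r' = 2^(n+2+2p) [w] is explicit
    ([reverse_holder], [rh_constant]).  If the mean of e^(|phi - c|/kap) over every
    cube is at most 2 and r' kap <= 1, with the similar condition for the dual weight,
    Young's inequality applied to w times e^phi gives
    [w e^phi] <= 2^(p + 2 kap) [w] ([nint_perturb], [Ap_perturb]).  For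
    phi = sum_j Re (z_j b_j) the exponential mean is bounded because of the norm of
    BMO, by convexity of the exponential ([bmo_exp_osc]).  The choice
    rho_j = m / (2^(n+2+2S) theta max_i [.]^(r_i) k B_j), for B_j slightly larger
    than the norm of b_j, makes all four constants at most 2^(t_i) times the original
    ones ([admissible_perturb]); the product of the rho_j^-1 is then the constant of
    the theorem.

    The analytic part cannot be carried out literally, since exp (- z.b) f need not
    belong to the domain of T, which is stable under bounded multipliers only, and
    since T is not assumed continuous in any sense.  Instead, everything takes place
    in finite sums.
    - For fixed b, the functions y |-> prod_j (b_j(x) - b_j(y)) span a space of finite
      dimension, so that the commutator is a combination of finitely many functions
      T g_i with coefficients depending on x ([commutator_coeffs]).  In particular it
      is measurable ([measurable_commutator]), also in the linearizable case, where
      the Banach space may be nonseparable.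
    - Cauchy's formula is replaced by a quadrature over roots of unity with an
      arbitrarily small error ([discrete_cauchy], [product_cauchy]).
    - f is cut off to a set where b is bounded and replaced by finitely many pieces on
      which b is nearly constant.  The error consists of finitely many functions; they
      are estimated by the hypothesis on T with the weights mu e^(-s), lambda e^(-s),
      s = sum_j rho_j |b_j|, which are admissible as well.  The factor e^(-s) absorbs
      the polynomial growth of the commutator kernel in b ([discretized_estimate]).
    - On the set where s <= K all errors tend to 0; the Fatou property lets K tend to
      infinity ([main_estimate]).

    It remains to let B_j tend to the norm of b_j.  When the right-hand side is a
    product of 0 and infinity, some b_j0 is almost everywhere equal to a constant, and
    f may be replaced by its restriction to the null set where b_j0 differs from that
    constant ([bound_zero]). *)

Set Implicit Arguments.
Unset Strict Implicit.
Unset Printing Implicit Defensive.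
Import Order.TTheory GRing.Theory Num.Theory.
Import numFieldNormedType.Exports.
Local Open Scope classical_set_scope.
Local Open Scope ring_scope.

(** * Half-open cubes and their dyadic subdivision *)

Section Cubes.
Variables (R : realType) (n : nat).
Local Notation Rn := (Rn R n).
Local Notation leb := (@lebesgue_Rn R n).

(** Half-open cubes, unlike closed ones, are the disjoint union of their [child]ren. *)
Definition hcube (a : 'I_n -> R) (l : R) : set Rn :=
  [set x | forall i, a i <= (tnth x i : R) < a i + l].

(** [e] selects, in each coordinate, the lower or the upper half. *)
Definition child (a : 'I_n -> R) (l : R) (e : {ffun 'I_n -> bool}) : 'I_n -> R :=
  fun i => a i + l / 2 * (e i)%:R.

Lemma measurable_coord i : measurable_fun setT (fun x : Rn => (tnth x i : R)).
Proof. exact: measurable_tnth. Qed.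

Lemma measurable_box (A : 'I_n -> set R) : (forall i, measurable (A i)) ->
  measurable [set x : Rn | forall i, A i (tnth x i : R)].
Proof.
move=> mA; rewrite (_ : mkset _ = \bigcap_(i in [set: 'I_n])
    (fun x : Rn => (tnth x i : R)) @^-1` A i); last first.
  by apply/seteqP; split=> x /= H i; [move=> _; exact: H|exact: H].
apply: fin_bigcap_measurable => // i _.
by rewrite -[X in measurable X]setTI; exact: measurable_coord.
Qed.

Lemma hcubeE a l : hcube a l = [set x : Rn | forall i, `[a i, a i + l[%classic (tnth x i : R)].
Proof. by apply/seteqP; split=> x /= H i; have := H i; rewrite in_itv. Qed.

Lemma measurable_hcube a l : measurable (hcube a l).
Proof.
by rewrite hcubeE; apply: (@measurable_box (fun i => `[a i, a i + l[%classic)) => i; exact: measurable_itv.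
Qed.

Lemma leb_hcube a l : 0 <= l -> leb (hcube a l) = (l ^+ n)%:E.
Proof.
move=> l0; rewrite hcubeE (@lebesgue_Rn_box R n (fun i => `[a i, a i + l[%classic))//.
under eq_bigr do rewrite lebesgue_measure_itv/= lte_fin ltrDl.
rewrite -[in RHS](card_ord n) -prodr_const -prodEFin.
apply: eq_bigr => i _; case: ifPn => [_|].
  by rewrite -EFinB; congr (_ %:E); ring.
by rewrite -leNgt => l1; congr (_%:E); apply/eqP; rewrite eq_le l0 l1.
Qed.

Lemma measurable_cube (Q : set Rn) : is_cube Q -> measurable Q.
Proof.
move=> [a [l [l0 ->]]].
rewrite (_ : mkset _ = [set x : Rn | forall i, `[a i, a i + l]%classic (tnth x i : R)]).
  by apply: (@measurable_box (fun i => `[a i, a i + l]%classic)) => i; exact: measurable_itv.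
by apply/seteqP; split=> x /= H i; have := H i; rewrite in_itv.
Qed.

Lemma leb_ccube (a : 'I_n -> R) l : 0 < l ->
  leb [set x | forall i, a i <= (tnth x i : R) <= a i + l] = (l ^+ n)%:E.
Proof.
move=> l0; rewrite (_ : mkset _ = [set x : Rn | forall i, `[a i, a i + l]%classic (tnth x i : R)]); last first.
  by apply/seteqP; split=> x /= H i; have := H i; rewrite in_itv.
rewrite (@lebesgue_Rn_box R n (fun i => `[a i, a i + l]%classic))//.
under eq_bigr do rewrite lebesgue_measure_itv/= lte_fin ltrDl l0.
rewrite -[in RHS](card_ord n) -prodr_const -prodEFin.
apply: eq_bigr => i _. by rewrite -EFinB; congr (_ %:E); ring.
Qed.

Lemma hcube_sub_ccube a l : hcube a l `<=` [set x | forall i, a i <= (tnth x i : R) <= a i + l].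
Proof. by move=> x H i; have /andP[-> /ltW] := H i. Qed.

Lemma child_sub a l e : 0 <= l -> hcube (child a l e) (l / 2) `<=` hcube a l.
Proof.
move=> l0 x H i; have := H i; rewrite /child; case: (e i) => /=; rewrite ?mulr1 ?mulr0 => /andP[h1 h2]; apply/andP; split; lra.
Qed.

Lemma hcube_bigcup a l : 0 < l ->
  hcube a l = \bigcup_(e in [set: {ffun 'I_n -> bool}]) hcube (child a l e) (l / 2).
Proof.
move=> l0; apply/seteqP; split=> x /=; last first.
  by move=> [e _]; exact/child_sub/ltW.
move=> H; exists [ffun i => a i + l / 2 <= (tnth x i : R)] => // i.
have := H i; rewrite /child ffunE; case: (leP (a i + l / 2) (tnth x i : R)) => /= h /andP[h1 h2]; rewrite ?mulr1 ?mulr0; apply/andP; split; lra.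
Qed.

Lemma trivIset_child a l : 0 < l ->
  trivIset [set: {ffun 'I_n -> bool}] (fun e => hcube (child a l e) (l / 2)).
Proof.
move=> l0; apply/trivIsetP => /= e e' _ _ ee'; rewrite -subset0 => x [H H'].
apply: (negP ee'); apply/eqP/ffunP => i.
have := H i; have := H' i; rewrite /child.
by case: (e i); case: (e' i) => //=; rewrite ?mulr1 ?mulr0 => /andP[h1 h2] /andP[h3 h4]; lra.
Qed.

Lemma measure_hcube_split (mu : {measure set Rn -> \bar R}) A a l : 0 < l ->
  measurable A ->
  mu (A `&` hcube a l) =
  (\sum_(e : {ffun 'I_n -> bool}) mu (A `&` hcube (child a l e) (l / 2)))%E.
Proof.
move=> l0 mA; rewrite (hcube_bigcup _ l0) setI_bigcupr.
rewrite measure_fin_bigcup//=.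
- rewrite (_ : [set: _] = [set` index_enum {ffun 'I_n -> bool}]) -?fsbig_seq ?index_enum_uniq//.
  by apply/seteqP; split=> e //= _; rewrite mem_index_enum.
- exact/trivIset_setIl/trivIset_child.
- by move=> e _; apply: measurableI => //; exact: measurable_hcube.
Qed.

End Cubes.

(** * Approximation of Borel sets by unions of dyadic cells *)

Section Approx.
Variables (R : realType) (n : nat).
Local Notation Rn := (Rn R n).
Local Notation leb := (@lebesgue_Rn R n).
Variables (a : 'I_n -> R) (l : R) (l0 : 0 < l).

(** [x] and [y] lie in the same cell of the grid of mesh [l / 2 ^+ j] through [a]; the
    grid covers the whole space. *)
Definition grid_eq (a : 'I_n -> R) (l : R) (j : nat) (x y : Rn) :=
  forall (i : 'I_n) (k : int),
    (a i + l / 2 ^+ j * k%:~R <= (tnth x i : R)) =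
    (a i + l / 2 ^+ j * k%:~R <= (tnth y i : R)).

Definition grid_set (a : 'I_n -> R) (l : R) (j : nat) (F : set Rn) :=
  measurable F /\ forall x y, grid_eq a l j x y -> F x -> F y.

Lemma grid_eq_sym b h j x y : grid_eq b h j x y -> grid_eq b h j y x.
Proof. by move=> E i k; rewrite E. Qed.

Lemma grid_eqS b h j x y : grid_eq b h j.+1 x y -> grid_eq b h j x y.
Proof.
move=> E i k; have := E i (2 * k).
suff -> : h / 2 ^+ j.+1 * (2 * k)%:~R = h / 2 ^+ j * k%:~R by [].
by rewrite exprS invfM intrM; field; rewrite expf_neq0.
Qed.

Lemma grid_eq_le b h i j x y : (i <= j)%N -> grid_eq b h j x y -> grid_eq b h i x y.
Proof.
move=> /subnKC <-; elim: (j - i)%N => [|m IH]; first by rewrite addn0.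
by rewrite addnS => /grid_eqS.
Qed.

Lemma grid_set_le b h i j F : (i <= j)%N -> grid_set b h i F -> grid_set b h j F.
Proof. by move=> ij [mF HF]; split => // x y /(grid_eq_le ij); exact: HF. Qed.

Lemma grid_setC b h j F : grid_set b h j F -> grid_set b h j (~` F).
Proof.
move=> [mF HF]; split; first exact: measurableC.
by move=> x y E nFx Fy; apply: nFx; apply: HF Fy; exact: grid_eq_sym.
Qed.

Lemma grid_setU b h j F G : grid_set b h j F -> grid_set b h j G -> grid_set b h j (F `|` G).
Proof.
move=> [mF HF] [mG HG]; split; first exact: measurableU.
by move=> x y E [Fx|Gx]; [left; apply: HF Fx|right; apply: HG Gx].
Qed.

Lemma grid_set0 b h j : grid_set b h j set0.
Proof. by split. Qed.

Lemma grid_set_child b h j e F :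
  grid_set b h j.+1 F -> grid_set (child b h e) (h / 2) j F.
Proof.
move=> [mF HF]; split=> // x y E; apply: HF => i k.
have := E i (k - 2 ^+ j * (e i)%:R).
rewrite (_ : child b h e i + _ = b i + h / 2 ^+ j.+1 * k%:~R)//.
rewrite /child intrB intrM exprS invfM rmorphXn/=.
have -> : ((e i)%:R : int)%:~R = (e i)%:R :> R by case: (e i).
by field; rewrite expf_neq0.
Qed.

Lemma grid_eq0 b h x y : 0 < h -> hcube b h x -> hcube b h y -> grid_eq b h 0 x y.
Proof.
move=> h0 Hx Hy i k; have /andP[x1 x2] := Hx i; have /andP[y1 y2] := Hy i.
rewrite expr0 divr1; have [k0|k0] := leP k 0.
  have : h * k%:~R <= 0 by rewrite pmulr_rle0// lerz0.
  move=> hk; rewrite !(le_trans _ x1, le_trans _ y1)//; lra.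
have : h <= h * k%:~R by rewrite ler_pMr// (ler_int _ 1).
move=> hk; rewrite !leNgt !(lt_le_trans x2, lt_le_trans y2)//; lra.
Qed.

Variables (rho : {measure set Rn -> \bar R}) (rhoT : (rho setT < +oo)%E).

Definition approximable (A : set Rn) := measurable A /\
  forall e : R, 0 < e -> exists j F, grid_set a l j F /\ (rho (A `+` F) < e%:E)%E.

Lemma measurableY (A B : set Rn) : measurable A -> measurable B -> measurable (A `+` B).
Proof. by move=> mA mB; apply: measurableU; exact: measurableD. Qed.

Lemma setY_sub (A B C : set Rn) : A `+` C `<=` (A `+` B) `|` (B `+` C).
Proof.
move=> x [[Ax nC]|[Cx nA]]; have [Bx|nB] := pselect (B x).
- by right; left.
- by left; left.
- by left; right.
- by right; right.
Qed.

Lemma measure_setY (A B C : set Rn) : measurable A -> measurable B -> measurable C ->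
  (rho (A `+` C) <= rho (A `+` B) + rho (B `+` C))%E.
Proof.
move=> mA mB mC; apply: le_trans (measureU2 _ _ _); try exact: measurableY.
by apply: le_measure; rewrite ?inE; [exact: measurableY|
  apply: measurableU; exact: measurableY|exact: setY_sub].
Qed.

Lemma approximable_lim (A : set Rn) : measurable A ->
  (forall e : R, 0 < e -> exists2 B, approximable B & (rho (A `+` B) < e%:E)%E) ->
  approximable A.
Proof.
move=> mA H; split => // e e0; have e20 : 0 < e / 2 by rewrite divr_gt0.
have [B [mB HB] AB] := H _ e20; have [j [F [gF BF]]] := HB _ e20.
exists j, F; split=> //; apply: le_lt_trans (measure_setY mA mB gF.1) _.
by rewrite [e]splitr EFinD lteD.
Qed.

Lemma approximableC (A : set Rn) : approximable A -> approximable (~` A).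
Proof.
move=> [mA HA]; split; first exact: measurableC.
move=> e /HA[j [F [gF AF]]]; exists j, (~` F); split; first exact: grid_setC.
rewrite (_ : _ `+` _ = A `+` F)//; apply/seteqP; split=> x.
  by move=> [[nA /contrapT Fx]|[nF /contrapT Ax]]; [right|left].
by move=> [[Ax nF]|[Fx nA]]; [right|left]; split=> //; exact.
Qed.

Lemma approximableU (A B : set Rn) : approximable A -> approximable B ->
  approximable (A `|` B).
Proof.
move=> [mA HA] [mB HB]; split; first exact: measurableU.
move=> e e0; have e20 : 0 < e / 2 by rewrite divr_gt0.
have [i [F [gF AF]]] := HA _ e20; have [j [G [gG BG]]] := HB _ e20.
exists (maxn i j), (F `|` G); split.
  by apply: grid_setU; [apply: grid_set_le gF; rewrite leq_maxl|
    apply: grid_set_le gG; rewrite leq_maxr].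
apply: (@le_lt_trans _ _ (rho (A `+` F) + rho (B `+` G))%E); last first.
  by rewrite [e]splitr EFinD lteD.
have mAF := measurableY mA gF.1; have mBG := measurableY mB gG.1.
apply: le_trans (measureU2 _ mAF mBG).
apply: le_measure; rewrite ?inE; [|exact: measurableU|].
  by apply: measurableY; apply: measurableU => //; [exact: gF.1|exact: gG.1].
move=> x [[[Ax|Bx] nFG]|[[Fx|Gx] nAB]].
- by left; left; split=> // Fx; apply: nFG; left.
- by right; left; split=> // Gx; apply: nFG; right.
- by left; right; split=> // Ax; apply: nAB; left.
- by right; right; split=> // Bx; apply: nAB; right.
Qed.

Lemma approximable0 : approximable set0.
Proof.
split => // e e0; exists 0%N, set0; split; first exact: grid_set0.
by rewrite setYK measure0 lte_fin.
Qed.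

Lemma measure_cvg0 (F : (set Rn)^nat) : (forall i, measurable (F i)) ->
  nonincreasing_seq F -> \bigcap_i F i = set0 ->
  forall e : R, 0 < e -> exists i, (rho (F i) < e%:E)%E.
Proof.
move=> mF nF F0 e e0.
have rF : (rho (F 0%N) < +oo)%E.
  by apply: le_lt_trans rhoT; apply: le_measure; rewrite ?inE.
have := @nonincreasing_cvg_mu _ _ _ rho F rF mF _ nF.
rewrite F0 measure0 => /(_ measurable0) /(_ [set y | (y < e%:E)%E]).
case.
  apply: open_nbhs_nbhs; split; last by rewrite /= lte_fin.
  exact: open_ereal_lt_ereal.
by move=> N _ /(_ N (leqnn N)) H; exists N.
Qed.

Lemma approximable_bigcup (A : (set Rn)^nat) : (forall k, approximable (A k)) ->
  approximable (\bigcup_k A k).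
Proof.
move=> HA; apply: approximable_lim; first by apply: bigcupT_measurable => k; exact: (HA k).1.
pose B m := \big[setU/set0]_(k < m) A k.
have HB m : approximable (B m).
  rewrite /B; elim: m => [|m IH]; first by rewrite big_ord0; exact: approximable0.
  by rewrite big_ord_recr; exact: approximableU.
move=> e e0.
have [|||m Hm] := @measure_cvg0 (fun m => (\bigcup_k A k) `\` B m) _ _ _ e e0.
- move=> m; apply: measurableD; last exact: (HB m).1.
  by apply: bigcupT_measurable => k; exact: (HA k).1.
- move=> i j ij; apply/subsetPset; apply: setDS => x.
  by rewrite /B -!bigcup_mkord => -[k /= ki Ak]; exists k => //=; exact: leq_trans ij.
- rewrite -subset0 => x H; have [[k _ Ak] _] := H 0%N I.
  have [_ /=] := H k.+1 I; apply; rewrite /B -bigcup_mkord; exists k => //=.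
exists (B m) => //; rewrite /setY (_ : B m `\` _ = set0) ?setU0//.
rewrite -subset0 => x; rewrite /B -bigcup_mkord => -[[k _ Ak] []]; by exists k.
Qed.

(** Moving the threshold up to the next grid hyperplane adds a slab of width at most
    [l / 2 ^+ j], whose measure tends to 0. *)
Lemma approximable_ray (i : 'I_n) (c : R) :
  approximable [set x : Rn | c < (tnth x i : R)].
Proof.
have mray (S : set R) : measurable S -> measurable [set x : Rn | S (tnth x i : R)].
  move=> mS; rewrite (_ : mkset _ = (fun x : Rn => (tnth x i : R)) @^-1` S)//.
  by rewrite -[X in measurable X]setTI; exact: measurable_coord.
have mA : measurable [set x : Rn | c < (tnth x i : R)].
  rewrite (_ : mkset _ = [set x : Rn | `]c, +oo[%classic (tnth x i : R)]).
    by apply: (mray `]c, +oo[%classic); exact: measurable_itv.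
  by apply/seteqP; split => x /=; rewrite in_itv/= andbT.
split => // e e0.
pose N j : R := 2 ^+ j.
have N0 j : 0 < N j by rewrite exprn_gt0.
pose k j := Num.floor ((c - a i) * N j / l) + 1.
pose c' j := a i + l / N j * (k j)%:~R.
have c1 j : c < c' j.
  have : (c - a i) * N j / l < (k j)%:~R by rewrite /k floorD1_gt.
  rewrite ltr_pdivrMr// -ltr_pdivlMr// => H; rewrite /c' -ltrBlDl.
  by rewrite (_ : l / N j * _ = (k j)%:~R * l / N j)//; ring.
have c2 j : c' j <= c + l / N j.
  have : (k j)%:~R - 1 <= (c - a i) * N j / l by rewrite /k intrD addrK floor_le.
  rewrite ler_pdivlMr// -ler_pdivrMr// => H; rewrite /c'.
  rewrite -lerBrDl; apply: le_trans (_ : (c - a i) + l / N j <= _); last lra.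
  by rewrite -lerBlDr; apply: le_trans H; rewrite le_eqVlt; apply/orP; left; apply/eqP; field; rewrite gt_eqF.
have [|||j Hj] := @measure_cvg0 (fun j => [set x : Rn | `]c, c + l / N j[%classic (tnth x i : R)]) _ _ _ e e0.
- by move=> j; apply: mray; exact: measurable_itv.
- move=> j j' jj'; apply/subsetPset => x /=; rewrite !in_itv/= => /andP[-> /=] h.
  apply: lt_le_trans h _; rewrite lerD2l ler_pM2l// lef_pV2 ?posrE// /N.
  by rewrite ler_eXn2l// ltr1n.
- rewrite -subset0 => x H; have cx : c < (tnth x i : R).
    by have := H 0%N I; rewrite /= in_itv/= => /andP[].
  pose j := (Num.truncn (l / ((tnth x i : R) - c))).+1.
  have := H j I; rewrite /= in_itv/= cx/=; apply/negP; rewrite -leNgt -lerBrDl.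
  rewrite ler_pdivrMr// mulrC -ler_pdivrMr ?subr_gt0//.
  apply: ltW; apply: lt_le_trans (truncnS_gt _) _.
  rewrite /N -natrX ler_nat; exact/ltnW/ltn_expl.
exists j, [set x : Rn | c' j <= (tnth x i : R)]; split.
  split; last by move=> x y E /=; have := E i (k j); rewrite -/(N j) -/(c' j) => ->.
  rewrite (_ : mkset _ = [set x : Rn | `[c' j, +oo[%classic (tnth x i : R)]).
    by apply: (mray `[c' j, +oo[%classic); exact: measurable_itv.
  by apply/seteqP; split => x /=; rewrite in_itv/= andbT.
apply: le_lt_trans Hj; apply: le_measure; rewrite ?inE.
- apply: measurableY => //.
  rewrite (_ : mkset _ = [set x : Rn | `[c' j, +oo[%classic (tnth x i : R)]).
    by apply: (mray `[c' j, +oo[%classic); exact: measurable_itv.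
  by apply/seteqP; split => x /=; rewrite in_itv/= andbT.
- by apply: mray; exact: measurable_itv.
move=> x [[/= cx /negP]|[/= cx]].
  rewrite -ltNge in_itv/= cx/= => h; exact: lt_le_trans (c2 j).
by move/negP; rewrite -leNgt => h; have := lt_le_trans (c1 j) (le_trans cx h); rewrite ltxx.
Qed.

(** The approximable sets form a sigma-algebra that contains the rays of each
    coordinate.  This is the substitute for the Lebesgue differentiation theorem: it
    lets estimates on dyadic cubes pass to arbitrary measurable sets. *)
Lemma approximable_measurable (A : set Rn) : measurable A -> approximable A.
Proof.
have sa : sigma_algebra setT approximable.
  split; [exact: approximable0|move=> B; rewrite setTD; exact: approximableC|].
  exact: approximable_bigcup.
suff : @measurable _ Rn `<=` approximable by apply.
apply: smallest_sub => //.
elim/big_ind : _ => //; first by move=> X Y HX HY x [/HX|/HY].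
move=> i _ _ [S mS <-]; rewrite setTI.
have {mS} : (@measurable_realfun.RGenOInfty.G R).-sigma.-measurable S by rewrite -measurable_realfun.RGenOInfty.measurableE.
pose pre (S : set R) : set Rn := [set x : Rn | S (tnth x i : R)].
suff: <<s @measurable_realfun.RGenOInfty.G R >> `<=` [set S | approximable (pre S)] by apply.
apply: smallest_sub; last first.
  move=> _ [c ->] /=; rewrite (_ : pre _ = [set x : Rn | c < (tnth x i : R)]).
    exact: approximable_ray.
  by apply/seteqP; split => x /=; rewrite /pre/= in_itv/= andbT.
case: sa => s0 sC sU; split => /=.
- by rewrite (_ : pre set0 = set0)//.
- by move=> B HB; rewrite (_ : pre _ = setT `\` pre B); [exact: sC|rewrite !setTD].
- move=> B HB; rewrite (_ : pre _ = \bigcup_k pre (B k)); first exact: sU.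
  by apply/seteqP; split => x [k _ Bk]; exists k.
Qed.

End Approx.

(** * Dyadic stopping cubes *)

Section Stopping.
Variables (R : realType) (n : nat).
Local Notation Rn := (Rn R n).
Local Notation leb := (@lebesgue_Rn R n).
Variables (om : {measure set Rn -> \bar R}) (t : R) (t0 : 0 <= t).
Local Open Scope ereal_scope.

(** The mean of [om] over the cube exceeds the level [t]. *)
Definition heavy (a : 'I_n -> R) (l : R) : bool :=
  (t%:E * leb (hcube a l) < om (hcube a l)).

(** The union of the maximal heavy cubes among the first [m] dyadic generations: the
    Calderon-Zygmund decomposition at height [t]. *)
Fixpoint stopped (m : nat) (a : 'I_n -> R) (l : R) : set Rn :=
  if heavy a l then hcube a l else
  match m with
  | 0 => set0
  | m'.+1 => \bigcup_(e in [set: {ffun 'I_n -> bool}]) stopped m' (child a l e) (l / 2)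
  end.

Lemma stopped_heavy m a l : heavy a l -> stopped m a l = hcube a l.
Proof. by case: m => /= [|m] ->. Qed.

Lemma measurable_stopped m a l : measurable (stopped m a l).
Proof.
elim: m a l => [|m IH] a l /=; case: ifP => _ //; try exact: measurable_hcube.
by apply: fin_bigcup_measurable => // e _; exact: IH.
Qed.

Lemma stopped_sub m a l : (0 <= l)%R -> stopped m a l `<=` hcube a l.
Proof.
elim: m a l => [|m IH] a l l0 /=; case: ifP => // _ x // [e _ /IH He].
by apply: (child_sub (e := e) l0); apply: He; rewrite divr_ge0.
Qed.

Lemma hcube_child_eq (a : 'I_n -> R) (l : R) e e' (x : Rn) : (0 < l)%R ->
  hcube (child a l e) (l / 2) x -> hcube (child a l e') (l / 2) x -> e = e' :> {ffun 'I_n -> bool}.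
Proof.
move=> l0 H H'; apply/eqP/negPn/negP => ee'.
have /trivIsetP/(_ e e' I I ee') := @trivIset_child _ n a l l0.
by rewrite -subset0 => /(_ x); apply.
Qed.

Lemma stopped_child m a l e : (0 < l)%R -> ~~ heavy a l ->
  stopped m.+1 a l `&` hcube (child a l e) (l / 2) = stopped m (child a l e) (l / 2).
Proof.
move=> l0 /negbTE/= ->; apply/seteqP; split=> x.
  move=> [[e' _ Hx] He].
  suff -> : e = e' by [].
  apply: hcube_child_eq He _ => //; apply: (stopped_sub _ Hx).
  by rewrite divr_ge0// ltW.
by move=> H; split; [exists e|apply: (stopped_sub _ H); rewrite divr_ge0// ltW].
Qed.

Lemma stopped_mono m a l : (0 < l)%R -> stopped m a l `<=` stopped m.+1 a l.
Proof.
elim: m a l => [|m IH] a l l0; first by move=> x /=; case: ifP.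
have [hv|hv] := boolP (heavy a l); first by rewrite !stopped_heavy.
rewrite /= (negbTE hv) => x [e _ Hx]; exists e => //; apply: (IH _ _ _ x Hx); rewrite divr_gt0//.
Qed.

Lemma leb_child (a : 'I_n -> R) (l : R) e : (0 < l)%R ->
  leb (hcube a l) = (2 ^+ n)%:E * leb (hcube (child a l e) (l / 2)).
Proof.
move=> l0; rewrite !leb_hcube ?divr_ge0 ?ltW// -EFinM; congr (_%:E).
by rewrite expr_div_n mulrC divfK// expf_neq0.
Qed.

(** A stopped cube is heavy while its parent is light, so that its mean is at most
    [2 ^+ n * t].  Summing over the stopped cubes transfers to their union a comparison
    that holds on such cubes. *)
Lemma om_stopped (C : R) (G : set Rn) m a l : (0 <= C)%R -> measurable G ->
  (forall b h, (0 < h)%R -> heavy b h ->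
     om (hcube b h) <= (2 ^+ n * t)%:E * leb (hcube b h) ->
     om (hcube b h) <= C%:E * leb (hcube b h `&` G)) ->
  (0 < l)%R -> ~~ heavy a l ->
  om (stopped m a l) <= C%:E * leb (stopped m a l `&` G).
Proof.
move=> C0 mG HG; elim: m a l => [|m IH] a l l0 hv.
  by rewrite /= (negbTE hv) measure0 set0I measure0 mule0.
have l20 : (0 < l / 2)%R by rewrite divr_gt0.
have mS := measurable_stopped m.+1 a l.
have {1}-> : stopped m.+1 a l = stopped m.+1 a l `&` hcube a l.
  by apply/esym/setIidPl; apply: stopped_sub; exact: ltW.
rewrite (_ : _ `&` G = (stopped m.+1 a l `&` G) `&` hcube a l); last first.
  by apply/esym/setIidPl => x [H _]; exact: (stopped_sub (ltW l0) H).
rewrite !measure_hcube_split//; last exact: measurableI.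
rewrite ge0_sume_distrr; last by move=> *; exact: measure_ge0.
apply: lee_sum => e _; rewrite setIAC stopped_child//.
have [he|he] := boolP (heavy (child a l e) (l / 2)); last exact: IH.
rewrite stopped_heavy//; apply: HG => //.
apply: (@le_trans _ _ (om (hcube a l))).
  apply: le_measure; rewrite ?inE; try exact: measurable_hcube.
  by apply: child_sub; exact: ltW.
move: hv; rewrite /heavy -leNgt => /le_trans; apply.
by rewrite (leb_child _ e l0) muleA -EFinM mulrC.
Qed.

Definition unstopped m a l := hcube a l `\` stopped m a l.

Lemma measurable_unstopped m a l : measurable (unstopped m a l).
Proof. by apply: measurableD; [exact: measurable_hcube|exact: measurable_stopped]. Qed.

Lemma unstopped_child m a l e : (0 < l)%R -> ~~ heavy a l ->
  unstopped m.+1 a l `&` hcube (child a l e) (l / 2) = unstopped m (child a l e) (l / 2).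
Proof.
move=> l0 hv; rewrite /unstopped -(stopped_child _ _ l0 hv).
apply/seteqP; split=> x.
  by move=> [[Hx Sx] Hc]; split => // -[].
move=> [Hc nS]; split => //; split; first exact: (child_sub (ltW l0) Hc).
by move=> S; apply: nS; split.
Qed.

(** A grid set of level [m] meets the unstopped part in a union of cells of level [m],
    each of which is light. *)
Lemma om_unstopped_grid m a l F : (0 < l)%R -> grid_set a l m F ->
  om (F `&` unstopped m a l) <= t%:E * leb (F `&` unstopped m a l).
Proof.
elim: m a l F => [|m IH] a l F l0 gF.
  rewrite /unstopped /=; case: ifPn => hv; first by rewrite setDv setI0 !measure0 mule0.
  rewrite setD0; have [[x [Fx Hx]]|nF] := pselect (exists x, (F `&` hcube a l) x).
    have -> : F `&` hcube a l = hcube a l; last by move: hv; rewrite /heavy -leNgt.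
    apply/seteqP; split=> y; first by case.
    by move=> Hy; split => //; apply: gF.2 Fx; exact: grid_eq0.
  rewrite (_ : _ `&` _ = set0) ?measure0 ?mule0//.
  by rewrite -subset0 => x Fx; apply: nF; exists x.
have [hv|hv] := boolP (heavy a l).
  by rewrite /unstopped stopped_heavy// setDv setI0 !measure0 mule0.
have mF := gF.1.
have mFS : measurable (F `&` unstopped m.+1 a l).
  by apply: measurableI => //; exact: measurable_unstopped.
rewrite (_ : F `&` _ = (F `&` unstopped m.+1 a l) `&` hcube a l); last first.
  by apply/esym/setIidPl => x [_ []].
rewrite !measure_hcube_split//.
rewrite ge0_sume_distrr; last by move=> *; exact: measure_ge0.
apply: lee_sum => e _; rewrite -setIA unstopped_child//.
by apply: IH; [rewrite divr_gt0|exact: grid_set_child].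
Qed.

Lemma nonincreasing_unstopped a l : (0 < l)%R ->
  nonincreasing_seq (fun m => unstopped m a l).
Proof.
move=> l0; apply/nonincreasing_seqP => m; apply/subsetPset => x [Hx nS].
by split => // S; apply: nS; exact: stopped_mono.
Qed.

Definition never_stopped a l := \bigcap_m unstopped m a l.

(** Lebesgue differentiation without maximal functions: approximate [A] by a grid set
    for the measure [om + leb] and apply the estimate at a generation that resolves
    this grid set. *)
Lemma om_never_stopped a l A : (0 < l)%R -> om (hcube a l) < +oo -> measurable A ->
  om (A `&` never_stopped a l) <= t%:E * leb (A `&` never_stopped a l).
Proof.
move=> l0 omH mA.
set H := hcube a l; have mH : measurable H := measurable_hcube a l.
have lebH : leb H < +oo by rewrite leb_hcube ?ltry// ltW.
pose rho := measure_add (mrestr om mH) (mrestr leb mH).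
have rhoE B : rho B = om (B `&` H) + leb (B `&` H) by rewrite /rho measure_addE.
have rhoT : rho setT < +oo by rewrite rhoE setTI lte_add_pinfty.
set S := never_stopped a l.
have mU m : measurable (unstopped m a l) by exact: measurable_unstopped.
have mS : measurable S by apply: bigcapT_measurable.
have SU m : S `<=` unstopped m a l by move=> x; apply.
have UH m : unstopped m a l `<=` H by move=> x [].
apply/lee_addgt0Pr => e e0.
pose d := (e / (2 * t + 1))%R.
have d0 : (0 < d)%R by rewrite divr_gt0// ltr_wpDl// mulr_ge0.
have [_ /(_ d d0)[j [F [gF rF]]]] := approximable_measurable a l0 rhoT mA.
have [||| i ri] := measure_cvg0 rhoT (F := fun m => unstopped m a l `\` S) _ _ _ d0.
- by move=> m; exact: measurableD.
- move=> p q pq; apply/subsetPset => x [Ux nS]; split => //.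
  by have /subsetPset := nonincreasing_unstopped a l0 pq; apply.
- by rewrite -subset0 => x K; have [_ nS] := K 0%N I; apply: nS => m _; have [] := K m I.
pose M := maxn i j; set U := unstopped M a l.
have mUM : measurable U := mU M.
have gFM : grid_set a l M F by apply: grid_set_le gF; rewrite leq_maxr.
have rU : rho (U `\` S) < d%:E.
  apply: le_lt_trans ri; apply: le_measure; rewrite ?inE; try exact: measurableD.
  move=> x [Ux nS]; split => //.
  have /subsetPset := nonincreasing_unstopped a l0 (leq_maxl i j); exact.
have mF := gF.1.
have mY : measurable (A `+` F) by exact: measurableY.
have le1 (mu : {measure set Rn -> \bar R}) (B : set Rn) : measurable B ->
  (forall B, measurable B -> B `<=` H -> mu B <= rho B) -> B `<=` H -> rho B < d%:E ->
  mu B <= d%:E.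
  by move=> mB Hmu BH rB; apply: le_trans (Hmu _ mB BH) (ltW rB).
have omr B : measurable B -> B `<=` H -> om B <= rho B.
  by move=> mB BH; rewrite rhoE; move/setIidPl: BH => ->; rewrite leeDl.
have lbr B : measurable B -> B `<=` H -> leb B <= rho B.
  by move=> mB BH; rewrite rhoE; move/setIidPl: BH => ->; rewrite leeDr.
have mYH : measurable ((A `+` F) `&` H) by exact: measurableI.
have rYH : rho ((A `+` F) `&` H) < d%:E.
  by apply: le_lt_trans rF; apply: le_measure; rewrite ?inE//; exact: subIsetl.
have mUS : measurable (U `\` S) by exact: measurableD.
have step1 : om (A `&` S) <= om (F `&` U) + d%:E.
  apply: (@le_trans _ _ (om ((F `&` U) `|` ((A `+` F) `&` H)))).
    apply: le_measure; rewrite ?inE; [exact: measurableI| |].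
      by apply: measurableU => //; apply: measurableI.
    move=> x [Ax Sx]; have Ux : U x by exact: SU.
    have [Fx|nF] := pselect (F x); first by left.
    by right; split; [left|exact: UH Ux].
  apply: le_trans (measureU2 _ _ _) _ => //; first by apply: measurableI.
  rewrite leeD2l//; apply: (le1 om) => //; exact: subIsetr.
have step2 : leb (F `&` U) <= leb (A `&` S) + d%:E + d%:E.
  apply: (@le_trans _ _ (leb (((A `&` S) `|` ((A `+` F) `&` H)) `|` (U `\` S)))).
    apply: le_measure; rewrite ?inE; first by apply: measurableI.
      by apply: measurableU => //; apply: measurableU => //; apply: measurableI.
    move=> x [Fx Ux]; have [Sx|nS] := pselect (S x); last by right.
    left; have [Ax|nA] := pselect (A x); first by left.
    by right; split; [right|exact: UH Ux].
  apply: le_trans (measureU2 _ _ _) _ => //.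
    by apply: measurableU => //; apply: measurableI.
  apply: leeD; last by apply: (le1 leb) => // x [/UH].
  apply: le_trans (measureU2 _ _ _) _ => //; first by apply: measurableI.
  rewrite leeD2l//; apply: (le1 leb) => //; exact: subIsetr.
apply: le_trans step1 _.
have lebAS : leb (A `&` S) \is a fin_num.
  rewrite ge0_fin_numE//; apply: le_lt_trans lebH; apply: le_measure; rewrite ?inE//.
    exact: measurableI.
  by move=> x [_ /(_ 0%N I)[]].
apply: (@le_trans _ _ (t%:E * (leb (A `&` S) + d%:E + d%:E) + d%:E)).
  rewrite leeD2r//; apply: le_trans (om_unstopped_grid l0 gFM) _.
  by apply: lee_wpmul2l => //; rewrite lee_fin.
move: lebAS; case: (leb _) => // r _; rewrite -!EFinD lee_fin.
suff -> : (e = (2 * t + 1) * d)%R by rewrite le_eqVlt; apply/orP; left; apply/eqP; ring.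
by rewrite /d mulrC divfK// gt_eqF// ltr_wpDl// mulr_ge0.
Qed.

End Stopping.

(** * Integrals of nonnegative real functions *)

Section RealIntegral.
Context d (T : measurableType d) (R : realType) (mu : {measure set T -> \bar R}).
Local Open Scope ereal_scope.
Implicit Types (D A : set T) (f g : T -> R).

Lemma nint_ge0 D f : (forall x, 0 <= f x)%R -> 0 <= \int[mu]_(x in D) (f x)%:E.
Proof. by move=> f0; apply: integral_ge0 => x _; rewrite lee_fin. Qed.

Lemma nint_le D f g : measurable D -> measurable_fun setT f -> measurable_fun setT g ->
  (forall x, 0 <= f x)%R -> (forall x, D x -> f x <= g x)%R ->
  \int[mu]_(x in D) (f x)%:E <= \int[mu]_(x in D) (g x)%:E.
Proof.
move=> mD mf mg f0 fg; apply: ge0_le_integral => //.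
- by move=> x _; rewrite lee_fin.
- by apply/measurable_EFinP; exact: measurable_funTS.
- by apply/measurable_EFinP; exact: measurable_funTS.
Qed.

Lemma nintD D f g : measurable D -> measurable_fun setT f -> measurable_fun setT g ->
  (forall x, 0 <= f x)%R -> (forall x, 0 <= g x)%R ->
  \int[mu]_(x in D) (f x + g x)%:E =
  \int[mu]_(x in D) (f x)%:E + \int[mu]_(x in D) (g x)%:E.
Proof.
move=> mD mf mg f0 g0; under eq_integral do rewrite EFinD.
rewrite ge0_integralD//.
- by move=> x _; rewrite lee_fin.
- by apply/measurable_EFinP; exact: measurable_funTS.
- by move=> x _; rewrite lee_fin.
- by apply/measurable_EFinP; exact: measurable_funTS.
Qed.

Lemma nintZ D f (k : R) : measurable D -> measurable_fun setT f ->
  (forall x, 0 <= f x)%R -> (0 <= k)%R ->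
  \int[mu]_(x in D) (k * f x)%:E = k%:E * \int[mu]_(x in D) (f x)%:E.
Proof.
move=> mD mf f0 k0; under eq_integral do rewrite EFinM.
rewrite ge0_integralZl_EFin//.
- by move=> x _; rewrite lee_fin.
- by apply/measurable_EFinP; exact: measurable_funTS.
Qed.

Lemma nint_sum D (I : Type) (s : seq I) (F : I -> T -> R) : measurable D ->
  (forall i, measurable_fun setT (F i)) -> (forall i x, 0 <= F i x)%R ->
  \int[mu]_(x in D) (\sum_(i <- s) F i x)%:E = \sum_(i <- s) \int[mu]_(x in D) (F i x)%:E.
Proof.
move=> mD mF F0; under eq_integral do rewrite -sumEFin.
rewrite ge0_integral_sum//.
- by move=> i; apply/measurable_EFinP; exact: measurable_funTS.
- by move=> i x _; rewrite lee_fin.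
Qed.

Lemma nint_indicM D A f : measurable D -> measurable A ->
  \int[mu]_(x in D) (\1_A x * f x)%:E = \int[mu]_(x in D `&` A) (f x)%:E.
Proof.
move=> mD mA; rewrite integral_mkcondr; apply: eq_integral => x _.
by rewrite patchE indicE; case: (x \in A); rewrite ?mul1r ?mul0r.
Qed.

Lemma nint_indic D A : measurable D -> measurable A ->
  \int[mu]_(x in D) (\1_A x)%:E = mu (D `&` A).
Proof. by move=> mD mA; rewrite integral_indic// setIC. Qed.

Lemma nint_cst D (k : R) : measurable D -> \int[mu]_(x in D) k%:E = k%:E * mu D.
Proof. by move=> mD; rewrite -(integral_cst mu mD). Qed.

Lemma measurable_lt f g : measurable_fun setT f -> measurable_fun setT g ->
  measurable [set x | (f x < g x)%R].
Proof.
move=> mf mg; rewrite (_ : mkset _ = setT `&` (fun x => (f x < g x)%R) @^-1` [set true]).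
  by apply: measurable_fun_ltr.
by apply/seteqP; split => x //= [].
Qed.

Lemma measurable_le f g : measurable_fun setT f -> measurable_fun setT g ->
  measurable [set x | (f x <= g x)%R].
Proof.
move=> mf mg; rewrite (_ : mkset _ = setT `&` (fun x => (f x <= g x)%R) @^-1` [set true]).
  by apply: measurable_fun_ler.
by apply/seteqP; split => x //= [].
Qed.

End RealIntegral.

Section DensityMeasure.
Context d (T : measurableType d) (R : realType) (mu : {measure set T -> \bar R}).
Variables (w : T -> R) (mw : measurable_fun setT w) (w0 : forall x, 0 < w x).
Local Open Scope ereal_scope.

(** The measure of density [w]; the two proofs are arguments so that it can carry the
    structure of a measure. *)
Definition wmeas (_ : measurable_fun setT w) (_ : forall x, (0 < w x)%R) (A : set T) : \bar R :=
  \int[mu]_(x in A) (w x)%:E.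

Local Notation om := (wmeas mw w0).

Let om0 : om set0 = 0. Proof. exact: integral_set0. Qed.
Let om_ge0 A : 0 <= om A. Proof. by apply: nint_ge0 => x; exact: ltW. Qed.
Let om_sigma : semi_sigma_additive om.
Proof.
apply: semi_sigma_additive_nng_induced; first exact/measurable_EFinP.
by move=> x; rewrite lee_fin ltW.
Qed.
HB.instance Definition _ := isMeasure.Build _ _ _ om om0 om_ge0 om_sigma.

End DensityMeasure.

(** * A layer-cake formula with dyadic levels *)

Section LayerCake.
Variable R : realType.
Implicit Types (tau del w y c : R).
Let t tau (k : nat) : R := tau * 2 ^+ k.

(** Sum of the jumps of [y `^ del] over the dyadic levels below [w]; the truncation at
    level [K] keeps all integrals finite. *)
Lemma layer_up tau del w (K : nat) : 0 < tau -> 0 < del -> 0 < w ->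
  (Num.min w (t tau K)) `^ del <= tau `^ del +
    \sum_(k < K) ((2 `^ del - 1) * (t tau k) `^ del) * (t tau k < w)%R%:R.
Proof.
move=> tau0 del0 w0; have t0 k : 0 < t tau k by rewrite mulr_gt0// exprn_gt0.
have P0 := ge0_ler_powR (ltW del0).
elim: K => [|K IH].
  rewrite big_ord0 addr0 /t expr0 mulr1; apply: P0; rewrite ?nnegrE; try lra.
    by rewrite le_min !ltW.
  by rewrite ge_min lexx orbT.
rewrite big_ord_recr/= addrA.
have [tw|wt] := ltP (t tau K) w; last first.
  rewrite mulr0 addr0; apply: le_trans IH.
  have wt2 : w <= t tau K.+1 by rewrite (_ : t tau K.+1 = 2 * t tau K) ?/t ?exprS; [have := t0 K; rewrite /t in wt *; lra|ring].
  by rewrite !min_l.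
rewrite mulr1; move: IH; rewrite min_r; last exact: ltW.
move=> IH; apply: (@le_trans _ _ (t tau K.+1 `^ del)).
  apply: P0; rewrite ?nnegrE; [|exact: ltW|by rewrite ge_min lexx orbT].
  by rewrite le_min !ltW.
have -> : t tau K.+1 = 2 * t tau K by rewrite /t exprS; ring.
rewrite powRM ?(ltW (t0 K))//; lra.
Qed.

(** The sum is geometric, hence dominated by the last level below [c * w]. *)
Lemma layer_down tau del w c (K : nat) : 0 < tau -> 0 < del -> 0 < w -> 1 <= c ->
  \sum_(k < K) ((2 `^ del - 1) * (t tau k) `^ del) * (t tau k) * (t tau k < c * w)%R%:R <=
  2 * (2 `^ del - 1) * c `^ (1 + del) * (Num.min w (t tau K) `^ del * w).
Proof.
move=> tau0 del0 w0 c1; have t0 k : 0 < t tau k by rewrite mulr_gt0// exprn_gt0.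
have P0 := ge0_ler_powR (ltW del0).
have c0 : 0 < c by lra.
have tS k : t tau k.+1 = 2 * t tau k by rewrite /t exprS; ring.
have tmono i j : (i <= j)%N -> t tau i <= t tau j.
  by move=> ij; rewrite /t ler_pM2l// ler_eXn2l// ltr1n.
have D0 : 0 <= 2 `^ del - 1 :> R.
  by rewrite subr_ge0 -[leLHS](powRr0 2); apply: ler_powR; rewrite ?(ltW del0)// ler1n.
have S1 : \sum_(k < K) t tau k <= t tau K.
  elim: (K) => [|k IH]; first by rewrite big_ord0 ltW.
  rewrite big_ord_recr/= tS; lra.
have S2 : \sum_(k < K) t tau k * (t tau k < c * w)%R%:R <= 2 * (c * w).
  elim: (K) => [|k IH]; first by rewrite big_ord0 !mulr_ge0// ltW.
  rewrite big_ord_recr/=; have [tw|wt] := ltP (t tau k) (c * w); last by rewrite mulr0 addr0.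
  rewrite mulr1; suff : \sum_(i < k) t tau i * (t tau i < c * w)%R%:R <= t tau k by lra.
  elim: (k) => [|j IHj]; first by rewrite big_ord0 ltW.
  rewrite big_ord_recr/= tS.
  have : t tau j * (t tau j < c * w)%R%:R <= t tau j by rewrite ler_piMr ?(ltW (t0 j))//; case: (t tau j < c * w)%R.
  lra.
set v := Num.min w (t tau K).
have v0 : 0 < v by rewrite lt_min w0 t0.
have term (k : 'I_K) : ((2 `^ del - 1) * (t tau k) `^ del) * (t tau k) * (t tau k < c * w)%R%:R <=
  (2 `^ del - 1) * (c * v) `^ del * (t tau k * (t tau k < c * w)%R%:R).
  have [tw|wt] := ltP (t tau k) (c * w); last by rewrite !mulr0.
  rewrite !mulr1 ler_pM2r//; apply: ler_wpM2l => //.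
  apply: P0; rewrite ?nnegrE; [exact: ltW|by rewrite mulr_ge0 ?ltW|].
  rewrite /v minr_pMr ?(ltW c0)// le_min (ltW tw)/=.
  apply: le_trans (tmono _ _ (ltnW (ltn_ord k))) _; by rewrite ler_peMl// ltW.
apply: le_trans (ler_sum _ (fun k _ => term k)) _; rewrite -mulr_sumr.
apply: (@le_trans _ _ ((2 `^ del - 1) * (c * v) `^ del * (2 * (c * w)))).
  by apply: ler_wpM2l => //; rewrite mulr_ge0// powR_ge0.
rewrite powRM ?(ltW c0) ?(ltW v0)// powRD; last by rewrite (gt_eqF c0) implybT.
rewrite powRr1 ?(ltW c0)//.
by rewrite le_eqVlt; apply/orP; left; apply/eqP; ring.
Qed.

End LayerCake.

(** * The reverse Hoelder inequality *)

Section ReverseHolder.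
Variables (R : realType) (n : nat).
Local Notation Rn := (Rn R n).
Local Notation leb := (@lebesgue_Rn R n).
Variables (w : Rn -> R) (mw : measurable_fun setT w) (w0 : forall x, 0 < w x).
Local Open Scope ereal_scope.
Let om : {measure set Rn -> \bar R} := wmeas leb mw w0.
Let omE A : om A = \int[leb]_(x in A) (w x)%:E. Proof. by []. Qed.

Variable c : R.
Hypothesis c1 : (1 <= c)%R.
Hypothesis om_fin : forall a l, (0 < l)%R -> om (hcube a l) < +oo.
Hypothesis density : forall a l, (0 < l)%R ->
  leb (hcube a l) <= 2%:E *
    leb (hcube a l `&` [set x | om (hcube a l) < (c * w x)%:E * leb (hcube a l)]).

Let mlt (s : R) : measurable [set x | (s < w x)%R].
Proof. exact: measurable_lt. Qed.

Lemma measurable_gtc (s : R) : measurable [set x : Rn | (s < c * w x)%R].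
Proof. by apply: measurable_lt => //; exact: measurable_funM. Qed.

Lemma leb_hcube_fin a l : (0 < l)%R -> leb (hcube a l) < +oo.
Proof. by move=> l0; rewrite leb_hcube ?ltry// ltW. Qed.

(** Off the stopped cubes the mass of every measurable set is at most [t] times its
    volume, which forces the density to be at most [t] there. *)
Lemma om_never_stopped0 (t : R) a l : (0 < t)%R -> (0 < l)%R ->
  om ([set x | (t < w x)%R] `&` never_stopped om t a l) = 0.
Proof.
move=> t0 l0; set S := never_stopped om t a l.
have mS : measurable S by apply: bigcapT_measurable => i; exact: measurable_unstopped.
pose s (k : nat) : R := (t + k.+1%:R^-1)%R.
pose B k := [set x | (s k < w x)%R] `&` S.
have mB k : measurable (B k) by apply: measurableI.
have lebS : leb S < +oo.
  apply: le_lt_trans (leb_hcube_fin a l0); apply: le_measure; rewrite ?inE//.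
    exact: measurable_hcube.
  by move=> x /(_ 0%N I)[].
have omB k : om (B k) = 0.
  have H : om (B k) <= t%:E * leb (B k).
    exact: (om_never_stopped (om := om) (ltW t0) l0 (om_fin _ l0) (mlt (s k))).
  have H2 : (s k)%:E * leb (B k) <= om (B k).
    rewrite omE -nint_cst//; apply: nint_le => //.
      by move=> x; rewrite addr_ge0 ?ltW.
    by move=> x [/ltW].
  have leb0 : leb (B k) = 0.
    have lebB : leb (B k) \is a fin_num.
      rewrite ge0_fin_numE//; apply: le_lt_trans lebS; apply: le_measure; rewrite ?inE//.
      by move=> x [].
    move: (le_trans H2 H); have lebp : 0 <= leb (B k) by exact: measure_ge0.
    move: lebB lebp.
    case: (leb (B k)) => // r _; rewrite -!EFinM !lee_fin => r0 H3.
    congr (_%:E); apply/eqP; rewrite eq_le r0 andbT leNgt; apply/negP => rgt0.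
    by move: H3; rewrite ler_pM2r// gerDl leNgt invr_gt0 ltr0n.
  apply/eqP; rewrite eq_le measure_ge0 andbT; apply: le_trans H _.
  by rewrite leb0 mule0.
have UB : [set x | (t < w x)%R] `&` S = \bigcup_k B k.
  apply/seteqP; split=> [x [/= tw Sx]|x [k _ [/= sw Sx]]].
    exists (Num.truncn (w x - t)^-1) => //; split => //=.
    rewrite /s -ltrBrDl invf_plt ?posrE ?subr_gt0//; exact: truncnS_gt.
  by split => //=; apply: lt_trans sw; rewrite /s ltrDl invr_gt0.
rewrite UB; apply/eqP; rewrite -measure_le0.
apply: le_trans (measure_sigma_subadditive _ mB (bigcupT_measurable _ mB) (fun=> id)) _.
by rewrite eseries0// => k _ _; rewrite omB.
Qed.

(** By the density hypothesis half of each stopped cube lies in [t < c * w], so that the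
    mass above level [t] is controlled by the volume of a superlevel set of [w]. *)
Lemma weak_type (t : R) a l : (0 < t)%R -> (0 < l)%R ->
  om (hcube a l) <= t%:E * leb (hcube a l) ->
  om (hcube a l `&` [set x | (t < w x)%R]) <=
  (2 ^+ n.+1 * t)%:E * leb (hcube a l `&` [set x | (t < c * w x)%R]).
Proof.
move=> t0 l0 light; set H := hcube a l; set A := mkset _; set G := mkset _.
have mH : measurable H by exact: measurable_hcube.
have mA : measurable A := mlt t.
have mG : measurable G := measurable_gtc t.
pose St m := stopped om t m a l.
have mSt m : measurable (St m) by exact: measurable_stopped.
have C0 : (0 <= 2 ^+ n.+1 * t)%R by rewrite mulr_ge0// ltW// exprn_gt0.
have HSt m : om (St m) <= (2 ^+ n.+1 * t)%:E * leb (H `&` G).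
  have := @om_stopped _ n om t _ G m a l C0 mG _ l0.
  rewrite /heavy -leNgt => /(_ _ light) H1.
  apply: (@le_trans _ _ ((2 ^+ n.+1 * t)%:E * leb (stopped om t m a l `&` G))).
    apply: H1 => b h h0 hv omb; apply: le_trans omb _.
    rewrite exprS -mulrA [X in _ <= X * _]EFinM [2%:E * _]muleC -muleA.
    apply: lee_wpmul2l; first by rewrite lee_fin mulr_ge0// ltW// exprn_gt0.
    apply: le_trans (density b h0) _; apply: lee_wpmul2l => //.
    have mb : measurable (hcube b h) by exact: measurable_hcube.
    have fb : leb (hcube b h) \is a fin_num by rewrite ge0_fin_numE// leb_hcube_fin.
    have fo : om (hcube b h) \is a fin_num by rewrite ge0_fin_numE// om_fin.
    apply: le_measure; rewrite ?inE.
    - apply: measurableI => //.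
      rewrite -(fineK fb) -(fineK fo); under eq_set do rewrite -EFinM lte_fin.
      by apply: measurable_lt => //; apply: measurable_funM => //; exact: measurable_funM.
    - exact: measurableI.
    move=> x [bx /= omx]; split => //=.
    have := lt_trans hv omx; rewrite -(fineK fb) -!EFinM lte_fin.
    by rewrite ltr_pM2r// fine_gt0// leb_hcube_fin// leb_hcube ?lte_fin ?exprn_gt0// ltW.
  apply: lee_wpmul2l; first by rewrite lee_fin.
  apply: le_measure; rewrite ?inE; [|exact: measurableI|].
    by apply: measurableI => //; exact: measurable_stopped.
  by move=> x [Sx Gx]; split => //; exact: (stopped_sub (ltW l0) Sx).
have mUS : measurable (\bigcup_m St m) by apply: bigcupT_measurable.
have USt : om (\bigcup_m St m) <= (2 ^+ n.+1 * t)%:E * leb (H `&` G).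
  have cv : om (St m) @[m --> \oo] --> om (\bigcup_m St m).
    apply: nondecreasing_cvg_mu => //; apply/nondecreasing_seqP => m.
    by apply/subsetPset; exact: stopped_mono.
  rewrite -(cvg_lim _ cv)//; apply: lime_le; first by apply/cvg_ex; eexists; exact: cv.
  by apply: nearW => m; exact: HSt.
have mN : measurable (A `&` never_stopped om t a l).
  by apply: measurableI => //; apply: bigcapT_measurable => i; exact: measurable_unstopped.
apply: (@le_trans _ _ (om ((\bigcup_m St m) `|` (A `&` never_stopped om t a l)))).
  apply: le_measure; rewrite ?inE; [exact: measurableI|exact: measurableU|].
  move=> x [Hx Ax]; have [[m Sm]|nS] := pselect (exists m, St m x); first by left; exists m.
  by right; split => // m _; split => // Sx; apply: nS; exists m.
apply: le_trans (measureU2 _ _ _) _ => //.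
have N0 : om (A `&` never_stopped om t a l) = 0 by exact: om_never_stopped0.
by rewrite -[leRHS]adde0; apply: leeD => //; rewrite le_eqVlt; apply/orP; left; apply/eqP; exact: N0.
Qed.

Lemma indic_pred (P : pred Rn) x : \1_[set x | P x] x = (P x)%:R :> R.
Proof. by rewrite indicE; congr (nat_of_bool _)%:R; apply/idP/idP; rewrite inE. Qed.

Lemma measurable_fun_powR (f : Rn -> R) (p : R) :
  measurable_fun setT f -> measurable_fun setT (fun x => f x `^ p)%R.
Proof. by move=> mf; exact: (measurableT_comp (measurable_powR p)). Qed.

Lemma om_gt0 a l : (0 < l)%R -> 0 < om (hcube a l).
Proof.
move=> l0; have mH : measurable (hcube a l) by exact: measurable_hcube.
rewrite lt_neqAle measure_ge0 andbT eq_sym; apply/negP => /eqP oH.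
have mE : measurable_fun (hcube a l) (EFin \o w).
  by apply/measurable_EFinP; exact: measurable_funTS.
have /(_ mE)[+ _] := @ae_eq_integral_abs _ _ _ leb _ mH (EFin \o w).
rewrite (_ : \int[leb]_(x in _) `|_| = om (hcube a l)); last first.
  by apply: eq_integral => x _ /=; rewrite ger0_norm// ltW.
move=> /(_ oH) N.
have : leb.-negligible (hcube a l).
  apply: negligibleS N => x Hx /=; move=> /(_ Hx)/= [] wx.
  by have := w0 x; rewrite wx ltxx.
move=> neg; have : leb (hcube a l) = 0 := measure_negligible mH neg.
rewrite (leb_hcube _ (ltW l0)) => -[].
by apply/eqP; rewrite expf_neq0// gt_eqF.
Qed.

(** The Coifman-Fefferman argument: integrate [weak_type] over the dyadic levels above the mean of
    [w].  The right-hand side reproduces the integral of [w `^ (1 + del)], truncated at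
    level [K], with a factor at most 1/2 when [del] is small, and is absorbed. *)
Lemma reverse_holder (del : R) a l : (0 < del)%R -> (0 < l)%R ->
  (2 ^+ n.+2 * (2 `^ del - 1) * c `^ (1 + del) <= 2^-1)%R ->
  \int[leb]_(x in hcube a l) (w x `^ (1 + del))%:E <=
  (2 * (fine (om (hcube a l)) / l ^+ n) `^ del * fine (om (hcube a l)))%:E.
Proof.
move=> d0 l0 small; set H := hcube a l.
have mH : measurable H by exact: measurable_hcube.
set o := fine (om H).
have omH : om H = o%:E by rewrite fineK// ge0_fin_numE// om_fin.
have ln0 : (0 < l ^+ n)%R by rewrite exprn_gt0.
have lH : leb H = (l ^+ n)%:E by rewrite leb_hcube// ltW.
have o0 : (0 < o)%R by rewrite fine_gt0// om_fin// om_gt0.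
set tau := (o / l ^+ n)%R.
have tau0 : (0 < tau)%R by rewrite divr_gt0.
pose t k : R := (tau * 2 ^+ k)%R.
have t0 k : (0 < t k)%R by rewrite mulr_gt0// exprn_gt0.
have tauH : om H = tau%:E * leb H by rewrite lH -EFinM omH divfK// gt_eqF.
have D0 : (0 <= 2 `^ del - 1 :> R)%R.
  by rewrite subr_ge0 -[leLHS](powRr0 2); apply: ler_powR; rewrite ?(ltW d0)// ler1n.
pose v K x := Num.min (w x) (t K).
have v0 K x : (0 < v K x)%R by rewrite lt_min w0 t0.
have mv K : measurable_fun setT (v K) by apply: measurable_minr.
pose h K x := (v K x `^ del * w x)%R.
have h0 K x : (0 <= h K x)%R by apply: mulr_ge0; [exact: powR_ge0|exact: ltW].
have mh K : measurable_fun setT (h K).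
  by apply: measurable_funM => //; exact: measurable_fun_powR.
pose D k := ((2 `^ del - 1) * (t k) `^ del)%R.
have Dk0 k : (0 <= D k)%R by rewrite mulr_ge0 ?powR_ge0.
pose A k := [set x | (t k < w x)%R].
pose G k := [set x | (t k < c * w x)%R].
have mA k : measurable (A k) by exact: mlt.
have mG k : measurable (G k) by exact: measurable_gtc.
have m1 (B : set Rn) : measurable B -> measurable_fun setT (\1_B : Rn -> R) by move=> mB; exact: measurable_indic.
have i0 (B : set Rn) x : (0 <= \1_B x :> R)%R by rewrite indicE ler0n.
have AW0 k x : (0 <= \1_(A k) x * w x)%R by apply: mulr_ge0 => //; exact: ltW.
have DA0 k x : (0 <= D k * (\1_(A k) x * w x))%R by exact: mulr_ge0.
have E0 k : (0 <= 2 ^+ n.+1 * (D k * t k))%R.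
  by apply: mulr_ge0; [exact: exprn_ge0|apply: mulr_ge0 => //; exact: ltW].
have DG0 k x : (0 <= 2 ^+ n.+1 * (D k * t k) * \1_(G k) x)%R by exact: mulr_ge0.
pose I K := \int[leb]_(x in H) (h K x)%:E.
have bound K : I K <= (2 * tau `^ del * o)%:E.
  have Ifin : I K < +oo.
    apply: (@le_lt_trans _ _ (\int[leb]_(x in H) (t K `^ del * w x)%:E)).
      apply: nint_le => //; first exact: measurable_funM.
      move=> x _; rewrite ler_pM2r//; apply: ge0_ler_powR; rewrite ?nnegrE; try exact: ltW.
      by rewrite ge_min lexx orbT.
    rewrite nintZ//; [|by move=> x; exact: ltW|exact: powR_ge0].
    by rewrite -omE omH -EFinM ltry.
  have I0 : 0 <= I K by exact: nint_ge0.
  have s1 : I K <= (tau `^ del)%:E * om H + \sum_(k < K) (D k)%:E * om (H `&` A k).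
    apply: (@le_trans _ _ (\int[leb]_(x in H) (tau `^ del * w x +
         \sum_(k < K) D k * (\1_(A k) x * w x))%:E)).
      have mS : measurable_fun setT (fun x => \sum_(k < K) D k * (\1_(A k) x * w x))%R.
        apply: measurable_sum => k; apply: measurable_funM => //.
        exact: measurable_funM.
      apply: nint_le => //; first by apply: measurable_funD => //; exact: measurable_funM.
      move=> x _; rewrite /h; apply: le_trans (_ : (tau `^ del +
        \sum_(k < K) D k * (t k < w x)%R%:R) * w x <= _)%R.
        by rewrite ler_pM2r//; exact: layer_up.
      rewrite mulrDl lerD2l mulr_suml; apply: ler_sum => k _.
      by rewrite indic_pred mulrA.
    rewrite nintD//; last first.
    - by move=> x; apply: sumr_ge0 => k _; exact: DA0.
    - by move=> x; apply: mulr_ge0; [exact: powR_ge0|exact: ltW].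
    - apply: measurable_sum => k; apply: measurable_funM => //.
      exact: measurable_funM.
    - exact: measurable_funM.
    rewrite nintZ//; [|by move=> x; exact: ltW|exact: powR_ge0].
    rewrite leeD2l// nint_sum//; last first.
    - by move=> k; apply: measurable_funM => //; exact: measurable_funM.
    apply: lee_sum => k _; rewrite nintZ//; last exact: measurable_funM.
    by rewrite nint_indicM.
  have s2 : \sum_(k < K) (D k)%:E * om (H `&` A k) <= (2^-1)%:E * I K.
    apply: (@le_trans _ _ (\sum_(k < K) (2 ^+ n.+1 * (D k * t k))%:E * leb (H `&` G k))).
      apply: lee_sum => k _.
      rewrite (_ : 2 ^+ n.+1 * (D k * t k) = D k * (2 ^+ n.+1 * t k))%R; last by ring.
      rewrite [X in _ <= X * _]EFinM -muleA; apply: lee_wpmul2l; first by rewrite lee_fin.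
      apply: weak_type => //; rewrite tauH; apply: lee_wpmul2r; first exact: measure_ge0.
      by rewrite lee_fin /t ler_peMr ?(ltW tau0)// exprn_ege1// ler1n.
    rewrite -nintZ ?invr_ge0//.
    apply: (@le_trans _ _ (\int[leb]_(x in H)
      (\sum_(k < K) (2 ^+ n.+1 * (D k * t k)) * \1_(G k) x)%:E)).
      rewrite nint_sum//; last by move=> k; exact: measurable_funM.
      apply: lee_sum => k _; by rewrite nintZ// nint_indic.
    apply: nint_le => //.
    - by apply: measurable_sum => k; exact: measurable_funM.
    - exact: measurable_funM.
    - by move=> x; apply: sumr_ge0 => k _; exact: DG0.
    move=> x _.
    have := @layer_down _ tau del (w x) c K tau0 d0 (w0 x) c1.
    rewrite -/(t K) -/(v K x) -/(h K x) => L.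
    apply: (@le_trans _ _ (2 ^+ n.+1 * (2 * (2 `^ del - 1) * c `^ (1 + del) * h K x))%R).
      apply: le_trans (_ : (2 ^+ n.+1 * (\sum_(k < K) ((2 `^ del - 1) * (t k) `^ del) *
        (t k) * (t k < c * w x)%R%:R) <= _)%R); last first.
        by rewrite ler_pM2l ?exprn_gt0//; exact: L.
      rewrite mulr_sumr; apply: ler_sum => k _; rewrite indic_pred /D -/(t k).
      by rewrite !mulrA.
    rewrite mulrA; apply: ler_wpM2r => //.
    apply: le_trans small; rewrite [X in (_ <= X * _ * _)%R]exprS le_eqVlt; apply/orP; left; apply/eqP; ring.
  have := le_trans s1 (leeD2l _ s2).
  rewrite omH; move: I0 Ifin; case: (I K) => // r r0 _.
  rewrite -!EFinM -EFinD !lee_fin; lra.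
have -> : \int[leb]_(x in H) (w x `^ (1 + del))%:E =
    \int[leb]_(x in H) limn (fun K => (h K x)%:E).
  apply: eq_integral => x _; apply/esym/cvg_lim => //.
  apply: cvg_near_cst; exists (Num.truncn (w x / tau)) => // K /= HK.
  rewrite /h /v min_l; first by rewrite powRD ?(gt_eqF (w0 x)) ?implybT// powRr1 ?(ltW (w0 x))// mulrC.
  rewrite /t -ler_pdivrMl// mulrC; apply/ltW/(lt_le_trans (truncnS_gt _)).
  rewrite -natrX ler_nat; apply: leq_trans (ltn_expl K (ltnSn 1)); by rewrite ltnS.
rewrite monotone_convergence//; last 3 first.
- by move=> K; apply/measurable_EFinP; exact: measurable_funTS.
- by move=> K x _; rewrite lee_fin.
- move=> x _ K K' KK'; rewrite lee_fin /h ler_pM2r//.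
  apply: ge0_ler_powR; rewrite ?nnegrE; try exact: ltW.
  rewrite le_min ge_min lexx/= ge_min; apply/orP; right.
  by rewrite /t ler_pM2l// ler_eXn2l// ltr1n.
apply: lime_le; last by apply: nearW => K; exact: bound.
apply: ereal_nondecreasing_is_cvgn => K K' KK'; apply: nint_le => //.
move=> x _; rewrite /h ler_pM2r//; apply: ge0_ler_powR; rewrite ?nnegrE; try exact: ltW.
rewrite le_min ge_min lexx/= ge_min; apply/orP; right.
by rewrite /t ler_pM2l// ler_eXn2l// ltr1n.
Qed.

End ReverseHolder.

(** * Exponents and constants *)

Section Exponents.
Variable R : realType.
Implicit Types (p x : R).

Lemma dual_exponentE p : 1 < p -> dual_exponent p = p / (p - 1).
Proof.
move=> p1; rewrite /dual_exponent.
have p0 : p != 0 by rewrite gt_eqF//; lra.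
have p10 : p - 1 != 0 by rewrite gt_eqF//; lra.
by rewrite -[1]divr1 -(mulfV p0) ; field; rewrite p0 p10.
Qed.

Lemma one_sub_dual p : 1 < p -> 1 - dual_exponent p = - (p - 1)^-1.
Proof. by move=> p1; rewrite dual_exponentE//; field; rewrite gt_eqF//; lra. Qed.

Lemma dual_gt1 p : 1 < p -> 1 < dual_exponent p.
Proof.
move=> p1; have := one_sub_dual p1.
have : 0 < (p - 1)^-1 by rewrite invr_gt0; lra.
lra.
Qed.

Lemma bernoulli s x : 0 <= s <= 1 -> 0 <= x -> x `^ s <= 1 + s * (x - 1).
Proof.
move=> /andP[]; rewrite le_eqVlt => /predU1P[<- _ _|s0].
  by rewrite powRr0 mul0r addr0.
rewrite le_eqVlt => /predU1P[-> x0|s1 x0]; first by rewrite powRr1//; lra.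
have s10 : 0 < 1 - s by lra.
have := @conjugate_powR _ (x `^ s) 1 s^-1 (1 - s)^-1 (powR_ge0 _ _) ler01.
rewrite !invr_gt0 !invrK mulr1 powR1 mul1r -powRrM mulfV ?gt_eqF// powRr1//.
move=> /(_ s0 s10); rewrite addrC subrK => /(_ erefl); lra.
Qed.

(** The conjugate exponent of [1 + (rh_exp n p K - 1)^-1]. *)
Definition rh_exp (n : nat) p K : R := 2 `^ (n%:R + 2 + 2 * p) * K.

(** Smallness condition of [reverse_holder] for the density constant
    [c = 2 `^ (p - 1) * K] of an A_p weight. *)
Lemma rh_constant (n : nat) p K : 1 < p -> 1 <= K ->
  0 < (rh_exp n p K - 1)^-1 /\
  2 ^+ n.+2 * (2 `^ (rh_exp n p K - 1)^-1 - 1) *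
    (2 `^ (p - 1) * K) `^ (1 + (rh_exp n p K - 1)^-1) <= 2^-1.
Proof.
move=> p1 K1; set r' := rh_exp n p K; set del := (r' - 1)^-1.
set c := 2 `^ (p - 1) * K.
have K0 : 0 < K by lra.
have two0 : (0 : R) < 2 by lra.
have pw a : 0 < 2 `^ a :> R by rewrite powR_gt0.
have c1 : 1 <= c.
  rewrite -[1]mulr1; apply: ler_pM => //.
  by rewrite -[leLHS](powRr0 2); apply: ler_powR; [rewrite ler1n|lra].
have c0 : 0 < c by lra.
(* The exponent r' dominates 16 c, which makes del c small. *)
have r'E : r' = 2 ^+ n.+2 * 2 * 2 `^ p * c.
  rewrite /r' /rh_exp /c mulrA; congr (_ * K).
  rewrite (_ : _ * 2 `^ (p - 1) = 2 ^+ n.+2 * (2 * (2 `^ (p - 1) * 2 `^ p))); last by ring.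
  have -> : 2 * (2 `^ (p - 1) * 2 `^ p) = 2 `^ (2 * p) :> R.
    rewrite mulrA -[X in X * _ * _](powRr1 (ltW two0)) -!powRD ?(gt_eqF two0) ?implybT//.
    by congr (2 `^ _); ring.
  rewrite -powR_mulrn ?(ltW two0)// -powRD ?(gt_eqF two0) ?implybT//.
  by congr (2 `^ _); rewrite -!natr1; ring.
have p2 : 2 <= 2 `^ p :> R.
  by rewrite -[leLHS](powRr1 (ltW two0)); apply: ler_powR; [rewrite ler1n|lra].
have N4 : 4 <= 2 ^+ n.+2 :> R.
  have : 1 <= 2 ^+ n :> R by rewrite exprn_ege1// ler1n.
  rewrite !exprS; lra.
set N := 2 ^+ n.+2 in r'E N4 *.
have Nc : 4 * c <= N * c by rewrite ler_pM2r.
have r'1 : 4 * (N * c) <= r'.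
  rewrite r'E (_ : N * 2 * 2 `^ p * c = (N * c) * 2 * 2 `^ p); last by ring.
  have : N * c * 2 * 2 <= N * c * 2 * 2 `^ p.
    have : 0 < 4 * c by rewrite mulr_gt0.
    by move=> ?; rewrite ler_pM2l//; lra.
  lra.
have r'16 : 16 * c <= r' by lra.
have r10 : 0 < r' - 1 by lra.
have del0 : 0 < del by rewrite invr_gt0.
have del1 : del <= 1 by rewrite invf_le1//; lra.
have S1 : 2 `^ del - 1 <= del.
  by have := @bernoulli del 2; rewrite ltW// del1 => /(_ isT (ltW two0)); lra.
have S2 : c `^ del <= 1 + del * (c - 1).
  by apply: bernoulli; [rewrite ltW|exact: ltW].
have delE : del * (r' - 1) = 1 by rewrite mulVf// gt_eqF.
have dN : 3 * (del * (N * c)) <= 1.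
  rewrite -[leRHS]delE (_ : 3 * _ = del * (3 * (N * c))); last by ring.
  by rewrite ler_pM2l//; lra.
have dc : 12 * (del * c) <= 1.
  apply: le_trans dN; rewrite (_ : 3 * _ = del * (3 * (N * c))); last by ring.
  by rewrite (_ : 12 * _ = del * (12 * c)) ?ler_pM2l//; [lra|ring].
rewrite powRD ?(gt_eqF c0) ?implybT// powRr1 ?(ltW c0)//.
split => //.
have N0 : 0 < N by lra.
apply: (@le_trans _ _ (N * del * (c * (1 + del * c)))).
  apply: ler_pM.
  - apply: mulr_ge0; first exact: ltW.
    by rewrite subr_ge0 -[leLHS](powRr0 2); apply: ler_powR; rewrite ?(ltW del0)// ler1n.
  - by apply: mulr_ge0; [exact: ltW|exact: powR_ge0].
  - by rewrite ler_pM2l.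
  - rewrite ler_pM2l//; apply: le_trans S2 _; rewrite lerD2l ler_pM2l//; lra.
rewrite (_ : N * del * (c * (1 + del * c)) = (del * (N * c)) * (1 + del * c)); last by ring.
have dNc0 : 0 < del * (N * c) by apply: mulr_gt0 => //; exact: mulr_gt0.
apply: (@le_trans _ _ (3^-1 * (1 + 12^-1))); last by lra.
by apply: ler_pM; [exact: ltW|by have := mulr_gt0 del0 c0; lra|lra|lra].
Qed.

End Exponents.

(** * Muckenhoupt weights multiplied by an exponential *)

Section ApReal.
Variables (R : realType) (n : nat).
Local Notation Rn := (Rn R n).
Local Notation leb := (@lebesgue_Rn R n).
Implicit Types (w phi : Rn -> R) (p K W V kap : R) (a : 'I_n -> R) (l : R).

(** The A_p condition on half-open cubes with real means: [W] and [V] are the means of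
    the weight and of its dual weight. *)
Definition Ap_on w p K := forall a l, 0 < l -> exists W V,
  [/\ 0 < W, 0 < V,
      (\int[leb]_(x in hcube a l) (w x)%:E = (W * l ^+ n)%:E)%E,
      (\int[leb]_(x in hcube a l) (w x `^ (- (p - 1)^-1))%:E = (V * l ^+ n)%:E)%E &
      W * V `^ (p - 1) <= K].

Lemma powRVl (x y : R) : 0 < x -> (x^-1) `^ y = (x `^ y)^-1.
Proof. by move=> x0; rewrite -powR_inv1 ?ltW// -powRrM mulN1r powRN. Qed.

Lemma expR_powR_le (kap q y : R) : 0 < kap -> 0 < q ->
  ((2 `^ kap)^-1 * expR y) `^ q <= (2^-1 * expR (`|y| / kap)) `^ (q * kap).
Proof.
move=> kap0 q0; have ki0 : 0 <= (2 `^ kap)^-1 :> R by rewrite invr_ge0 powR_ge0.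
have two0 : (0 : R) < 2 by [].
have expP (x t : R) : expR x `^ t = expR (t * x) by rewrite /powR gt_eqF ?expR_gt0// expRK.
have -> : ((2 `^ kap)^-1 * expR y) `^ q = (2 `^ (q * kap))^-1 * expR (q * y).
  by rewrite (powRM _ ki0 (expR_ge0 y)) expP (powRVl q (powR_gt0 kap two0)) -powRrM [kap * q]mulrC.
have -> : (2^-1 * expR (`|y| / kap)) `^ (q * kap) = (2 `^ (q * kap))^-1 * expR (q * kap * (`|y| / kap)).
  by rewrite powRM ?expR_ge0 ?invr_ge0 ?(ltW two0)// expP (powRVl _ two0).
apply: ler_wpM2l; first by rewrite invr_ge0 powR_ge0.
rewrite ler_expR -mulrA; apply: ler_wpM2l; first exact: ltW.
by rewrite mulrC divfK ?gt_eqF// ler_norm.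
Qed.

Lemma nint_cube_cst a l (k : R) : 0 < l ->
  (\int[leb]_(x in hcube a l) k%:E = (k * l ^+ n)%:E)%E.
Proof.
move=> l0; rewrite (nint_cst leb k (measurable_hcube a l)).
by rewrite EFinM; congr (_ * _)%E; exact: leb_hcube (ltW l0).
Qed.

Lemma Ap_on_dual w p K : 1 < p -> (forall x, 0 < w x) -> 0 <= K -> Ap_on w p K ->
  Ap_on (fun x => w x `^ (- (p - 1)^-1)) (dual_exponent p) (K `^ (p - 1)^-1).
Proof.
move=> p1 w0 K0 H a l l0; have [W [V [W0 V0 iW iV WV]]] := H a l l0.
have q0 : 0 < (p - 1)^-1 by rewrite invr_gt0; lra.
have E : dual_exponent p - 1 = (p - 1)^-1 by have := one_sub_dual p1; lra.
exists V, W; split => //.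
  rewrite -iW; apply: eq_integral => x _; congr (_%:E).
  rewrite E invrK -powRrM mulrNN mulVf ?powRr1//; first exact: ltW.
  by rewrite gt_eqF//; lra.
rewrite E; have : (W * V `^ (p - 1)) `^ (p - 1)^-1 <= K `^ (p - 1)^-1.
  apply: ge0_ler_powR WV; rewrite ?nnegrE// ?ltW//.
  by apply: mulr_gt0 => //; exact: powR_gt0.
rewrite powRM ?powR_ge0 ?(ltW W0)// -powRrM mulfV; last by rewrite gt_eqF//; lra.
by rewrite powRr1 ?(ltW V0)// mulrC.
Qed.

(** Hoelder's inequality between [w] and its dual weight on one cube, obtained by
    integrating Young's inequality. *)
Lemma Ap_on_ge1 w p K : 1 < p -> measurable_fun setT w -> (forall x, 0 < w x) ->
  Ap_on w p K -> 1 <= K.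
Proof.
move=> p1 mw w0 /(_ (fun=> 0) 1 ltr01)[W [V [W0 V0 iW iV WV]]].
apply: le_trans WV; set H := hcube _ _ in iW iV.
have mH : measurable H by exact: measurable_hcube.
have p0 : 0 < p by lra.
have p10 : 0 < p - 1 by lra.
have [q' q'0] : exists2 q', 0 < q' & p^-1 + q'^-1 = 1.
  exists (p / (p - 1)); first by rewrite divr_gt0.
  by field; rewrite !gt_eqF.
move=> pq.
have q'E : q'^-1 = (p - 1) / p.
  have -> : q'^-1 = 1 - p^-1 by lra.
  by field; rewrite gt_eqF.
(* Young's inequality, normalised by both means *)
have young x : (W `^ p^-1 * V `^ q'^-1)^-1 <=
    p^-1 * (W^-1 * w x) + q'^-1 * (V^-1 * w x `^ (- (p - 1)^-1)).
  have := @conjugate_powR _ ((W^-1 * w x) `^ p^-1) ((V^-1 * w x `^ (- (p - 1)^-1)) `^ q'^-1) p q'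
    (powR_ge0 _ _) (powR_ge0 _ _) p0 q'0 pq.
  have Wi0 : 0 < W^-1 by rewrite invr_gt0.
  have Vi0 : 0 < V^-1 by rewrite invr_gt0.
  have wq0 : 0 < w x `^ (- (p - 1)^-1) by exact: powR_gt0.
  rewrite -!powRrM !mulVf ?gt_eqF// !powRr1; try by apply/ltW/mulr_gt0.
  rewrite [p^-1 * _]mulrC [q'^-1 * _]mulrC; apply: le_trans.
  rewrite !powRM ?(ltW Wi0) ?(ltW Vi0) ?(ltW (w0 x)) ?(ltW wq0)//.
  rewrite mulrACA -[X in _ <= _ * (_ * X)]powRrM -powRD; last by rewrite (gt_eqF (w0 x)) implybT.
  have -> : p^-1 + - (p - 1)^-1 * q'^-1 = 0 by rewrite q'E; field; rewrite !gt_eqF.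
  by rewrite powRr0 mulr1 !powRVl// -invfM.
have iY : (\int[leb]_(x in H) (p^-1 * (W^-1 * w x) + q'^-1 * (V^-1 * w x `^ (- (p - 1)^-1)))%:E = 1)%E.
  have mwq : measurable_fun setT (fun x => w x `^ (- (p - 1)^-1)) by exact: measurable_fun_powR.
  have pi0 : 0 <= p^-1 by rewrite invr_ge0 ltW.
  have qi0 : 0 <= q'^-1 by rewrite invr_ge0 ltW.
  have Wi0 : 0 <= W^-1 by rewrite invr_ge0 ltW.
  have Vi0 : 0 <= V^-1 by rewrite invr_ge0 ltW.
  have w0' x : 0 <= w x by exact: ltW.
  have wq0' x : 0 <= w x `^ (- (p - 1)^-1) by exact: powR_ge0.
  have ww x : 0 <= W^-1 * w x by exact: mulr_ge0.
  have vv x : 0 <= V^-1 * w x `^ (- (p - 1)^-1) by exact: mulr_ge0.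
  rewrite nintD//; last 4 first.
  - by apply: measurable_funM => //; exact: measurable_funM.
  - by apply: measurable_funM => //; exact: measurable_funM.
  - by move=> x; exact: mulr_ge0.
  - by move=> x; exact: mulr_ge0.
  rewrite !nintZ//; try exact: measurable_funM.
  rewrite iW iV -!EFinM -EFinD; congr (_%:E).
  by rewrite expr1n !mulr1 !mulVf ?gt_eqF// !mulr1.
have : ((W `^ p^-1 * V `^ q'^-1)^-1%:E <= 1)%E.
  rewrite -[leLHS]mule1 -[X in (_ * X)%E](_ : ((1 : R) ^+ n)%:E = 1%E); last by rewrite expr1n.
  rewrite -EFinM -(nint_cube_cst (fun=> 0) _ ltr01) -iY; apply: nint_le => //.
  - apply: measurable_funD; apply: measurable_funM => //; apply: measurable_funM => //.
    exact: measurable_fun_powR.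
  - by move=> x; rewrite invr_ge0 mulr_ge0 ?powR_ge0.
rewrite lee_fin invf_le1 ?mulr_gt0 ?powR_gt0// => H1.
have : 1 `^ p <= (W `^ p^-1 * V `^ q'^-1) `^ p.
  by apply: ge0_ler_powR; rewrite ?nnegrE ?mulr_ge0 ?powR_ge0// ltW.
rewrite powR1 powRM ?powR_ge0// -!powRrM mulVf ?gt_eqF// powRr1 ?(ltW W0)//.
by rewrite q'E divfK// gt_eqF.
Qed.

(** On the part where [c * w] is at most the mean [W] of [w], the dual weight is at least
    [(W / c) `^ (- (p - 1)^-1)]; the A_p condition bounds the volume of this part by half
    of the cube. *)
Lemma Ap_on_density w p K a l : 1 < p -> measurable_fun setT w -> (forall x, 0 < w x) ->
  Ap_on w p K -> 0 < l ->
  (leb (hcube a l) <= 2%:E * leb (hcube a l `&`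
    [set x | \int[leb]_(x in hcube a l) (w x)%:E <
             (2 `^ (p - 1) * K * w x)%:E * leb (hcube a l)]))%E.
Proof.
move=> p1 mw w0 HA l0; have K1 := Ap_on_ge1 p1 mw w0 HA.
have [W [V [W0 V0 iW iV WV]]] := HA a l l0.
set H := hcube a l in iW iV *.
have mH : measurable H by exact: measurable_hcube.
have ln0 : 0 < l ^+ n by rewrite exprn_gt0.
have lH : (leb H = (l ^+ n)%:E)%E by exact: leb_hcube (ltW l0).
set c := 2 `^ (p - 1) * K.
have c0 : 0 < c by apply: mulr_gt0; [exact: powR_gt0|lra].
have q0 : 0 < (p - 1)^-1 by rewrite invr_gt0; lra.
pose E := [set x | c * w x <= W].
have mE : measurable E by apply: measurable_le => //; exact: measurable_funM.
have -> : [set x | (\int[leb]_(x in H) (w x)%:E < (c * w x)%:E * leb H)%E] = ~` E.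
  apply/seteqP; split => x /=; rewrite iW lH -EFinM lte_fin ltr_pM2r// ltNge => /negP //.
have leE : (leb (H `&` E) <= (2^-1 * l ^+ n)%:E)%E.
  have s1 : (((W / c) `^ (- (p - 1)^-1))%:E * leb (H `&` E) <= (V * l ^+ n)%:E)%E.
    rewrite -iV -nint_cst; last exact: measurableI.
    apply: (@le_trans _ _ (\int[leb]_(x in H `&` E) (w x `^ (- (p - 1)^-1))%:E)%E).
      apply: nint_le => //; [exact: measurableI|exact: measurable_fun_powR|by move=> x; exact: powR_ge0|].
      - by move=> x [_ /= cw]; rewrite !powRN lef_pV2 ?posrE ?powR_gt0 ?divr_gt0//;
          apply: ge0_ler_powR; rewrite ?nnegrE ?(ltW q0) ?(ltW (w0 x)) ?divr_ge0 ?(ltW W0) ?(ltW c0)// ler_pdivlMr// mulrC.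
    apply: ge0_subset_integral => //; try exact: measurableI.
      by apply/measurable_EFinP/measurable_funTS; exact: measurable_fun_powR.
    by move=> x _; rewrite lee_fin powR_ge0.
  have fE : leb (H `&` E) \is a fin_num.
    rewrite ge0_fin_numE//; apply: (@le_lt_trans _ _ (leb H)).
      by apply: le_measure; rewrite ?inE//; exact: measurableI.
    by rewrite lH ltry.
  move: s1; rewrite -(fineK fE) -EFinM !lee_fin powRN ler_pdivrMl ?powR_gt0 ?divr_gt0//.
  move=> /le_trans; apply; rewrite mulrA ler_pM2r//.
  rewrite powRM ?(ltW W0) ?invr_ge0 ?(ltW c0)// powRVl// mulrAC.
  rewrite ler_pdivrMr ?powR_gt0//.
  have -> : W `^ (p - 1)^-1 * V = (W * V `^ (p - 1)) `^ (p - 1)^-1.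
    rewrite powRM ?powR_ge0 ?(ltW W0)// -powRrM mulfV ?powRr1 ?(ltW V0)//.
    by rewrite gt_eqF//; lra.
  apply: (@le_trans _ _ (K `^ (p - 1)^-1)).
    apply: ge0_ler_powR WV; rewrite ?nnegrE ?(ltW q0)//; last by lra.
    by apply: mulr_ge0; [exact: ltW|exact: powR_ge0].
  rewrite /c powRM ?powR_ge0//; last lra.
  rewrite -powRrM mulfV; last by rewrite gt_eqF//; lra.
  by rewrite powRr1// mulrA mulVf// mul1r.
have split : (leb H = leb (H `&` E) + leb (H `&` ~` E))%E.
  by rewrite -measureU ?setIUr//; [rewrite -setIUr setUv setIT|exact: measurableI|
    apply: measurableI => //; exact: measurableC|rewrite setIACA setICr setI0].
have fE' : leb (H `&` ~` E) \is a fin_num.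
  rewrite ge0_fin_numE//; apply: (@le_lt_trans _ _ (leb H)).
    by apply: le_measure; rewrite ?inE//; apply: measurableI => //; exact: measurableC.
  by rewrite lH ltry.
have fE : leb (H `&` E) \is a fin_num.
  rewrite ge0_fin_numE//; apply: le_lt_trans leE _; exact: ltry.
move: split leE; rewrite lH -(fineK fE) -(fineK fE') -EFinM -EFinD !lee_fin => -[]; lra.
Qed.

Lemma Ap_on_reverse_holder w p K a l : 1 < p -> measurable_fun setT w -> (forall x, 0 < w x) ->
  Ap_on w p K -> 0 < l -> forall W, (\int[leb]_(x in hcube a l) (w x)%:E = (W * l ^+ n)%:E)%E ->
  (\int[leb]_(x in hcube a l) (w x `^ (1 + (rh_exp n p K - 1)^-1))%:E <=
    (2 * W `^ (1 + (rh_exp n p K - 1)^-1) * l ^+ n)%:E)%E.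
Proof.
move=> p1 mw w0 HA l0 W iW; have K1 := Ap_on_ge1 p1 mw w0 HA.
have [d0 small] := rh_constant n p1 K1.
have ln0 : 0 < l ^+ n by rewrite exprn_gt0.
have c1 : 1 <= 2 `^ (p - 1) * K.
  rewrite -[leLHS]mulr1; apply: ler_pM => //.
  by rewrite -[leLHS](powRr0 2); apply: ler_powR; [rewrite ler1n|lra].
have W0 : 0 <= W.
  have : (0 <= (W * l ^+ n)%:E)%E by rewrite -iW; apply: nint_ge0 => x; exact: ltW.
  by rewrite lee_fin pmulr_lge0.
apply: le_trans (@reverse_holder _ n w mw w0 _ c1 _ _ _ a l d0 l0 small) _.
- move=> b h h0; have [W' [V' [_ _ iW' _ _]]] := HA b h h0.
  exact: (eq_ind_r (fun z => (z < +oo)%E) (ltry _) iW').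
- by move=> b h h0; exact: Ap_on_density.
rewrite [fine _](_ : _ = W * l ^+ n); last exact: (congr1 fine iW).
rewrite mulfK ?gt_eqF// lee_fin.
rewrite powRD; last by rewrite gt_eqF//; lra.
by rewrite powRr1// le_eqVlt; apply/orP; left; apply/eqP; ring.
Qed.

(** Young's inequality with exponents [r] and [r'] for the factors [w / (2 W)] and
    [e^(phi - c) / 2^kap]: the r-th power of the first is handled by the reverse Hoelder
    inequality; the r'-th power of the second is at most the power [r' * kap <= 1] of
    [e^(|phi - c| / kap) / 2], which is estimated by Bernoulli's inequality. *)
Lemma nint_perturb w p K a l phi kap c : 1 < p -> measurable_fun setT w -> (forall x, 0 < w x) ->
  Ap_on w p K -> 0 < l -> forall W, 0 < W ->
  (\int[leb]_(x in hcube a l) (w x)%:E = (W * l ^+ n)%:E)%E ->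
  measurable_fun setT phi -> 0 < kap -> rh_exp n p K * kap <= 1 ->
  (\int[leb]_(x in hcube a l) (expR (`|phi x - c| / kap))%:E <= (2 * l ^+ n)%:E)%E ->
  (\int[leb]_(x in hcube a l) (w x * expR (phi x))%:E <=
    (2 * 2 `^ kap * expR c * W * l ^+ n)%:E)%E.
Proof.
move=> p1 mw w0 HA l0 W W0 iW mphi kap0 r'kap osc.
have K1 := Ap_on_ge1 p1 mw w0 HA.
have := Ap_on_reverse_holder p1 mw w0 HA l0 iW.
set r' := rh_exp n p K in r'kap *; set r := 1 + (r' - 1)^-1 => RH.
have [d0 _] := rh_constant n p1 K1.
have r'1 : 1 < r' by move: d0; rewrite -/r' invr_gt0; lra.
have r'0 : 0 < r' by lra.
have r1 : 1 < r by rewrite /r -/r' in d0 *; lra.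
have r0 : 0 < r by lra.
have rr' : r^-1 + r'^-1 = 1 by rewrite /r; field; rewrite !gt_eqF//; lra.
have ln0 : 0 < l ^+ n by rewrite exprn_gt0.
set s := r' * kap.
have s0 : 0 < s by exact: mulr_gt0.
pose G x := expR (`|phi x - c| / kap).
have mG : measurable_fun setT G.
  apply: measurableT_comp; first exact: measurable_expR.
  apply: measurable_funM => //; apply: measurableT_comp => //.
  exact: measurable_funB.
have G0 x : 0 < G x by exact: expR_gt0.
pose U := 2 * W; have U0 : 0 < U by exact: mulr_gt0.
have two0 : (0 : R) < 2 by [].
have k2 : 0 < 2 `^ kap :> R by exact: powR_gt0.
have Ui0 : 0 < U^-1 by rewrite invr_gt0.
have ki0 : 0 < (2 `^ kap)^-1 :> R by rewrite invr_gt0.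
have wr0 x : 0 <= w x `^ r by exact: powR_ge0.
have key x : w x * expR (phi x) <= U * 2 `^ kap * expR c *
    (r^-1 * U^-1 `^ r * (w x `^ r) + r'^-1 * ((1 - s) + s / 2 * G x)).
  have e0 := expR_gt0 (phi x - c).
  have := @conjugate_powR _ (U^-1 * w x) ((2 `^ kap)^-1 * expR (phi x - c)) r r'
    (ltW (mulr_gt0 Ui0 (w0 x))) (ltW (mulr_gt0 ki0 e0)) r0 r'0 rr'.
  rewrite [(U^-1 * w x) `^ r]powRM ?(ltW Ui0) ?(ltW (w0 x))//.
  have B : ((2 `^ kap)^-1 * expR (phi x - c)) `^ r' <= (1 - s) + s / 2 * G x.
    have g0 : 0 <= 2^-1 * G x by apply: mulr_ge0; [rewrite invr_ge0|exact: ltW].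
    apply: (@le_trans _ _ ((2^-1 * G x) `^ s)); last first.
      have s01 : 0 <= s <= 1 by rewrite (ltW s0).
      by apply: le_trans (bernoulli s01 g0) _; lra.
    exact: expR_powR_le.
  move=> Y; rewrite -subr_ge0.
  have -> : expR (phi x) = expR c * expR (phi x - c) by rewrite -expRD addrC subrK.
  have C0 : 0 < U * 2 `^ kap * expR c by rewrite !mulr_gt0// expR_gt0.
  have -> : w x * (expR c * expR (phi x - c)) =
    U * 2 `^ kap * expR c * (U^-1 * w x * ((2 `^ kap)^-1 * expR (phi x - c))).
    by field; rewrite !gt_eqF.
  rewrite subr_ge0 ler_pM2l//; apply: le_trans Y _; apply: lerD.
    by rewrite le_eqVlt; apply/orP; left; apply/eqP; ring.
  by rewrite mulrC ler_pM2l// invr_gt0.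
set C := U * 2 `^ kap * expR c in key.
have C0 : 0 < C by rewrite !mulr_gt0// expR_gt0.
have mH : measurable (hcube a l) by exact: measurable_hcube.
have ri0 : 0 <= r^-1 by rewrite invr_ge0 ltW.
have r'i0 : 0 <= r'^-1 by rewrite invr_ge0 ltW.
have rU0 : 0 <= r^-1 * U^-1 `^ r by apply: mulr_ge0 => //; exact: powR_ge0.
have s20 : 0 <= s / 2 by rewrite divr_ge0 ?ltW.
have s10 : 0 <= 1 - s by rewrite subr_ge0.
have mwr : measurable_fun setT (fun x => w x `^ r) by exact: measurable_fun_powR.
have G0' x : 0 <= G x by exact: ltW.
have sG0 x : 0 <= s / 2 * G x by exact: mulr_ge0.
have t10 x : 0 <= r^-1 * U^-1 `^ r * w x `^ r by exact: mulr_ge0.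
have t30 x : 0 <= (1 - s) + s / 2 * G x by exact: addr_ge0.
have t20 x : 0 <= r'^-1 * ((1 - s) + s / 2 * G x) by exact: mulr_ge0.
have m3 : measurable_fun setT (fun x => (1 - s) + s / 2 * G x).
  by apply: measurable_funD => //; exact: measurable_funM.
have m2 : measurable_fun setT (fun x => r'^-1 * ((1 - s) + s / 2 * G x)).
  exact: measurable_funM.
have m1 : measurable_fun setT (fun x => r^-1 * U^-1 `^ r * w x `^ r).
  exact: measurable_funM.
have m12 := measurable_funD m1 m2.
have me : measurable_fun setT (fun x => expR (phi x)) by exact: measurableT_comp.
apply: (@le_trans _ _ (\int[leb]_(x in hcube a l) (C *
    (r^-1 * U^-1 `^ r * (w x `^ r) + r'^-1 * ((1 - s) + s / 2 * G x)))%:E)%E).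
  apply: nint_le => //.
  - exact: measurable_funM.
  - exact: measurable_funM.
  - by move=> x; apply: mulr_ge0; [exact: ltW|exact: expR_ge0].
rewrite nintZ//; last 2 first.
- by move=> x; exact: addr_ge0.
- exact: ltW.
rewrite nintD// !nintZ// nintD//; last exact: measurable_funM.
rewrite nintZ// nint_cube_cst//.
have IG0 : (0 <= \int[leb]_(x in hcube a l) (G x)%:E)%E by exact: nint_ge0.
have IR0 : (0 <= \int[leb]_(x in hcube a l) (w x `^ r)%:E)%E by exact: nint_ge0.
move: osc RH IG0 IR0.
rewrite (_ : (fun x => (expR (`|phi x - c| / kap))%:E) = (fun x => (G x)%:E))//.
case: (\int[leb]_(x in hcube a l) (G x)%:E)%E => // ig.
case: (\int[leb]_(x in hcube a l) (w x `^ r)%:E)%E => // ir.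
rewrite !lee_fin => Hig Hir ig0 ir0.
have -> : 2 * 2 `^ kap * expR c * W * l ^+ n = C * l ^+ n by rewrite /C /U; ring.
rewrite ler_pM2l//.
have e1 : U^-1 `^ r * ir <= l ^+ n.
  rewrite powRVl// ler_pdivrMl ?powR_gt0//; apply: le_trans Hir _.
  rewrite ler_pM2r// /U powRM ?(ltW W0)// ler_pM2r ?powR_gt0//.
  by rewrite -[leLHS](powRr1 (ltW two0)); apply: ler_powR; [rewrite ler1n|exact: ltW].
have e2 : (1 - s) * l ^+ n + s / 2 * ig <= l ^+ n.
  have : s / 2 * ig <= s / 2 * (2 * l ^+ n) by exact: ler_wpM2l.
  lra.
have := lerD (ler_wpM2l ri0 e1) (ler_wpM2l r'i0 e2).
rewrite -mulrDl rr' mul1r; apply: le_trans.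
by rewrite le_eqVlt; apply/orP; left; apply/eqP; ring.
Qed.

End ApReal.

(** * Passage to closed cubes and to almost everywhere positive weights *)

Section ApPerturb.
Variables (R : realType) (n : nat).
Local Notation Rn := (Rn R n).
Local Notation leb := (@lebesgue_Rn R n).
Implicit Types (w phi : Rn -> R) (p K W V kap : R) (a : 'I_n -> R) (l : R).

Definition ccube a l : set Rn := [set x | forall i, a i <= (tnth x i : R) <= a i + l].

Lemma is_cube_ccube a l : 0 < l -> is_cube (ccube a l).
Proof. by move=> l0; exists a, l. Qed.

Lemma integral_ccube (f : Rn -> R) a l : 0 < l -> measurable_fun setT f -> (forall x, 0 <= f x) ->
  (\int[leb]_(x in ccube a l) (f x)%:E = \int[leb]_(x in hcube a l) (f x)%:E)%E.
Proof.
move=> l0 mf f0.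
have mQ : measurable (ccube a l) := measurable_cube (is_cube_ccube a l0).
have mH : measurable (hcube a l) by exact: measurable_hcube.
have sHQ : hcube a l `<=` ccube a l by exact: hcube_sub_ccube.
have lH : (leb (hcube a l) = (l ^+ n)%:E)%E by exact: leb_hcube (ltW l0).
have lQ : (leb (ccube a l) = (l ^+ n)%:E)%E by exact: leb_ccube l0.
have N0 : leb (ccube a l `\` hcube a l) = 0%E.
  have lQoo : (leb (ccube a l) < +oo)%E by rewrite lQ ltry.
  have -> : (leb (ccube a l `\` hcube a l) = leb (ccube a l) - leb (ccube a l `&` hcube a l))%E.
    exact: measureD.
  by rewrite setIidr// lH lQ subee.
rewrite (@ge0_negligible_integral _ _ _ leb (ccube a l) (ccube a l `\` hcube a l))//.
- by rewrite setDD setIidr.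
- exact: measurableD.
- by apply/measurable_EFinP; exact: measurable_funTS.
- by move=> x _; rewrite lee_fin.
Qed.

Lemma avg_ccube (f : Rn -> R) a l : 0 < l -> measurable_fun setT f -> (forall x, 0 <= f x) ->
  (avg (ccube a l) (fun x => (f x)%:E) = ((l ^+ n)^-1)%:E * \int[leb]_(x in hcube a l) (f x)%:E)%E.
Proof.
move=> l0 mf f0; rewrite /avg -integral_ccube//; congr (_%:E * _)%E.
have lQ : (leb (ccube a l) = (l ^+ n)%:E)%E by exact: leb_ccube l0.
by rewrite lQ.
Qed.

Lemma nint_gt0 w a l : measurable_fun setT w -> (forall x, 0 < w x) -> 0 < l ->
  (0 < \int[leb]_(x in hcube a l) (w x)%:E)%E.
Proof. by move=> mw w0 l0; exact: (om_gt0 mw w0). Qed.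

Lemma Ap_Ap_on w p : 1 < p -> (forall x, 0 < w x) -> Ap p w ->
  Ap_on w p (fine (Ap_const p w)).
Proof.
move=> p1 w0 [[mw _] Kfin] a l l0.
have ln0 : 0 < l ^+ n by rewrite exprn_gt0.
have p10 : 0 < p - 1 by lra.
have mv : measurable_fun setT (fun x => w x `^ (1 - dual_exponent p)) by exact: measurable_fun_powR.
have v0 x : 0 < w x `^ (1 - dual_exponent p) by exact: powR_gt0.
have := nint_gt0 a mw w0 l0; have := nint_gt0 a mv v0 l0.
have : (avg (ccube a l) (fun x => (w x)%:E) *
  avg (ccube a l) (fun x => (w x `^ (1 - dual_exponent p))%:E) `^ (p - 1) <= Ap_const p w)%E.
  by apply: ereal_sup_ubound; exists (ccube a l) => //; exact: is_cube_ccube.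
rewrite !avg_ccube//; try by move=> x; exact: ltW.
rewrite one_sub_dual//.
have li0 : 0 < (l ^+ n)^-1 by rewrite invr_gt0.
case: (Ap_const p w) Kfin => [K||]//= _; last first.
  move=> H v1 w1; have := le_lt_trans H (ltNyr 0); rewrite ltNge mule_ge0//.
    by rewrite mule_ge0 ?lee_fin ?(ltW li0)// ltW.
  exact: poweR_ge0.
case: (\int[leb]_(x in hcube a l) (w x)%:E)%E => [X||]//.
- case: (\int[leb]_(x in hcube a l) (w x `^ (- (p - 1)^-1))%:E)%E => [Y||]//.
    move=> H Y0 X0; exists ((l ^+ n)^-1 * X), ((l ^+ n)^-1 * Y).
    rewrite !lte_fin in Y0 X0; split.
    + exact: mulr_gt0.
    + exact: mulr_gt0.
    + by rewrite mulrAC mulVf ?mul1r// gt_eqF.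
    + by rewrite mulrAC mulVf ?mul1r// gt_eqF.
    + by move: H; rewrite -!EFinM ?poweR_EFin -?EFinM lee_fin.
  move=> H _ X0; move: H; rewrite gt0_muley ?lte_fin//.
  rewrite poweRyr ?gt_eqF// gt0_muley// ?mule_gt0// leye_eq//.
case: (\int[leb]_(x in hcube a l) (w x `^ (- (p - 1)^-1))%:E)%E => [Y||]//.
  move=> H Y0 _; move: H; rewrite gt0_muley ?lte_fin// -EFinM poweR_EFin gt0_mulye ?lte_fin ?powR_gt0 ?mulr_gt0//.
move=> H _ _; move: H; rewrite gt0_muley ?lte_fin// gt0_mulye// poweRyr ?gt_eqF//.
Qed.

Lemma Ap_const_le w p (M : R) : 1 < p -> measurable_fun setT w -> (forall x, 0 <= w x) ->
  (forall a l, 0 < l -> exists X Y, [/\ 0 <= X, 0 <= Y,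
    (\int[leb]_(x in hcube a l) (w x)%:E <= (X * l ^+ n)%:E)%E,
    (\int[leb]_(x in hcube a l) (w x `^ (- (p - 1)^-1))%:E <= (Y * l ^+ n)%:E)%E &
    X * Y `^ (p - 1) <= M]) ->
  (Ap_const p w <= M%:E)%E.
Proof.
move=> p1 mw w0 H; apply: ge_ereal_sup => _ [_ [a [l [l0 ->]]] <-].
have [X [Y [X0 Y0 HX HY XY]]] := H a l l0.
have mv : measurable_fun setT (fun x => w x `^ (1 - dual_exponent p)) by exact: measurable_fun_powR.
rewrite -/(ccube a l) !avg_ccube//; last by move=> x; exact: powR_ge0.
rewrite one_sub_dual//.
have ln0 : 0 < l ^+ n by rewrite exprn_gt0.
have scale (Z : \bar R) (z : R) : (Z <= (z * l ^+ n)%:E)%E -> (((l ^+ n)^-1)%:E * Z <= z%:E)%E.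
  move=> Zz; apply: (@le_trans _ _ (((l ^+ n)^-1)%:E * (z * l ^+ n)%:E)%E).
    by apply: lee_wpmul2l => //; rewrite lee_fin invr_ge0 ltW.
  by rewrite -EFinM mulrC mulfK// gt_eqF.
apply: (@le_trans _ _ (X%:E * (Y%:E `^ (p - 1)))%E); last by rewrite poweR_EFin -EFinM lee_fin.
apply: lee_pmul; [|exact: poweR_ge0|exact: scale|].
  by rewrite mule_ge0 ?lee_fin ?invr_ge0 ?(ltW ln0)//; exact: nint_ge0.
apply: gt0_ler_poweR; rewrite ?in_itv/= ?leey ?andbT; first by lra.
- by rewrite mule_ge0 ?lee_fin ?invr_ge0 ?(ltW ln0)//; apply: nint_ge0 => x; exact: powR_ge0.
- by rewrite lee_fin.
- exact: scale.
Qed.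

Lemma avg_ae (f g : Rn -> R) (Q : set Rn) : is_cube Q -> measurable_fun setT f -> measurable_fun setT g ->
  {ae leb, forall x, f x = g x} ->
  avg Q (fun x => (f x)%:E) = avg Q (fun x => (g x)%:E).
Proof.
move=> cQ mf mg fg; rewrite /avg; congr (_ * _)%E; apply: ae_eq_integral.
- exact: measurable_cube.
- by apply/measurable_EFinP; exact: measurable_funTS.
- by apply/measurable_EFinP; exact: measurable_funTS.
by apply: filterS fg => x -> _.
Qed.

Lemma Ap_const_ae w1 w2 p : measurable_fun setT w1 -> measurable_fun setT w2 ->
  {ae leb, forall x, w1 x = w2 x} -> Ap_const p w1 = Ap_const p w2.
Proof.
move=> m1 m2 E; apply: (@f_equal _ _ (@ereal_sup R)); apply/eq_imagel => Q cQ.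
rewrite (avg_ae cQ m1 m2 E).
have E' : {ae leb, forall x, w1 x `^ (1 - dual_exponent p) = w2 x `^ (1 - dual_exponent p)}.
  by apply: filterS E => x ->.
by rewrite (avg_ae cQ _ _ E')//; exact: measurable_fun_powR.
Qed.

(** Only the values on a null set change, so that the arguments for everywhere positive
    weights apply. *)
Lemma weight_pos w : weight w -> exists u : Rn -> R,
  [/\ measurable_fun setT u, forall x, 0 < u x & {ae leb, forall x, w x = u x}].
Proof.
move=> [mw w0]; exists (fun x => if 0 < w x then w x else 1); split.
- apply: measurable_fun_ifT => //; exact: measurable_fun_ltr.
- by move=> x; case: ifPn.
- by apply: filterS w0 => x ->.
Qed.

Lemma Ap_ge1 w p : 1 < p -> Ap p w -> 1 <= fine (Ap_const p w).
Proof.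
move=> p1 [/[dup] ww [mw w0] Kfin].
have [u [mu u0 wu]] := weight_pos ww.
have E : Ap_const p w = Ap_const p u := Ap_const_ae p mw mu wu.
have Ku : (Ap_const p u < +oo)%E := eq_ind _ (fun z => (z < +oo)%E) Kfin _ E.
have Au : Ap p u := conj (conj mu (aeW leb u0)) Ku.
have : 1 <= fine (Ap_const p u) := Ap_on_ge1 p1 mu u0 (Ap_Ap_on p1 u0 Au).
by move=> H; exact: (eq_ind_r (fun z => 1 <= fine z) H E).
Qed.

(** Exponential integrability of the oscillation at scale [kap]; constants [c] may depend
    on the cube. *)
Definition exp_osc phi kap := forall a l, 0 < l -> exists c : R,
  (\int[leb]_(x in hcube a l) (expR (`|phi x - c| / kap))%:E <= (2 * l ^+ n)%:E)%E.

(** [nint_perturb] is applied to [w] with [phi] and to the dual weight with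
    [- phi / (p - 1)]; the factors [e^c] and [e^-c] cancel in the product. *)
Lemma Ap_on_perturb (u : Rn -> R) p K phi kap : 1 < p -> measurable_fun setT u -> (forall x, 0 < u x) ->
  Ap_on u p K -> measurable_fun setT phi -> 0 < kap -> exp_osc phi kap ->
  rh_exp n p K * kap <= 1 ->
  rh_exp n (dual_exponent p) (K `^ (p - 1)^-1) * (kap / (p - 1)) <= 1 ->
  (Ap_const p (fun x => u x * expR (phi x))%R <= (2 `^ (p + 2 * kap) * K)%:E)%E.
Proof.
move=> p1 mu u0 on mphi kap0 osc r1 r2.
have K1 := Ap_on_ge1 p1 mu u0 on.
have me : measurable_fun setT (fun x => expR (phi x)) by exact: measurableT_comp.
have mue : measurable_fun setT (fun x => u x * expR (phi x)) by exact: measurable_funM.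
have p10 : 0 < p - 1 by lra.
have p10' : p - 1 != 0 by rewrite gt_eqF.
have q0 : 0 < (p - 1)^-1 by rewrite invr_gt0.
have ond := Ap_on_dual p1 u0 (le_trans ler01 K1) on.
have ue0 x : 0 < u x * expR (phi x) by rewrite mulr_gt0// expR_gt0.
apply: Ap_const_le => //; first by move=> x; exact: ltW.
move=> a l l0; have [W [V [W0 V0 iW iV WV]]] := on a l l0.
have [c oc] := osc a l l0.
exists (2 * 2 `^ kap * expR c * W), (2 * 2 `^ (kap / (p - 1)) * expR (- (p - 1)^-1 * c) * V).
split.
- by rewrite !mulr_ge0 ?powR_ge0 ?expR_ge0 ?(ltW W0).
- by rewrite !mulr_ge0 ?powR_ge0 ?expR_ge0 ?(ltW V0).
- exact: (nint_perturb p1 mu u0 on).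
- rewrite (_ : (fun x => ((u x * expR (phi x)) `^ (- (p - 1)^-1))%:E) =
    (fun x => (u x `^ (- (p - 1)^-1) * expR (- (p - 1)^-1 * phi x))%:E)); last first.
    apply/funext => x; congr (_%:E); rewrite powRM ?(ltW (u0 x)) ?expR_ge0//.
    by congr (_ * _); rewrite /powR gt_eqF ?expR_gt0// expRK.
  apply: (nint_perturb (dual_gt1 p1) _ _ ond) => //.
  + exact: measurable_fun_powR.
  + by move=> x; exact: powR_gt0.
  + exact: measurable_funM.
  + exact: divr_gt0.
  + rewrite (_ : (fun x => _) = (fun x => (expR (`|phi x - c| / kap))%:E))//.
    apply/funext => x; congr (expR _)%:E.
    rewrite -mulrBr normrM normrN (ger0_norm (ltW q0)).
    by field; rewrite p10' gt_eqF.
rewrite !powRM ?mulr_ge0 ?powR_ge0 ?expR_ge0 ?(ltW V0)//.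
rewrite -powRrM divfK// [expR (- _ * c) `^ _]/powR gt_eqF ?expR_gt0// expRK.
have -> : (p - 1) * (- (p - 1)^-1 * c) = - c by field.
have -> : 2 `^ (p + 2 * kap) = 2 * 2 `^ (p - 1) * 2 `^ kap * 2 `^ kap :> R.
  have n2 : (2 : R) == 0 = false by rewrite gt_eqF.
  rewrite -[X in X * _ * _ * _](powRr1 (ler0n _ 2)) -!powRD ?n2 ?implybT//.
  by congr (2 `^ _); ring.
have ee : expR c * expR (- c) = 1 by rewrite expRN mulfV// gt_eqF ?expR_gt0.
rewrite (_ : _ * W * _ = (2 * 2 `^ (p - 1) * 2 `^ kap * 2 `^ kap) *
  (expR c * expR (- c)) * (W * V `^ (p - 1))); last by ring.
by rewrite ee mulr1 ler_pM2l// !mulr_gt0 ?powR_gt0.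
Qed.

Lemma fine_le_ge1 (z : \bar R) (c : R) : 1 <= fine z -> (z <= c%:E)%E -> fine z <= c.
Proof. by case: z => [r||]//= H; have := lt_le_trans ltr01 H; rewrite ltxx. Qed.

Lemma Ap_perturb w p phi kap : 1 < p -> Ap p w -> measurable_fun setT phi -> 0 < kap ->
  exp_osc phi kap ->
  rh_exp n p (fine (Ap_const p w)) * kap <= 1 ->
  rh_exp n (dual_exponent p) (fine (Ap_const p w) `^ (p - 1)^-1) * (kap / (p - 1)) <= 1 ->
  Ap p (fun x => w x * expR (phi x)) /\
  fine (Ap_const p (fun x => w x * expR (phi x))) <= 2 `^ (p + 2 * kap) * fine (Ap_const p w).
Proof.
move=> p1 Aw mphi kap0 osc.
have [/[dup] ww [mw w0] Kfin] := Aw.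
have [u [mu u0 wu]] := weight_pos ww.
have wp : {ae leb, forall x, 0 < w x * expR (phi x)}.
  by apply: filterS w0 => x wx; rewrite mulr_gt0// expR_gt0.
move=> r1 r2.
have E : Ap_const p w = Ap_const p u := Ap_const_ae p mw mu wu.
have me : measurable_fun setT (fun x => expR (phi x)) by exact: measurableT_comp.
have mwe : measurable_fun setT (fun x => w x * expR (phi x)) by exact: measurable_funM.
have mue : measurable_fun setT (fun x => u x * expR (phi x)) by exact: measurable_funM.
have Ku : (Ap_const p u < +oo)%E := eq_ind _ (fun z => (z < +oo)%E) Kfin _ E.
have Au : Ap p u := conj (conj mu (aeW leb u0)) Ku.
have on : Ap_on u p (fine (Ap_const p w)) :=
  eq_ind_r (fun z => Ap_on u p (fine z)) (Ap_Ap_on p1 u0 Au) E.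
have eae : {ae leb, forall x, w x * expR (phi x) = u x * expR (phi x)}.
  by apply: filterS wu => x ->.
have Ee : Ap_const p (fun x => w x * expR (phi x)) = Ap_const p (fun x => u x * expR (phi x)) :=
  Ap_const_ae p mwe mue eae.
have le : (Ap_const p (fun x => w x * expR (phi x))%R <=
    (2 `^ (p + 2 * kap) * fine (Ap_const p w))%:E)%E.
  exact: (eq_ind_r (fun z => (z <= _)%E)
    (Ap_on_perturb p1 mu u0 on mphi kap0 osc r1 r2) Ee).
have A' : Ap p (fun x => w x * expR (phi x)) :=
  conj (conj mwe wp) (le_lt_trans le (ltry _)).
split; first exact: A'.
exact: (fine_le_ge1 (Ap_ge1 p1 A') le).
Qed.

End ApPerturb.

(** * The complex absolute value *)

Section ComplexAbs.
Variable R : realType.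
Implicit Types z w : R[i].

Lemma cabsE z : (cabs z)%:C%C = `|z|.
Proof. by rewrite /cabs; case: z => a b. Qed.

Lemma cabs_ge0 z : 0 <= cabs z.
Proof. by have := normr_ge0 z; rewrite -cabsE lecR. Qed.

Lemma cabsM z w : cabs (z * w) = cabs z * cabs w.
Proof. by apply: (@complexI R); rewrite rmorphM/= !cabsE normrM. Qed.

Lemma cabsD z w : cabs (z + w) <= cabs z + cabs w.
Proof. by rewrite -lecR rmorphD/= !cabsE ler_normD. Qed.

Lemma cabsN z : cabs (- z) = cabs z.
Proof. by apply: (@complexI R); rewrite !cabsE normrN. Qed.

Lemma cabsB z w : cabs (z - w) <= cabs z + cabs w.
Proof. by rewrite -(cabsN w) cabsD. Qed.

Lemma cabs0 : cabs (0 : R[i]) = 0.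
Proof. by apply: (@complexI R); rewrite cabsE normr0. Qed.

Lemma cabs1 : cabs (1 : R[i]) = 1.
Proof. by apply: (@complexI R); rewrite cabsE normr1. Qed.

Lemma cabs_eq0 z : (cabs z == 0) = (z == 0).
Proof. by rewrite -(normr_eq0 z) -cabsE (inj_eq (@complexI R) _ 0). Qed.

Lemma cabs_real (x : R) : cabs x%:C%C = `|x|.
Proof. by apply: (@complexI R); rewrite cabsE normc_def/= expr0n addr0 sqrtr_sqr. Qed.

Lemma cabsV z : cabs z^-1 = (cabs z)^-1.
Proof. by apply: (@complexI R); rewrite fmorphV/= !cabsE normfV. Qed.

Lemma cabsX z k : cabs (z ^+ k) = cabs z ^+ k.
Proof. by apply: (@complexI R); rewrite rmorphXn/= !cabsE normrX. Qed.

Lemma cabs_sum (I : Type) (s : seq I) (P : pred I) (F : I -> R[i]) :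
  cabs (\sum_(i <- s | P i) F i) <= \sum_(i <- s | P i) cabs (F i).
Proof.
elim/big_ind2 : _ => //; first by rewrite cabs0.
by move=> x1 x2 y1 y2 h1 h2; apply: le_trans (cabsD _ _) (lerD h1 h2).
Qed.

Lemma cabs_prod (I : Type) (s : seq I) (P : pred I) (F : I -> R[i]) :
  cabs (\prod_(i <- s | P i) F i) = \prod_(i <- s | P i) cabs (F i).
Proof. by elim/big_ind2 : _ => //; [exact: cabs1|move=> x1 x2 y1 y2 <- <-; rewrite cabsM]. Qed.

Lemma cabs_def z : cabs z = Num.sqrt (complex.Re z ^+ 2 + complex.Im z ^+ 2).
Proof. by case: z => a b; rewrite /cabs normc_def. Qed.

Lemma cabs_sqr z : cabs z ^+ 2 = complex.Re z ^+ 2 + complex.Im z ^+ 2.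
Proof. by rewrite cabs_def sqr_sqrtr// addr_ge0 ?sqr_ge0. Qed.

Lemma Re_le_cabs z : `|complex.Re z| <= cabs z.
Proof. by rewrite cabs_def -sqrtr_sqr ler_sqrt ?addr_ge0 ?sqr_ge0// lerDl sqr_ge0. Qed.

Lemma Im_le_cabs z : `|complex.Im z| <= cabs z.
Proof. by rewrite cabs_def -sqrtr_sqr ler_sqrt ?addr_ge0 ?sqr_ge0// lerDr sqr_ge0. Qed.

Lemma cabs_le_ReIm z : cabs z <= `|complex.Re z| + `|complex.Im z|.
Proof.
case: z => a b /=; have -> : (a +i* b)%C = a%:C%C + 'i%C * b%:C%C by simpc.
apply: le_trans (cabsD _ _) _; rewrite cabsM !cabs_real.
suff -> : cabs ('i%C : R[i]) = 1 by rewrite mul1r.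
by rewrite cabs_def/= expr0n expr1n add0r sqrtr1.
Qed.

Lemma mul_conjE z : z * z^*%C = (cabs z ^+ 2)%:C%C.
Proof. by rewrite cabs_sqr; case: z => a b /=; simpc; rewrite -!expr2; congr (_ +i* _)%C; ring. Qed.

Lemma cabs_conj z : cabs z^*%C = cabs z.
Proof. by rewrite !cabs_def; case: z => a b /=; rewrite sqrrN. Qed.

Lemma ReM z w : complex.Re (z * w) = complex.Re z * complex.Re w - complex.Im z * complex.Im w.
Proof. by case: z w => [a b] [c d]. Qed.
Lemma ImM z w : complex.Im (z * w) = complex.Re z * complex.Im w + complex.Im z * complex.Re w.
Proof. by case: z w => [a b] [c d]. Qed.

End ComplexAbs.

(** * Measurable complex functions *)

Section CMeasurable.
Variables (R : realType) (n : nat).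
Local Notation Rn := (Rn R n).
Implicit Types f g : Rn -> R[i].

Lemma cmeasurable_cst (c : R[i]) : cmeasurable (fun _ : Rn => c).
Proof. by split; exact: measurable_cst. Qed.

Lemma cmeasurable_real (h : Rn -> R) : measurable_fun setT h -> cmeasurable (fun x => (h x)%:C%C).
Proof. by move=> mh; split => //=; exact: measurable_cst. Qed.

Lemma cmeasurableD f g : cmeasurable f -> cmeasurable g -> cmeasurable (fun x => f x + g x).
Proof.
move=> [f1 f2] [g1 g2]; split.
  under eq_fun do rewrite raddfD/=; exact: measurable_funD.
under eq_fun do rewrite raddfD/=; exact: measurable_funD.
Qed.

Lemma cmeasurableM f g : cmeasurable f -> cmeasurable g -> cmeasurable (fun x => f x * g x).
Proof.
move=> [f1 f2] [g1 g2]; split.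
  under eq_fun do rewrite ReM; apply: measurable_funB; exact: measurable_funM.
under eq_fun do rewrite ImM; apply: measurable_funD; exact: measurable_funM.
Qed.

Lemma cmeasurableN f : cmeasurable f -> cmeasurable (fun x => - f x).
Proof.
move=> mf; under eq_fun do rewrite -mulN1r.
exact: cmeasurableM (cmeasurable_cst _) mf.
Qed.

Lemma cmeasurableB f g : cmeasurable f -> cmeasurable g -> cmeasurable (fun x => f x - g x).
Proof. by move=> mf mg; apply: cmeasurableD => //; exact: cmeasurableN. Qed.

Lemma cmeasurable_sum (I : Type) (s : seq I) (P : pred I) (F : I -> Rn -> R[i]) :
  (forall i, cmeasurable (F i)) -> cmeasurable (fun x => \sum_(i <- s | P i) F i x).
Proof.
move=> mF; elim: s => [|i s IH].
  by under eq_fun do rewrite big_nil; exact: cmeasurable_cst.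
under eq_fun do rewrite big_cons; case: (P i) => //; exact: cmeasurableD.
Qed.

Lemma cmeasurable_prod (I : Type) (s : seq I) (P : pred I) (F : I -> Rn -> R[i]) :
  (forall i, cmeasurable (F i)) -> cmeasurable (fun x => \prod_(i <- s | P i) F i x).
Proof.
move=> mF; elim: s => [|i s IH].
  by under eq_fun do rewrite big_nil; exact: cmeasurable_cst.
under eq_fun do rewrite big_cons; case: (P i) => //; exact: cmeasurableM.
Qed.

Lemma cmeasurable_conj f : cmeasurable f -> cmeasurable (fun x => (f x)^*%C).
Proof.
move=> [f1 f2]; split.
  by rewrite (_ : (fun x => _) = fun x => complex.Re (f x))//; apply/funext => x; case: (f x).
rewrite (_ : (fun x => _) = fun x => - complex.Im (f x)); first exact: measurable_funN.
by apply/funext => x; case: (f x).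
Qed.

Lemma measurable_cabs f : cmeasurable f -> measurable_fun setT (fun x => cabs (f x)).
Proof.
move=> [f1 f2]; under eq_fun do rewrite cabs_def -powR12_sqrt ?addr_ge0 ?sqr_ge0//.
by apply: measurable_fun_powR; apply: measurable_funD; exact: measurable_funX.
Qed.

Lemma cmeasurable_indic (E : set Rn) : measurable E -> cmeasurable (fun x => (\1_E x)%:C%C).
Proof. by move=> mE; apply: cmeasurable_real; exact: measurable_indic. Qed.

End CMeasurable.

(** * Exponentials of functions of bounded mean oscillation *)

(* The constant is a supremum of integrals, which conversion must not unfold. *)
Opaque Ap_const.

Section BmoOsc.
Variables (R : realType) (n : nat).
Local Notation Rn := (Rn R n).
Local Notation leb := (@lebesgue_Rn R n).
Local Notation C := R[i].

(** The strict bound leaves room for a scale [h < B] at which the condition in the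
    definition of the norm holds. *)
Lemma bmo_exp (b : Rn -> C) (B : R) a l : cmeasurable b -> (bmo_norm b < B%:E)%E -> 0 < l ->
  (\int[leb]_(x in hcube a l) (expR (cabs (b x - cmean (ccube a l) b) / B))%:E <=
   (2 * l ^+ n)%:E)%E.
Proof.
move=> mb bB l0; have ln0 : 0 < l ^+ n by rewrite exprn_gt0.
set m := cmean (ccube a l) b.
have : (expL_norm (ccube a l) (fun x => b x - m)%R < B%:E)%E.
  apply: le_lt_trans bB; apply: ereal_sup_ubound; exists (ccube a l) => //.
  exact: is_cube_ccube.
rewrite /expL_norm => /ereal_inf_lt[_ [h [h0 avgh] <-]]; rewrite lte_fin => hB.
have mc : measurable_fun setT (fun x => cabs (b x - m)).
  by apply: measurable_cabs; apply: cmeasurableB => //; exact: cmeasurable_cst.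
have me (c : R) : measurable_fun setT (fun x => expR (cabs (b x - m) / c)).
  by apply: measurableT_comp => //; exact: measurable_funM.
have e1 x : 1 <= expR (cabs (b x - m) / h).
  by rewrite -expR0 ler_expR divr_ge0 ?cabs_ge0 ?(ltW h0).
move: avgh; rewrite avg_ccube//; last 2 first.
- by apply: measurable_funB.
- by move=> x; rewrite subr_ge0.
move=> H.
have {}H : (\int[leb]_(x in hcube a l) (expR (cabs (b x - m) / h) - 1)%:E <= (l ^+ n)%:E)%E.
  have := @lee_wpmul2l _ (l ^+ n)%:E _ _ _ H; rewrite muleA -EFinM mulfV ?gt_eqF// mul1e mule1.
  by apply; rewrite lee_fin ltW.
apply: (@le_trans _ _ (\int[leb]_(x in hcube a l) ((expR (cabs (b x - m) / h) - 1) + 1)%:E)%E).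
  apply: nint_le => //; first exact: measurable_hcube.
  - by apply: measurable_funD => //; apply: measurable_funB.
  - move=> x _; rewrite subrK ler_expR; apply: ler_wpM2l; first exact: cabs_ge0.
    by rewrite lef_pV2 ?posrE ?(lt_trans h0 hB)// ltW.
rewrite nintD//; last 3 first.
- exact: measurable_hcube.
- by apply: measurable_funB.
- by move=> x; rewrite subr_ge0.
rewrite nint_cube_cst// (_ : 2 * l ^+ n = l ^+ n + 1 * l ^+ n); last by ring.
by rewrite EFinD leeD2r.
Qed.

Lemma expR_mean (k : nat) (x : 'I_k -> R) : (0 < k)%N ->
  expR (k%:R^-1 * \sum_j x j) <= k%:R^-1 * \sum_j expR (x j).
Proof.
move=> k0; have k0' : 0 < k%:R :> R by rewrite ltr0n.
set x0 := k%:R^-1 * _.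
have H j : expR x0 * (1 + (x j - x0)) <= expR (x j).
  rewrite -[in leRHS](subrK x0 (x j)) expRD mulrC ler_pM2r ?expR_gt0//; exact: expR_ge1Dx.
rewrite ler_pdivlMl//; apply: le_trans (ler_sum _ (fun j _ => H j)).
rewrite -mulr_sumr mulrC ler_pM2l ?expR_gt0//.
rewrite big_split/= sumr_const card_ord big_split/= sumr_const card_ord.
rewrite -[(- x0) *+ k]mulr_natl mulrN.
by rewrite /x0 mulVKf ?gt_eqF// subrr addr0.
Qed.

(** Convexity of the exponential turns the sum of [k] oscillations at scale [kap] into a
    mean of exponentials, at the cost of the scale [k * kap].  It will be applied with
    [psi j] equal to [Re (z_j * b j)] and to [- rho j * |b j|]. *)
Lemma bmo_exp_osc (k : nat) (b : 'I_k -> Rn -> C) (B rho : 'I_k -> R) (kap : R)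
    (psi : 'I_k -> Rn -> R) : (0 < k)%N -> 0 < kap ->
  (forall j, cmeasurable (b j)) -> (forall j, (bmo_norm (b j) < (B j)%:E)%E) ->
  (forall j, 0 < B j) ->
  (forall j, measurable_fun setT (psi j)) ->
  (forall j, rho j * B j = kap) ->
  (forall j m, exists c, forall x, `|psi j x - c| <= rho j * cabs (b j x - m)) ->
  exp_osc (fun x => \sum_j psi j x) (k%:R * kap).
Proof.
move=> k0 kap0 mb bB B0 mpsi rB Hpsi a l l0.
have k0' : 0 < k%:R :> R by rewrite ltr0n.
pose m j := cmean (ccube a l) (b j); have Hm j := bmo_exp a (mb j) (bB j) l0.
have /choice[c Hc] j := Hpsi j (m j).
exists (\sum_j c j).
have mc j : measurable_fun setT (fun x => cabs (b j x - m j)).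
  by apply: measurable_cabs; apply: cmeasurableB => //; exact: cmeasurable_cst.
have me j : measurable_fun setT (fun x => expR (cabs (b j x - m j) / B j)).
  by apply: measurableT_comp => //; exact: measurable_funM.
have mH : measurable (hcube a l : set Rn) by exact: measurable_hcube.
apply: (@le_trans _ _ (\int[leb]_(x in hcube a l)
   (k%:R^-1 * \sum_j expR (cabs (b j x - m j) / B j))%:E)%E).
  apply: nint_le => //.
  - apply: measurableT_comp => //; apply: measurable_funM => //.
    apply: measurableT_comp => //; apply: measurable_funB => //.
    exact: measurable_sum.
  - apply: measurable_funM => //; exact: measurable_sum.
  move=> x _; apply: le_trans (expR_mean _ k0); rewrite ler_expR.
  rewrite ler_pdivrMr ?mulr_gt0//.
  rewrite (_ : _ * (k%:R * kap) = \sum_j (cabs (b j x - m j) / B j * kap)); last first.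
    by rewrite -mulr_suml; field; rewrite gt_eqF.
  rewrite -sumrB; apply: le_trans (ler_norm_sum _ _ _) _.
  apply: ler_sum => j _; rewrite -(rB j) (_ : _ * (rho j * B j) = rho j * cabs (b j x - m j)).
    exact: Hc.
  by field; rewrite gt_eqF.
rewrite nintZ//; last 2 first.
- exact: measurable_sum.
- by move=> x; apply: sumr_ge0 => j _; exact: expR_ge0.
rewrite nint_sum//.
apply: (@le_trans _ _ ((k%:R^-1)%:E * \sum_(j < k) (2 * l ^+ n)%:E)%E).
  apply: lee_wpmul2l; first by rewrite lee_fin invr_ge0 ltW.
  by apply: lee_sum => j _.
rewrite sumEFin sumr_const card_ord -EFinM lee_fin -[(_ * _) *+ k]mulr_natl mulKf//.
by rewrite gt_eqF.
Qed.

Lemma exp_oscZ (phi : Rn -> R) kap c : 0 < kap -> c != 0 -> exp_osc phi kap ->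
  exp_osc (fun x => c * phi x) (`|c| * kap).
Proof.
move=> kap0 c0 H a l l0; have [d Hd] := H a l l0; exists (c * d).
rewrite (_ : (fun x => _) = (fun x => (expR (`|phi x - d| / kap))%:E))//.
apply/funext => x; congr (expR _)%:E; rewrite -mulrBr normrM.
by field; rewrite normr_eq0 c0 gt_eqF.
Qed.

Lemma Ap_ae (w1 w2 : Rn -> R) p : measurable_fun setT w1 ->
  {ae leb, forall x, w1 x = w2 x} -> Ap p w2 ->
  Ap p w1 /\ Ap_const p w1 = Ap_const p w2.
Proof.
move=> m1 E [[m2 w2p] K].
have w1p : {ae leb, forall x, 0 < w1 x} by apply: filterS2 E w2p => x ->.
have EE : Ap_const p w1 = Ap_const p w2 := Ap_const_ae p m1 m2 E.
exact: (conj (conj (conj m1 w1p) (eq_ind_r (fun z => (z < +oo)%E) K EE)) EE).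
Qed.

Lemma measurable_weights4 (theta : 'I_4 -> R) mu lambda i :
  measurable_fun setT mu -> measurable_fun setT lambda ->
  measurable_fun setT (weights4 (n := n) theta mu lambda i).
Proof.
move=> mmu ml; rewrite /weights4; case: (val i) => [|[|[|?]]]; exact: measurable_fun_powR.
Qed.

Section Admissible.
Variables (s theta : 'I_4 -> R) (hs : forall i, 1 < s i) (htheta : forall i, 1 < theta i).
Variables (nu mu lambda : Rn -> R) (hml : admissible s theta nu mu lambda).
Let S := \big[Num.max/0]_(i < 4) Num.max (s i) (dual_exponent (s i)).
Let m := \big[Num.min/1]_(i < 4) Num.min 1 (s i - 1).
Let thetamax := \big[Num.max/0]_(i < 4) theta i.
Let A := Ap_consts s theta mu lambda.
Let maxA := \big[Num.max/0]_(i < 4) (A i `^ Num.max 1 (1 / (s i - 1))).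

Lemma Ap_consts_ge1 i : 1 <= A i.
Proof. by apply: Ap_ge1 => //; have [_ _ _] := hml; apply. Qed.

(** Each of the four weights is multiplied by [e^(+-theta_i phi)], so that
    [Ap_perturb] applies at scale [theta_i * eps].  The hypothesis on [eps] implies the
    smallness conditions for the weight and for its dual weight, and makes
    [2 * theta_i * eps] at most [2 * Num.min 1 (s i - 1)]. *)
Lemma admissible_perturb phi eps : measurable_fun setT phi -> 0 < eps ->
  exp_osc phi eps -> 2 `^ (n%:R + 2 + 2 * S) * thetamax * maxA * eps <= m ->
  admissible s theta nu (fun x => mu x * expR (phi x)) (fun x => lambda x * expR (phi x)) /\
  forall i, 1 <= Ap_consts s theta (fun x => mu x * expR (phi x)) (fun x => lambda x * expR (phi x)) i
    <= 2 `^ (s i + 2 * Num.min 1 (s i - 1)) * A i.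
Proof.
move=> mphi eps0 osc small.
have [wmu wla enu _] := hml.
have me : measurable_fun setT (fun x => expR (phi x)) by exact: measurableT_comp.
have mmu' : measurable_fun setT (fun x => mu x * expR (phi x)) by apply: measurable_funM => //; exact: wmu.1.
have mla' : measurable_fun setT (fun x => lambda x * expR (phi x)) by apply: measurable_funM => //; exact: wla.1.
pose mu' x := mu x * expR (phi x); pose la' x := lambda x * expR (phi x).
have wmu' : weight mu'.
  split; first exact: mmu'.
  by apply: filterS wmu.2 => x mux; apply: mulr_gt0 => //; exact: expR_gt0.
have wla' : weight la'.
  split; first exact: mla'.
  by apply: filterS wla.2 => x lax; apply: mulr_gt0 => //; exact: expR_gt0.
have enu' : {ae leb, forall x, nu x = mu' x / la' x}.
  apply: filterS2 enu wla.2 => x -> lax; rewrite /mu' /la'; field.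
  by rewrite (gt_eqF lax) (gt_eqF (expR_gt0 _)).
have main i : Ap (s i) (weights4 theta mu' la' i) /\
   fine (Ap_const (s i) (weights4 theta mu' la' i)) <= 2 `^ (s i + 2 * Num.min 1 (s i - 1)) * A i.
  have HApi : Ap (s i) (weights4 theta mu lambda i) by have [_ _ _] := hml; apply.
  pose sg : R := match val i with 0 => 1 | 1 => 1 | _ => -1 end.
  have Eae : {ae leb, forall x, weights4 theta mu' la' i x =
     weights4 theta mu lambda i x * expR (sg * theta i * phi x)}.
    have pe y t x : 0 < y -> (y * expR (phi x)) `^ t = y `^ t * expR (t * phi x).
      move=> y0; rewrite powRM ?(ltW y0) ?expR_ge0//.
      by congr (_ * _); rewrite [expR _ `^ _]/powR gt_eqF ?expR_gt0// expRK.
    apply: filterS2 wmu.2 wla.2 => x mux lax; rewrite /weights4 /sg /mu' /la'.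
    by case: (val i) => [|[|[|?]]]; rewrite pe// ?mul1r// mulN1r.
  have th0 : 0 < theta i by have := htheta i; lra.
  have absc : `|sg * theta i| = theta i.
    rewrite normrM (gtr0_norm th0) (_ : `|sg| = 1) ?mul1r// /sg.
    by case: (val i) => [|[|?]]; rewrite ?normrN1 ?normr1.
  have sg0 : sg * theta i != 0 by rewrite -normr_eq0 absc gt_eqF.
  have osc' := exp_oscZ eps0 sg0 osc; rewrite absc in osc'.
  set kap := theta i * eps in osc'.
  have kap0 : 0 < kap by exact: mulr_gt0.
  have s10 : 0 < s i - 1 by have := hs i; lra.
  have A1 := Ap_consts_ge1 i.
  have A0 : 0 < A i by lra.
  have A0' : 0 <= A i by lra.
  have mx : A i `^ Num.max 1 (1 / (s i - 1)) <= maxA by rewrite /maxA; exact: le_bigmax.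
  have mxA : A i <= maxA.
    apply: le_trans mx; rewrite -[leLHS](powRr1 A0'); apply: ler_powR => //.
    by rewrite le_max lexx.
  have mxA' : A i `^ (s i - 1)^-1 <= maxA.
    by apply: le_trans mx; apply: ler_powR => //; rewrite le_max div1r lexx orbT.
  have mle : m <= Num.min 1 (s i - 1) by rewrite /m; exact: bigmin_le.
  have thle : theta i <= thetamax by rewrite /thetamax; exact: le_bigmax.
  have Sle : Num.max (s i) (dual_exponent (s i)) <= S by rewrite /S; exact: le_bigmax.
  have bd t P0 : t <= S -> 1 <= P0 -> P0 <= maxA -> 2 `^ (n%:R + 2 + 2 * t) * P0 * kap <= m.
    move=> tS P1 PA; apply: le_trans small.
    have -> : 2 `^ (n%:R + 2 + 2 * t) * P0 * kap = 2 `^ (n%:R + 2 + 2 * t) * theta i * P0 * eps.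
      by rewrite /kap; ring.
    rewrite ler_pM2r//; apply: ler_pM => //.
    - by apply: mulr_ge0; [exact: powR_ge0|exact: ltW].
    - lra.
    - apply: ler_pM => //; first exact: ltW.
      by apply: ler_powR; [rewrite ler1n|rewrite lerD2l ler_pM2l].
  have m1 : m <= 1 by apply: le_trans mle _; rewrite ge_min lexx.
  have ms : m <= s i - 1 by apply: le_trans mle _; rewrite ge_min lexx orbT.
  have sS : s i <= S by apply: le_trans Sle; rewrite le_max lexx.
  have s'S : dual_exponent (s i) <= S by apply: le_trans Sle; rewrite le_max lexx orbT.
  have r1 : rh_exp n (s i) (A i) * kap <= 1 by apply: le_trans m1; exact: bd.
  have A'1 : 1 <= A i `^ (s i - 1)^-1.
    by rewrite -[leLHS](powRr0 (A i)); apply: ler_powR => //; rewrite invr_ge0 ltW.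
  have r2 : rh_exp n (dual_exponent (s i)) (A i `^ (s i - 1)^-1) * (kap / (s i - 1)) <= 1.
    by rewrite mulrA ler_pdivrMr// mul1r; apply: le_trans ms; exact: bd.
  have up : 2 `^ (s i + 2 * kap) * A i <= 2 `^ (s i + 2 * Num.min 1 (s i - 1)) * A i.
    rewrite ler_pM2r//; apply: ler_powR; first by rewrite ler1n.
    rewrite lerD2l ler_pM2l//; apply: le_trans mle.
    have S0 : 0 <= S by apply: le_trans sS; lra.
    apply: le_trans (bd 0 1 S0 (lexx _) (le_trans A1 mxA)).
    rewrite mulr1 ler_peMl ?(ltW kap0)// -[leLHS](powRr0 2).
    by apply: ler_powR; [rewrite ler1n|rewrite mulr0 addr0 addr_ge0].
  have mph : measurable_fun setT (fun x => sg * theta i * phi x) by exact: measurable_funM.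
  have [Ap' le'] := Ap_perturb (hs i) HApi mph kap0 osc' r1 r2.
  have [Ap1 E1] := Ap_ae (measurable_weights4 theta i mmu' mla') Eae Ap'.
  split; first exact: Ap1.
  exact: (eq_ind_r (fun z => fine z <= _) (le_trans le' up) E1).
have H1 i : Ap (s i) (weights4 theta mu' la' i) by have [] := main i.
split; first exact: (And4 wmu' wla' enu' H1).
move=> i; have [_ le'] := main i; apply/andP; split; last exact: le'.
exact: Ap_ge1 (hs i) (H1 i).
Qed.

End Admissible.
End BmoOsc.

(** * The complex exponential and a discrete Cauchy formula *)

Section ComplexExponential.
Variable R : realType.
Implicit Types z w u : R[i].

Definition cexp z : R[i] :=
  Complex (expR (complex.Re z) * cos (complex.Im z)) (expR (complex.Re z) * sin (complex.Im z)).

Lemma cexp0 : cexp 0 = 1.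
Proof. by rewrite /cexp/= expR0 cos0 sin0 !mul1r. Qed.

Lemma cexpD z w : cexp (z + w) = cexp z * cexp w.
Proof.
rewrite /cexp; case: z w => [a b] [c d] /=; simpc; rewrite expRD cosD sinD.
by congr (_ +i* _)%C; ring.
Qed.

Lemma cexp_sum (I : Type) (s : seq I) (F : I -> R[i]) :
  cexp (\sum_(i <- s) F i) = \prod_(i <- s) cexp (F i).
Proof. by elim/big_rec2 : _ => [|i x y _ <-]; [exact: cexp0|rewrite cexpD]. Qed.

Lemma cexpMn z k : cexp (z *+ k) = cexp z ^+ k.
Proof. by elim: k => [|k IH]; [rewrite cexp0|rewrite mulrS exprS cexpD IH]. Qed.

Lemma cabs_cexp z : cabs (cexp z) = expR (complex.Re z).
Proof.
rewrite cabs_def /cexp/= !exprMn -mulrDr cos2Dsin2 mulr1 sqrtr_sqr ger0_norm//.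
Qed.

Lemma sin_le_abs (x : R) : `|sin x| <= `|x|.
Proof.
wlog x0 : x / 0 <= x.
  by move=> H; have [/H//|/ltW] := leP 0 x; rewrite -oppr_ge0 => /H; rewrite sinN !normrN.
have [c _] := @MVT_segment R sin cos 0 x x0 (fun x _ => is_derive_sin x)
  (continuous_subspaceT (@continuous_sin R)).
rewrite sin0 !subr0 => ->; rewrite normrM ler_piMl//; exact: cos_max.
Qed.

Lemma one_sub_cos (x : R) : `|cos x - 1| <= x ^+ 2.
Proof.
have -> : cos x - 1 = - 2 * sin (x / 2) ^+ 2.
  rewrite [in cos x](splitr x) cosD -!expr2 cos2sin2; ring.
have h : `|sin (x / 2)| ^+ 2 <= (x / 2) ^+ 2.
  rewrite -(real_normK (num_real (x / 2))); apply: lerXn2r; rewrite ?nnegrE//.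
  exact: sin_le_abs.
rewrite normrM normrX normrN (ger0_norm (ler0n R 2)).
rewrite expr_div_n in h; have := sqr_ge0 x; lra.
Qed.

Lemma sin_sub_id (x : R) : `|x| <= 1 -> `|sin x - x| <= x ^+ 2.
Proof.
wlog x0 : x / 0 <= x.
  move=> H; have [/H//|/ltW] := leP 0 x; rewrite -oppr_ge0 => /H.
  by rewrite sinN opprK sqrrN normrN => H' /H'; rewrite -normrN opprD opprK.
move=> x1; have [c] := @MVT_segment R sin cos 0 x x0 (fun x _ => is_derive_sin x)
  (continuous_subspaceT (@continuous_sin R)).
rewrite in_itv/= => /andP[c0 cx].
rewrite sin0 !subr0 => ->; rewrite -[X in _ - X]mul1r -mulrBl normrM expr2.
rewrite (ger0_norm x0) ler_wpM2r//; apply: le_trans (one_sub_cos c) _.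
rewrite ger0_norm// in x1; apply: (@le_trans _ _ (c * 1)).
  by rewrite expr2 ler_wpM2l// (le_trans cx).
by rewrite mulr1.
Qed.

Lemma expR_sub_1D (a : R) : `|a| <= 2^-1 -> `|expR a - 1 - a| <= 2 * a ^+ 2.
Proof.
move=> a2; have /andP[a1 a1'] : - 2^-1 <= a <= 2^-1 by rewrite -ler_norml.
have h1 := expR_ge1Dx a; have h2 := expR_ge1Dx (- a).
have e0 := expR_gt0 a; have sq := sqr_ge0 a.
have h3 : expR a * (1 - a) <= 1.
  by rewrite -[leRHS](expRxMexpNx_1 a) ler_pM2l.
rewrite ger0_norm; last by lra.
have h4 : (expR a - 1 - a) * (1 - a) <= a ^+ 2 by lra.
have h5 : 2^-1 * (expR a - 1 - a) <= (expR a - 1 - a) * (1 - a).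
  by rewrite mulrC ler_wpM2l//; lra.
lra.
Qed.

Lemma cexp_sub_1D w : cabs w <= 2^-1 -> cabs (cexp w - 1 - w) <= 10 * cabs w ^+ 2.
Proof.
move=> w2; have wre := le_trans (Re_le_cabs w) w2; have wim := le_trans (Im_le_cabs w) w2.
have im1 : `|complex.Im w| <= 1 by lra.
have sqr_le (x : R) : `|x| <= cabs w -> x ^+ 2 <= cabs w ^+ 2.
  by move=> xw; rewrite -[x ^+ 2]ger0_norm ?sqr_ge0// normrX; apply: lerXn2r; rewrite ?nnegrE ?cabs_ge0.
have a2 := sqr_le _ (Re_le_cabs w); have b2 := sqr_le _ (Im_le_cabs w).
set a := complex.Re w in wre a2 *; set b := complex.Im w in wim im1 b2 *.
set q := cabs w ^+ 2 in a2 b2 *.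
have ea : expR a <= 2.
  have := expR_sub_1D wre; rewrite ler_norml => /andP[_].
  have : a <= 2^-1 by apply: le_trans wre; exact: ler_norm.
  have : a ^+ 2 <= 4^-1.
    rewrite -(real_normK (num_real a)); apply: (@le_trans _ _ (2^-1 ^+ 2)); last by lra.
    by apply: lerXn2r; rewrite ?nnegrE// invr_ge0.
  lra.
have e0 := expR_gt0 a.
have H1 : `|expR a * cos b - 1 - a| <= 4 * q.
  have -> : expR a * cos b - 1 - a = expR a * (cos b - 1) + (expR a - 1 - a) by ring.
  apply: le_trans (ler_normD _ _) _; rewrite normrM (gtr0_norm e0).
  have := expR_sub_1D wre; have : expR a * `|cos b - 1| <= 2 * q.
    by apply: ler_pM => //; exact: le_trans (one_sub_cos b) b2.
  lra.
have H2 : `|expR a * sin b - b| <= 6 * q.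
  have -> : expR a * sin b - b = (sin b - b) + (expR a - 1 - a) * sin b + a * sin b by ring.
  apply: le_trans (ler_normD _ _) _; apply: (@le_trans _ _ ((q + 4 * q) + q)); last lra.
  apply: lerD; last first.
    rewrite normrM /q expr2; apply: ler_pM => //; first exact: Re_le_cabs.
    by apply: le_trans (sin_le_abs b) _; exact: Im_le_cabs.
  apply: le_trans (ler_normD _ _) _; apply: lerD; first exact: le_trans (sin_sub_id im1) b2.
  rewrite normrM; apply: (@le_trans _ _ (`|expR a - 1 - a| * 1)).
    by apply: ler_wpM2l => //; exact: sin_max.
  have := expR_sub_1D wre; have := sqr_ge0 a; lra.
apply: le_trans (cabs_le_ReIm _) _.
have -> : complex.Re (cexp w - 1 - w) = expR a * cos b - 1 - a.
  by rewrite /cexp /a /b; case: (w).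
have -> : complex.Im (cexp w - 1 - w) = expR a * sin b - b.
  by rewrite /cexp /a /b; case: (w) => x y /=; rewrite subr0.
lra.
Qed.

Lemma pow_sub_pow z w (M : R) k : cabs z <= M -> cabs w <= M ->
  cabs (z ^+ k - w ^+ k) <= k%:R * M ^+ k.-1 * cabs (z - w).
Proof.
move=> zM wM; have M0 : 0 <= M := le_trans (cabs_ge0 _) zM.
rewrite subrXX cabsM mulrC; apply: ler_wpM2r; first exact: cabs_ge0.
apply: le_trans (cabs_sum _ _ _) _.
have -> : k%:R * M ^+ k.-1 = \sum_(i < k) M ^+ k.-1 by rewrite sumr_const card_ord mulr_natl.
apply: ler_sum => i _.
rewrite cabsM !cabsX.
have ik : (i <= k.-1)%N by case: (k) i => [[]//|k'] i /=; rewrite -ltnS.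
rewrite (_ : M ^+ k.-1 = M ^+ (k.-1 - i) * M ^+ i); last by rewrite -exprD subnK.
by apply: ler_pM; rewrite ?exprn_ge0 ?cabs_ge0//; apply: lerXn2r; rewrite ?nnegrE ?cabs_ge0.
Qed.

(** Euler's limit, uniformly on discs: it makes [cexp] a polynomial up to a small error,
    which a quadrature at the roots of unity integrates exactly. *)
Lemma cexp_euler (r del : R) : 0 < r -> 0 < del -> exists2 k : nat, (0 < k)%N &
  forall z, cabs z <= r -> cabs (cexp z - (1 + z / k%:R) ^+ k) <= del.
Proof.
move=> r0 del0.
pose Q := 2 * r + expR r * 10 * r ^+ 2 / del.
have Q0 : 0 < Q.
  by rewrite /Q addr_gt0 ?mulr_gt0 ?divr_gt0 ?expR_gt0 ?exprn_gt0 ?invr_gt0.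
pose k := (Num.truncn Q).+1; exists k => // z zr.
have k0 : 0 < k%:R :> R by rewrite ltr0n.
have Qk : Q < k%:R by exact: truncnS_gt.
have kC : (k%:R : R[i]) = (k%:R : R)%:C%C by rewrite rmorph_nat.
set w := z / k%:R.
have wE : cabs w = cabs z / k%:R by rewrite /w cabsM cabsV kC cabs_real ger0_norm// ltW.
have wr : cabs w <= r / k%:R by rewrite wE ler_pM2r ?invr_gt0.
have rk2 : r / k%:R <= 2^-1.
  rewrite ler_pdivrMr// ; have : 0 < expR r * 10 * r ^+ 2 / del.
    by rewrite !mulr_gt0 ?expR_gt0 ?exprn_gt0 ?invr_gt0.
  rewrite /Q in Qk; lra.
have -> : cexp z = cexp w ^+ k.
  by rewrite -cexpMn /w -[(_ / _) *+ k]mulr_natl mulrCA mulfV ?mulr1// pnatr_eq0.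
have M1 : cabs (cexp w) <= expR (r / k%:R).
  rewrite cabs_cexp ler_expR; apply: le_trans wr; apply: le_trans (Re_le_cabs w); exact: ler_norm.
have M2 : cabs (1 + w) <= expR (r / k%:R).
  apply: le_trans (cabsD _ _) _; rewrite cabs1; apply: le_trans (expR_ge1Dx _); lra.
apply: le_trans (pow_sub_pow k M1 M2) _.
have -> : cexp w - (1 + w) = cexp w - 1 - w by rewrite opprD addrA.
have ek : expR (r / k%:R) ^+ k.-1 <= expR r.
  rewrite -expRM_natl ler_expR mulrCA ler_piMr ?(ltW r0)// ler_pdivrMr// mul1r ler_nat.
  exact: leq_pred.
apply: (@le_trans _ _ (k%:R * expR r * (10 * (r / k%:R) ^+ 2))).
  apply: ler_pM.
  - by rewrite mulr_ge0 ?exprn_ge0 ?expR_ge0 ?(ltW k0).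
  - exact: cabs_ge0.
  - by rewrite ler_pM2l.
  apply: le_trans (cexp_sub_1D (le_trans wr rk2)) _.
  by rewrite ler_pM2l//; apply: lerXn2r; rewrite ?nnegrE ?cabs_ge0// divr_ge0 ?(ltW r0) ?(ltW k0).
have -> : k%:R * expR r * (10 * (r / k%:R) ^+ 2) = expR r * 10 * r ^+ 2 / k%:R.
  by field; rewrite gt_eqF.
rewrite ler_pdivrMr// [del * _]mulrC -ler_pdivrMr//; rewrite /Q in Qk; lra.
Qed.

Lemma prim_root_exists k : (0 < k)%N -> exists z : R[i], k.-primitive_root z.
Proof.
move=> k0; pose p : {poly R[i]} := 'X^k - 1.
have [r Dp] := closed_field_poly_normal p.
rewrite (monicP _) ?monicXnsubC// scale1r in Dp.
have rk : all k.-unity_root r by apply/allP => z; rewrite -root_prod_XsubC -Dp.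
have sz : (k < (size r).+1)%N by rewrite -(size_prod_XsubC r id) -Dp size_XnsubC.
have ur : uniq r.
  by rewrite -separable_prod_XsubC -Dp separable_Xn_sub_1// pnatr_eq0 -lt0n.
by have [z _ Hz] := hasP (cyclic.has_prim_root k0 rk ur sz); exists z.
Qed.

Lemma sum_root_of_unity N (om : R[i]) e : N.-primitive_root om ->
  \sum_(t < N) (om ^+ e) ^+ t = if (N %| e)%N then N%:R else 0.
Proof.
move=> pr; rewrite (prim_order_dvd pr); case: eqP => [->|/eqP e1].
  under eq_bigr do rewrite expr1n; by rewrite sumr_const card_ord.
apply: (mulfI (_ : om ^+ e - 1 != 0)); first by rewrite subr_eq0.
by rewrite mulr0 -subrX1 -exprM mulnC exprM (prim_expr_order pr) expr1n subrr.
Qed.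

(** Discrete form of [u = (2 pi i)^-1 \oint e^(omega u) omega^-2 d omega].  For a
    polynomial of degree [k] in [omega] the mean over the [(k+1)]-st roots of unity
    extracts a coefficient exactly; here the polynomial is [(1 + omega * u / k) ^+ k],
    whose coefficient of [omega] is [u]. *)
Lemma discrete_cauchy (r del : R) : 0 < r -> 0 < del ->
  exists N (om gam : 'I_N -> R[i]),
  [/\ forall t, cabs (om t) = 1, \sum_t cabs (gam t) <= 1 &
   forall u, cabs u <= r -> cabs (\sum_t gam t * cexp (om t * u) - u) <= del].
Proof.
move=> r0 del0; have [k k0 Hk] := cexp_euler r0 del0.
pose N := k.+1; have [z pz] := prim_root_exists (ltn0Sn k).
have z1 : cabs z = 1.
  have : cabs z ^+ N = 1 by rewrite -cabsX (prim_expr_order pz) cabs1.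
  by move/eqP; rewrite pexprn_eq1 ?cabs_ge0// => /eqP.
(* As z ^+ k is the inverse of z, the weights are omega^-1 / N. *)
exists N, (fun t => z ^+ t), (fun t => N%:R^-1 * (z ^+ k) ^+ t).
have NC : (N%:R : R[i]) = (N%:R : R)%:C%C by rewrite rmorph_nat.
have cg (t : 'I_N) : cabs (N%:R^-1 * (z ^+ k) ^+ t) = N%:R^-1.
  by rewrite cabsM cabsV NC cabs_real ger0_norm// !cabsX z1 !expr1n mulr1.
have sg : \sum_(t < N) cabs (N%:R^-1 * (z ^+ k) ^+ t) = 1.
  rewrite (eq_bigr _ (fun t _ => cg t)) sumr_const card_ord -[_^-1 *+ _]mulr_natr mulVf//.
  by rewrite pnatr_eq0.
split; [by move=> t; rewrite cabsX z1 expr1n|by rewrite sg|].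
move=> u ur.
have exact : \sum_(t < N) N%:R^-1 * (z ^+ k) ^+ t * (1 + z ^+ t * u / k%:R) ^+ k = u.
  under eq_bigr => t _ do rewrite exprDn mulr_sumr.
  rewrite exchange_big/= .
  have term (i : 'I_k.+1) : \sum_(t < N) N%:R^-1 * (z ^+ k) ^+ t *
      (1 ^+ (k - i) * (z ^+ t * u / k%:R) ^+ i *+ 'C(k, i)) =
      if i == 1%N :> nat then u else 0.
    rewrite (eq_bigr (fun t : 'I_N => ((u / k%:R) ^+ i *+ 'C(k, i) / N%:R) * (z ^+ (k + i)) ^+ t)); last first.
      move=> t _; rewrite expr1n mul1r -!mulrA exprMn -!exprM mulrnAr.
      rewrite [(k + i)%N]addnC mulnDl exprD [(t * i)%N]mulnC -mulrnAr.
      by ring.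
    rewrite -mulr_sumr (sum_root_of_unity _ pz).
    have -> : (N %| k + i)%N = (i == 1%N :> nat).
      case: i => [[|[|i]] Hi] /=; rewrite /N.
      - by rewrite addn0 gtnNdvd.
      - by rewrite addn1 dvdnn.
      - rewrite (_ : (k + i.+2)%N = (k.+1 + i.+1)%N); last by rewrite addnS addSn.
        by rewrite dvdn_addr// gtnNdvd// ltnW.
    case: eqP => [->|_]; last by rewrite mulr0.
    by rewrite bin1 expr1 divfK ?pnatr_eq0// -[(_ / _) *+ k]mulr_natr divfK// pnatr_eq0 -lt0n.
  rewrite (eq_bigr _ (fun i _ => term i)).
  have k1 : (1 < k.+1)%N by rewrite ltnS.
  rewrite (bigD1 (Ordinal k1))//= big1 ?addr0// => i; rewrite -val_eqE/= => /negbTE -> //.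
rewrite -{2}exact -sumrB.
apply: le_trans (cabs_sum _ _ _) _; rewrite -[del]mul1r -sg mulr_suml.
apply: ler_sum => t _; rewrite -mulrBr cabsM; apply: ler_wpM2l; first exact: cabs_ge0.
by apply: Hk; rewrite cabsM cabsX z1 expr1n mul1r.
Qed.

End ComplexExponential.

(** * Finite expansion of the commutator kernel *)

(** Add points whose vector is not yet in the row space until the rank stops growing. *)
Lemma finite_spanning (F : fieldType) (X : Type) (d : nat) (c : X -> 'rV[F]_d) :
  exists (m : nat) (xs : 'I_m -> X), forall x, (c x <= \matrix_i c (xs i))%MS.
Proof.
suff : forall e m (xs : 'I_m -> X), (d <= \rank (\matrix_i c (xs i)) + e)%N ->
    exists (m : nat) (xs : 'I_m -> X), forall x, (c x <= \matrix_i c (xs i))%MS.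
  move=> H; apply: (H d 0%N (fun i : 'I_0 => match i with Ordinal _ h => False_rect _ (notF h) end)).
  exact: leq_addl.
elim=> [|e IH] m xs rk.
  exists m, xs => x; apply: submx_full; rewrite /row_full eqn_leq rank_leq_col/=.
  by rewrite addn0 in rk.
have [H|] := pselect (forall x, (c x <= \matrix_i c (xs i))%MS); first by exists m, xs.
move/existsNP => [x /negP nx].
pose xs' (i : 'I_m.+1) := if unlift ord0 i is Some j then xs j else x.
apply: (IH _ xs').
have sub : (\matrix_i c (xs i) <= \matrix_i c (xs' i))%MS.
  apply/row_subP => i; rewrite rowK.
  have -> : c (xs i) = row (lift ord0 i) (\matrix_i c (xs' i)) by rewrite rowK /xs' liftK.
  exact: row_sub.
have lt : (\matrix_i c (xs i) < \matrix_i c (xs' i))%MS.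
  rewrite ltmxE sub/=; apply: contra nx; apply: submx_trans.
  have -> : c x = row ord0 (\matrix_i c (xs' i)) by rewrite rowK /xs' unlift_none.
  exact: row_sub.
by apply: leq_trans rk _; rewrite addnS -addSn leq_add2r; exact: rank_ltmx.
Qed.

Section Coefficients.
Variables (R : realType) (n : nat).
Local Notation Rn := (Rn R n).

Lemma prod_le_pow (k : nat) (A : {set 'I_k}) (u : 'I_k -> R) (K : R) : 0 <= K ->
  (forall j, 0 <= u j <= K) -> \prod_(j in A) u j <= (1 + K) ^+ k.
Proof.
move=> K0 uK; apply: (@le_trans _ _ (\prod_(j < k) (1 + K))); last first.
  by rewrite prodr_const card_ord.
rewrite big_mkcond/=; apply: ler_prod => j _; have /andP[u0 uk] := uK j.
by case: ifP => _; rewrite ?u0/=; lra.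
Qed.

(** The product is a linear combination, with coefficients depending on [v], of the [2^k]
    monomials in the [b j x]; finitely many points [xs i] give all vectors of monomials
    by linear combination. *)
Lemma commutator_coeffs (k : nat) (b : 'I_k -> Rn -> R[i]) : (forall j, cmeasurable (b j)) ->
  exists (m : nat) (xs : 'I_m -> Rn) (a : 'I_m -> Rn -> R[i]),
  [/\ forall i, cmeasurable (a i),
      forall K : R, exists K' : R, forall x i, (forall j, cabs (b j x) <= K) -> cabs (a i x) <= K' &
      forall x (v : 'I_k -> R[i]),
        \prod_j (b j x - v j) = \sum_i a i x * \prod_j (b j (xs i) - v j)].
Proof.
move=> mb; pose S := {set 'I_k}; pose d := #|{: S}|.
pose mon (A : S) x := \prod_(j in A) b j x.
pose c (x : Rn) : 'rV[R[i]]_d := \row_e mon (enum_val e) x.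
have [m [xs Hxs]] := finite_spanning c.
pose M := \matrix_i c (xs i).
have Mval i e : M i e = mon (enum_val e) (xs i) by rewrite !mxE.
exists m, xs, (fun i x => (c x *m pinvmx M) 0 i).
have aE i x : (c x *m pinvmx M) 0 i = \sum_e mon (enum_val e) x * pinvmx M e i.
  by rewrite mxE; apply: eq_bigr => e _; rewrite mxE.
split.
- move=> i; under eq_fun do rewrite aE; apply: cmeasurable_sum => e.
  apply: cmeasurableM; last exact: cmeasurable_cst.
  exact: cmeasurable_prod.
- move=> K; exists (\sum_i \sum_e (1 + Num.max 0 K) ^+ k * cabs (pinvmx M e i)) => x i xK.
  have p0 j : 0 <= \sum_e (1 + Num.max 0 K) ^+ k * cabs (pinvmx M e j).
    by apply: sumr_ge0 => e _; rewrite mulr_ge0 ?cabs_ge0// exprn_ge0// addr_ge0// le_max lexx.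
  rewrite (bigD1 i)//=; apply: ler_wpDr; first exact: sumr_ge0.
  rewrite aE; apply: le_trans (cabs_sum _ _ _) _; apply: ler_sum => e _.
  rewrite cabsM; apply: ler_wpM2r; first exact: cabs_ge0.
  rewrite cabs_prod; apply: prod_le_pow; first by rewrite le_max lexx.
  by move=> j; rewrite cabs_ge0/= le_max xK orbT.
move=> x v.
have expand (y : Rn) : \prod_j (b j y - v j) = \sum_(A : S) mon A y * \prod_(j in ~: A) (- v j).
  rewrite bigA_distr; apply: eq_bigr => A _.
  rewrite (bigID (mem A))/=; congr (_ * _).
    by apply: eq_bigr => j ->.
  by apply: eq_big => [j|j]; rewrite ?inE// => /negbTE ->.
have cE A : mon A x = \sum_i (c x *m pinvmx M) 0 i * mon A (xs i).
  have := mulmxKpV (Hxs x); rewrite -/M => /matrixP/(_ 0 (enum_rank A)).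
  rewrite [in X in _ = X]mxE enum_rankK => <-.
  by rewrite mxE; apply: eq_bigr => i _; rewrite Mval enum_rankK.
rewrite expand; under eq_bigr => A _ do rewrite cE mulr_suml.
rewrite exchange_big/=; apply: eq_bigr => i _; rewrite expand mulr_sumr.
by apply: eq_bigr => A _; rewrite mulrA.
Qed.

End Coefficients.

Lemma rat_approx (R : realType) (x e : R) : 0 < e -> exists q : rat, `|x - ratr q| <= e.
Proof.
move=> e0; have : x - e < x + e by lra.
move=> /rat_in_itvoo[q]; rewrite in_itv/= => /andP[h1 h2]; exists q.
by rewrite ler_norml; apply/andP; split; lra.
Qed.

(** * Linear operators composed with a seminorm *)

Section LinearOperator.
Variables (R : realType) (n : nat).
Local Notation Rn := (Rn R n).
Local Notation C := R[i].
Variables (D : set (Rn -> C)) (hD : operator_domain D).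
Variables (V : lmodType C) (N : V -> R).
Hypothesis N_triangle : forall v w, N (v + w) <= N v + N w.
Hypothesis N_scale : forall (a : C) v, N (a *: v) = cabs a * N v.
Variables (calT : (Rn -> C) -> Rn -> V) (T : (Rn -> C) -> Rn -> C).
Hypothesis calT_linear : linear_on D calT.
Hypothesis T_meas : forall f, D f -> cmeasurable (T f).
Hypothesis T_norm : forall f, D f -> forall x, cabs (T f x) = N (calT f x).

Lemma N0 : N 0 = 0.
Proof. by rewrite -(scale0r 0) N_scale cabs0 mul0r. Qed.

Lemma N_ge0 v : 0 <= N v.
Proof.
have := N_triangle v (- v); rewrite subrr N0 -scaleN1r N_scale cabsN cabs1; lra.
Qed.

Lemma N_sum (I : Type) (s : seq I) (F : I -> V) : N (\sum_(i <- s) F i) <= \sum_(i <- s) N (F i).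
Proof.
elim/big_ind2 : _ => //; first by rewrite N0.
by move=> x1 x2 y1 y2 h1 h2; apply: le_trans (N_triangle _ _) (lerD h1 h2).
Qed.

Lemma domain0 : D (fun=> 0). Proof. by case: hD. Qed.

Lemma calT0 x : calT (fun=> 0) x = 0.
Proof.
have := calT_linear (-1) domain0 domain0 x.
rewrite (_ : (fun y : Rn => -1 * 0 + 0) = fun=> 0); last first.
  by apply/funext => y; rewrite mulr0 addr0.
by rewrite scaleN1r addNr.
Qed.

Lemma domain_sum (I : Type) (s : seq I) (a : I -> C) (g : I -> Rn -> C) :
  (forall i, D (g i)) ->
  D (fun y => \sum_(i <- s) a i * g i y) /\
  forall x, calT (fun y => \sum_(i <- s) a i * g i y) x = \sum_(i <- s) a i *: calT (g i) x.
Proof.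
move=> Dg; elim: s => [|i s [IH1 IH2]].
  have -> : (fun y : Rn => \sum_(i <- [::]) a i * g i y) = fun=> 0.
    by apply/funext => y; rewrite big_nil.
  by split; [exact: domain0|move=> x; rewrite big_nil calT0].
have -> : (fun y => \sum_(j <- i :: s) a j * g j y) =
    (fun y => a i * g i y + \sum_(j <- s) a j * g j y).
  by apply/funext => y; rewrite big_cons.
split; first by case: hD => _ _ H _; exact: H.
by move=> x; rewrite calT_linear// IH2 big_cons.
Qed.

Lemma domain_bounded (h f : Rn -> C) (M : R) : cmeasurable h -> (forall x, cabs (h x) <= M) ->
  D f -> D (fun x => h x * f x).
Proof. by move=> mh hM Df; case: hD => _ _ _; apply => //; exists M. Qed.

Lemma domainB f g : D f -> D g -> D (fun x => f x - g x) /\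
  forall x, calT (fun x => f x - g x) x = calT f x - calT g x.
Proof.
move=> Df Dg; have E : (fun x => f x - g x) = (fun x => -1 * g x + f x).
  by apply/funext => x; rewrite mulN1r addrC.
split; rewrite E; first by case: hD => _ _ H _; exact: H.
by move=> x; rewrite calT_linear// scaleN1r addrC.
Qed.

(** For constant rational coefficients the function is the modulus of a value of [T], and
    the general case is a countable infimum of such functions, by
    approximation of the coefficients. *)
Lemma measurable_N_comb (m : nat) (g : 'I_m -> Rn -> C) (a : 'I_m -> Rn -> C) :
  (forall i, D (g i)) -> (forall i, cmeasurable (a i)) ->
  measurable_fun setT (fun x => N (\sum_i a i x *: calT (g i) x)).
Proof.
move=> Dg ma.
pose qc (q : {ffun 'I_m -> rat * rat}) (i : 'I_m) : C := Complex (ratr (q i).1) (ratr (q i).2).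
pose H q x := N (\sum_i qc q i *: calT (g i) x) + \sum_i cabs (a i x - qc q i) * N (calT (g i) x).
have mNg i : measurable_fun setT (fun x => N (calT (g i) x)).
  under eq_fun do rewrite -T_norm//; apply: measurable_cabs; exact: T_meas.
have mH q : measurable_fun setT (H q).
  apply: measurable_funD; last first.
    apply: measurable_sum => i; apply: measurable_funM => //.
    by apply: measurable_cabs; apply: cmeasurableB => //; exact: cmeasurable_cst.
  have [Dq Eq] := domain_sum (index_enum 'I_m) (qc q) Dg.
  under eq_fun do rewrite -Eq -T_norm//; apply: measurable_cabs; exact: T_meas.
(* H q x >= N (...) with near equality for suitable rational q *)
have main c : [set x | N (\sum_i a i x *: calT (g i) x) < c] =
    \bigcup_q [set x | H q x < c].
  apply/seteqP; split => x /=; last first.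
    move=> [q _ /=]; apply: le_lt_trans.
    have -> : \sum_i a i x *: calT (g i) x =
        \sum_i qc q i *: calT (g i) x + \sum_i (a i x - qc q i) *: calT (g i) x.
      by rewrite -big_split/=; apply: eq_bigr => i _; rewrite -scalerDl addrC subrK.
    apply: le_trans (N_triangle _ _) _; rewrite lerD2l.
    apply: le_trans (N_sum _ _) _; apply: ler_sum => i _; by rewrite N_scale.
  move=> Nc; set v := N _ in Nc.
  pose S := \sum_i N (calT (g i) x).
  have S0 : 0 <= S by apply: sumr_ge0 => i _; exact: N_ge0.
  pose tau := (c - v) / (4 * (S + 1)).
  have tau0 : 0 < tau by rewrite divr_gt0 ?subr_gt0// mulr_gt0//; lra.
  have tau20 : 0 < tau / 2 by rewrite divr_gt0.
  have ex i : exists q : rat * rat, cabs (a i x - Complex (ratr q.1) (ratr q.2)) <= tau.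
    have [q1 h1] := rat_approx (complex.Re (a i x)) tau20.
    have [q2 h2] := rat_approx (complex.Im (a i x)) tau20.
    exists (q1, q2); apply: le_trans (cabs_le_ReIm _) _.
    rewrite [leRHS]splitr; case: (a i x) h1 h2 => u w /= h1 h2; exact: lerD.
  have [q Hq] := choice ex.
  exists (finfun q) => //=; rewrite /H.
  have Hq' i : cabs (a i x - qc (finfun q) i) <= tau by rewrite /qc ffunE.
  have E : \sum_i cabs (a i x - qc (finfun q) i) * N (calT (g i) x) <= tau * S.
    by rewrite mulr_sumr; apply: ler_sum => i _; apply: ler_wpM2r => //; exact: N_ge0.
  have E2 : N (\sum_i qc (finfun q) i *: calT (g i) x) <= v + tau * S.
    have -> : \sum_i qc (finfun q) i *: calT (g i) x =
        \sum_i a i x *: calT (g i) x + \sum_i (-1) *: ((a i x - qc (finfun q) i) *: calT (g i) x).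
      rewrite -big_split/=; apply: eq_bigr => i _.
      by rewrite scalerA -scalerDl mulN1r opprB addrC subrK.
    apply: le_trans (N_triangle _ _) _; rewrite lerD2l; apply: le_trans E.
    apply: le_trans (N_sum _ _) _; apply: ler_sum => i _.
    by rewrite !N_scale cabsN cabs1 mul1r.
  have tS : tau * S < (c - v) / 2.
    have -> : (c - v) / 2 = tau * (2 * (S + 1)).
      by rewrite /tau; field; rewrite gt_eqF//; lra.
    by rewrite ltr_pM2l//; lra.
  lra.
move=> mT; apply: (measurability _ (RGenInftyO.measurableE R)) => //.
move=> _ [_ [c ->] <-]; rewrite setTI.
rewrite (_ : _ @^-1` _ = [set x | N (\sum_i a i x *: calT (g i) x) < c]); last first.
  by apply/seteqP; split => x /=; rewrite in_itv.
rewrite main; apply: countable_bigcupT_measurable => //.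
by move=> q; exact: measurable_lt.
Qed.

End LinearOperator.

(** * Banach function spaces *)

Section BanachFunctionSpace.
Variables (R : realType) (n : nat).
Local Notation Rn := (Rn R n).
Local Notation C := R[i].
Variables (sigma : Rn -> R) (X : banach_function_space sigma).
Implicit Types f g h : Rn -> C.

Lemma bfs_le f g : cmeasurable f -> cmeasurable g -> (forall x, cabs (f x) <= cabs (g x)) ->
  (X f <= X g)%E.
Proof. by move=> mf mg fg; apply: bfs_monotone => //; exact: aeW. Qed.

Lemma bfs_norm0 : X (fun=> 0) = 0%E.
Proof. by apply/bfs_eq0; [exact: cmeasurable_cst|exact: aeW]. Qed.

Lemma bfs_leZ f g (c : R) : cmeasurable f -> cmeasurable g -> 0 <= c ->
  (forall x, cabs (f x) <= c * cabs (g x)) -> (X f <= c%:E * X g)%E.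
Proof.
move=> mf mg c0 fg; have -> : (c%:E * X g = X (fun x => c%:C%C * g x)%R)%E.
  by rewrite bfs_homogeneous// cabs_real ger0_norm.
apply: bfs_le => //; first by apply: cmeasurableM => //; exact: cmeasurable_cst.
by move=> x; rewrite cabsM cabs_real ger0_norm.
Qed.

Lemma bfs_le3 f f1 f2 f3 : cmeasurable f -> cmeasurable f1 -> cmeasurable f2 -> cmeasurable f3 ->
  (forall x, cabs (f x) <= cabs (f1 x) + cabs (f2 x) + cabs (f3 x)) ->
  (X f <= X f1 + X f2 + X f3)%E.
Proof.
move=> mf m1 m2 m3 H.
have ma g : cmeasurable g -> cmeasurable (fun x => `|g x|).
  move=> mg; under eq_fun do rewrite -cabsE; apply: cmeasurable_real; exact: measurable_cabs.
apply: (@le_trans _ _ (X (fun x => (`|f1 x| + `|f2 x|) + `|f3 x|))).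
  apply: bfs_le => //.
    by apply: cmeasurableD; [apply: cmeasurableD|]; exact: ma.
  move=> x; apply: le_trans (H x) _; rewrite -!cabsE -!rmorphD/= cabs_real.
  by rewrite ger0_norm// !addr_ge0 ?cabs_ge0.
apply: le_trans (bfs_triangle _ _ _) _; [by apply: cmeasurableD; exact: ma|exact: ma|].
rewrite -bfs_abs//; apply: leeD => //.
by apply: le_trans (bfs_triangle _ _ _) _; [exact: ma|exact: ma|rewrite -!bfs_abs].
Qed.

Lemma bfs_sum_le (I : Type) (s : seq I) (c : I -> R) (h : I -> Rn -> C) :
  (forall i, cmeasurable (h i)) -> (forall i, 0 <= c i) ->
  (X (fun x => (\sum_(i <- s) c i * cabs (h i x))%:C%C)%R <= \sum_(i <- s) (c i)%:E * X (h i))%E.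
Proof.
move=> mh c0; have mc i : cmeasurable (fun x => (c i * cabs (h i x))%:C%C).
  by apply: cmeasurable_real; apply: measurable_funM => //; exact: measurable_cabs.
elim: s => [|i s IH].
  rewrite big_nil; under eq_fun do rewrite big_nil; by rewrite bfs_norm0.
rewrite big_cons; under eq_fun do rewrite big_cons rmorphD.
apply: le_trans (bfs_triangle _ _ _) _; first exact: mc.
  apply: cmeasurable_real; apply: measurable_sum => j.
  by apply: measurable_funM => //; apply: measurable_cabs.
apply: leeD; last exact: IH.
apply: bfs_leZ; [exact: mc|exact: mh|exact: c0|move=> x].
by rewrite cabs_real ger0_norm// mulr_ge0 ?cabs_ge0.
Qed.

End BanachFunctionSpace.

(** * Functions with finitely many values *)

Section Quantize.
Variables (R : realType) (n : nat).
Local Notation Rn := (Rn R n).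
Local Notation C := R[i].

Lemma quantize_real (u : Rn -> R) (L e : R) : measurable_fun setT u -> 0 < e -> 0 <= L ->
  exists (N : nat) (q : Rn -> 'I_N) (val : 'I_N -> R),
    (forall v, measurable [set y | q y = v]) /\
    forall y, `|u y| <= L -> `|u y - val (q y)| <= e.
Proof.
move=> mu e0 L0; pose N := (Num.truncn (2 * L / e)).+1.
pose p y := Num.truncn ((u y + L) / e).
pose q y : 'I_N := inord (p y); exists N, q, (fun v => e * v%:R - L); split.
  move=> v; have mp (i : nat) : measurable [set y | p y = i].
    have mf : measurable_fun setT (fun y => (u y + L) / e).
      by apply: measurable_funM => //; exact: measurable_funD.
    have ml (j : nat) : measurable [set y | (p y <= j)%N].
      rewrite (_ : mkset _ = [set y | (u y + L) / e < j.+1%:R]); first exact: measurable_lt.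
      by apply/seteqP; split => y /=; rewrite truncn_le_nat.
    case: i => [|i].
      rewrite (_ : mkset _ = [set y | (p y <= 0)%N])//.
      by apply/seteqP; split => y /=; rewrite leqn0 => /eqP.
    rewrite (_ : mkset _ = [set y | (p y <= i.+1)%N] `\` [set y | (p y <= i)%N]).
      exact: measurableD.
    apply/seteqP; split => y /=; first by move=> ->; rewrite leqnn ltnn.
    by move=> [h1 /negP]; rewrite -ltnNge => h2; apply/eqP; rewrite eqn_leq h1 h2.
  rewrite (_ : [set y | q y = v] = \bigcup_(i in [set i | inord i = v]) [set y | p y = i]).
    exact: bigcup_measurable.
  by apply/seteqP; split => y /=; [move=> qv; exists (p y)|move=> [i /= iv pi]; rewrite /q pi].
move=> y uL; have := uL; rewrite ler_norml => /andP[u1 u2].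
have ue : 0 <= (u y + L) / e by apply: divr_ge0; [lra|exact: ltW].
have /andP[t1 t2] := truncn_itv ue.
have pN : (p y < N)%N.
  rewrite /N ltnS; apply: le_truncn; rewrite ler_pM2r ?invr_gt0//; lra.
rewrite /q inordK//; rewrite ler_pdivlMr// in t1; rewrite ltr_pdivrMr// -natr1 in t2.
by rewrite /p ler_norml; apply/andP; split; lra.
Qed.

Lemma quantize (k : nat) (b : 'I_k -> Rn -> C) (L e : R) : (forall j, cmeasurable (b j)) ->
  0 < e -> 0 <= L ->
  exists (I : finType) (q : Rn -> I) (val : I -> 'I_k -> C),
    (forall v, measurable [set y | q y = v]) /\
    forall y, (forall j, cabs (b j y) <= L) -> forall j, cabs (b j y - val (q y) j) <= e.
Proof.
move=> mb e0 L0; have e20 : 0 < e / 2 by rewrite divr_gt0.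
have ex j : exists (I : finType) (q : Rn -> I) (val : I -> C),
    (forall v, measurable [set y | q y = v]) /\
    forall y, cabs (b j y) <= L -> cabs (b j y - val (q y)) <= e.
  have [mr mi] := mb j.
  have [N1 [q1 [v1 [m1 h1]]]] := quantize_real mr e20 L0.
  have [N2 [q2 [v2 [m2 h2]]]] := quantize_real mi e20 L0.
  exists ('I_N1 * 'I_N2)%type, (fun y => (q1 y, q2 y)), (fun v => Complex (v1 v.1) (v2 v.2)); split.
    move=> [w1 w2]; rewrite (_ : mkset _ = [set y | q1 y = w1] `&` [set y | q2 y = w2]).
      exact: measurableI.
    by apply/seteqP; split => y /= [<- <-].
  move=> y yL; apply: le_trans (cabs_le_ReIm _) _; rewrite [leRHS]splitr.
  have := h1 y (le_trans (Re_le_cabs _) yL); have := h2 y (le_trans (Im_le_cabs _) yL).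
  case: (b j y) => r i /=; lra.
pose I j := sval (cid (ex j)); pose HI j := svalP (cid (ex j)).
pose q j : Rn -> I j := sval (cid (HI j)); pose Hq j := svalP (cid (HI j)).
pose val j : I j -> C := sval (cid (Hq j)).
have Hval j := svalP (cid (Hq j)).
exists {dffun forall j : 'I_k, I j}, (fun y => [ffun j => q j y] : {dffun forall j : 'I_k, I j}),
  (fun (v : {dffun forall j : 'I_k, I j}) j => val j (v j)); split.
  move=> v; rewrite (_ : mkset _ = \bigcap_(j in [set: 'I_k]) [set y | q j y = v j]).
    by apply: fin_bigcap_measurable => // j _; exact: (Hval j).1.
  apply/seteqP; split => y /=.
    by move=> <- j _ /=; rewrite ffunE.
  by move=> H; apply/ffunP => j; rewrite ffunE; exact: H.
by move=> y yL j; rewrite ffunE; apply: (Hval j).2.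
Qed.

End Quantize.

(** * Products of complex numbers *)

Section ProductEstimates.
Variable R : realType.

(** Telescoping, with the factor 1 <= P j inserted for the position that carries the
    difference. *)
Lemma prod_diff (k : nat) (u w : 'I_k -> R[i]) (P : 'I_k -> R) (d : R) : 0 <= d ->
  (forall j, 1 <= P j) -> (forall j, cabs (u j) <= P j) -> (forall j, cabs (w j) <= P j) ->
  (forall j, cabs (u j - w j) <= d) ->
  cabs (\prod_j u j - \prod_j w j) <= d * k%:R * \prod_j P j.
Proof.
move=> d0; elim: k u w P => [|k IH] u w P P1 uP wP uw.
  by rewrite !big_ord0 subrr cabs0 mulr0 mul0r.
rewrite !big_ord_recl; set U := \prod_(i < k) u _; set W := \prod_(i < k) w _.
set PP := \prod_(i < k) P _.
have -> : u ord0 * U - w ord0 * W = u ord0 * (U - W) + (u ord0 - w ord0) * W by ring.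
apply: le_trans (cabsD _ _) _; rewrite !cabsM.
have H := IH (fun j => u (lift ord0 j)) (fun j => w (lift ord0 j)) (fun j => P (lift ord0 j))
  (fun j => P1 _) (fun j => uP _) (fun j => wP _) (fun j => uw _).
have PP1 : 1 <= PP.
  rewrite -[leLHS](expr1n _ k) -[k in X in X <= _]card_ord -prodr_const.
  by apply: ler_prod => j _; rewrite ler01/=; exact: P1.
have WP : cabs W <= PP.
  by rewrite cabs_prod; apply: ler_prod => j _; rewrite cabs_ge0/=; exact: wP.
have P0 := P1 ord0.
have e1 : cabs (u ord0) * cabs (U - W) <= P ord0 * (d * k%:R * PP).
  by apply: ler_pM; rewrite ?cabs_ge0.
have e2 : cabs (u ord0 - w ord0) * cabs W <= d * (P ord0 * PP).
  apply: ler_pM; rewrite ?cabs_ge0//; apply: le_trans WP _; rewrite ler_peMl//; lra.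
rewrite -natr1; apply: le_trans (lerD e1 e2) _.
by rewrite le_eqVlt; apply/orP; left; apply/eqP; ring.
Qed.

Lemma pow_le_exp (k : nat) : exists2 C1 : R, 0 < C1 &
  forall s : R, 0 <= s -> (1 + s) ^+ k.+1 <= C1 * expR s.
Proof.
exists (k.+1%:R ^+ k.+1 * expR 1); first by rewrite mulr_gt0 ?exprn_gt0 ?expR_gt0.
move=> s s0; rewrite -mulrA -expRD.
have k0 : (0 : R) < k.+1%:R by rewrite ltr0n.
have -> : expR (1 + s) = expR ((1 + s) / k.+1%:R) ^+ k.+1.
  by rewrite -expRM_natl mulrCA mulfV ?mulr1// gt_eqF.
rewrite -exprMn; apply: lerXn2r; rewrite ?nnegrE; [lra|by rewrite mulr_ge0 ?expR_ge0 ?ltW|].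
have h (z : R) : z <= expR z by have := expR_ge1Dx z; lra.
have := h ((1 + s) / k.+1%:R).
by rewrite ler_pdivrMr// [X in _ <= X]mulrC.
Qed.

End ProductEstimates.

Section ProductFormula.
Variable R : realType.
Local Notation C := R[i].

(** One factor of [discrete_cauchy], rescaled by [rho j], for each [u j]; the product of
    the sums is expanded. *)
Lemma product_cauchy (k : nat) (rho : 'I_k -> R) (W del : R) :
  (forall j, 0 < rho j) -> 0 <= W -> 0 < del ->
  exists (L : finType) (Gam : L -> C) (z : L -> 'I_k -> C),
    [/\ forall l j, cabs (z l j) <= rho j,
        \sum_l cabs (Gam l) <= \prod_j (rho j)^-1 &
        forall u : 'I_k -> C, (forall j, cabs (u j) <= W) ->
          cabs (\prod_j u j - \sum_l Gam l * cexp (\sum_j z l j * u j)) <= del].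
Proof.
move=> rho0 W0 del0.
have ri0 j : 0 <= (rho j)^-1 by rewrite invr_ge0 ltW.
set R0 := \sum_j (rho j)^-1; have R00 : 0 <= R0 by apply: sumr_ge0.
have R0le j : (rho j)^-1 <= R0 by rewrite /R0 (bigD1 j)//= lerDl; apply: sumr_ge0.
pose c := k%:R * (W + 1) ^+ k.
have c0 : 0 <= c by rewrite mulr_ge0// exprn_ge0//; lra.
pose d := Num.min 1 (del / (c + 1)).
have d0 : 0 < d by rewrite lt_min ltr01 divr_gt0//; lra.
have dc : d * c <= del.
  apply: le_trans (_ : del / (c + 1) * c <= _).
    by apply: ler_wpM2r => //; rewrite ge_min lexx orbT.
  rewrite mulrAC ler_pdivrMr; last by lra.
  by rewrite mulrDr mulr1 lerDl ltW.
have d1 : d <= 1 by rewrite ge_min lexx.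
pose r := 1 + W * \sum_j rho j.
have sr0 : 0 <= \sum_j rho j by apply: sumr_ge0 => j _; exact: ltW.
have r0 : 0 < r by have := mulr_ge0 W0 sr0; rewrite /r; lra.
have e0 : 0 < d / (R0 + 1) by rewrite divr_gt0//; lra.
have [N [om [gam [om1 gam1 happ]]]] := discrete_cauchy r0 e0.
pose h j (u : C) := (rho j)^-1%:C%C * \sum_t gam t * cexp (om t * ((rho j)%:C%C * u)).
exists {ffun 'I_k -> 'I_N}, (fun l : {ffun 'I_k -> 'I_N} => \prod_j ((rho j)^-1%:C%C * gam (l j))),
  (fun (l : {ffun 'I_k -> 'I_N}) j => om (l j) * (rho j)%:C%C); split.
- by move=> l j; rewrite cabsM om1 mul1r cabs_real gtr0_norm.
- rewrite [X in X <= _](_ : _ = \sum_(l : {ffun 'I_k -> 'I_N}) \prod_j cabs ((rho j)^-1%:C%C * gam (l j))); last by apply: eq_bigr => l _; rewrite cabs_prod.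
  rewrite -(bigA_distr_bigA (fun j t => cabs ((rho j)^-1%:C%C * gam t))).
  apply: ler_prod => j _; apply/andP; split; first by apply: sumr_ge0 => *; exact: cabs_ge0.
  under eq_bigr => t _ do rewrite cabsM cabs_real (ger0_norm (ri0 j)).
  by rewrite -mulr_sumr ler_piMr.
move=> u uW.
have -> : \sum_(l : {ffun 'I_k -> 'I_N}) (\prod_j ((rho j)^-1%:C%C * gam (l j))) *
    cexp (\sum_j om (l j) * (rho j)%:C%C * u j) = \prod_j h j (u j).
  rewrite /h; under [RHS]eq_bigr => j _ do rewrite mulr_sumr.
  rewrite bigA_distr_bigA; apply: eq_bigr => l _.
  by rewrite cexp_sum -big_split/=; apply: eq_bigr => j _; rewrite !mulrA.
have uh j : cabs (u j - h j (u j)) <= d.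
  have rj := rho0 j.
  have -> : u j - h j (u j) = (rho j)^-1%:C%C *
      - (\sum_t gam t * cexp (om t * ((rho j)%:C%C * u j)) - (rho j)%:C%C * u j).
    rewrite /h opprB mulrBr mulrA -rmorphM/= mulVf ?gt_eqF// mul1r. by [].
  rewrite cabsM cabsN cabs_real ger0_norm//.
  have ur : cabs ((rho j)%:C%C * u j) <= r.
    rewrite cabsM cabs_real gtr0_norm// mulrC.
    apply: le_trans (_ : W * \sum_j rho j <= _); last by rewrite /r; lra.
    apply: ler_pM; rewrite ?cabs_ge0 ?(ltW rj)//.
    by rewrite (bigD1 j)//= lerDl; apply: sumr_ge0 => i _; exact: ltW.
  apply: le_trans (_ : R0 * (d / (R0 + 1)) <= _).
    by apply: ler_pM; rewrite ?cabs_ge0//; exact: happ.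
  rewrite mulrA ler_pdivrMr; last by lra.
  by rewrite mulrDr mulr1 mulrC lerDl ltW.
apply: le_trans (prod_diff (ltW d0) (P := fun=> W + 1) _ _ _ uh) _.
- by move=> j; lra.
- by move=> j; apply: le_trans (uW j) _; lra.
- move=> j; have -> : h j (u j) = u j - (u j - h j (u j)) by ring.
  by apply: le_trans (cabsB _ _) _; have := uW j; have := uh j; lra.
by rewrite prodr_const card_ord -mulrA.
Qed.

End ProductFormula.

(** * The commutator estimate for a fixed pair of weights *)

Section MainEstimate.
Variables (R : realType) (n : nat).
Local Notation Rn := (Rn R n).
Local Notation C := R[i].
Variables (sigma : Rn -> R) (X Y : banach_function_space sigma).
Variables (D : set (Rn -> C)) (hD : operator_domain D).
Variables (V : lmodType C) (N : V -> R).
Hypothesis N_triangle : forall v w, N (v + w) <= N v + N w.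
Hypothesis N_scale : forall (a : C) v, N (a *: v) = cabs a * N v.
Variables (calT : (Rn -> C) -> Rn -> V) (T : (Rn -> C) -> Rn -> C).
Hypothesis calT_linear : linear_on D calT.
Hypothesis T_meas : forall f, D f -> cmeasurable (T f).
Hypothesis T_norm : forall f, D f -> forall x, cabs (T f x) = N (calT f x).

Variables (k : nat) (b : 'I_k -> Rn -> C) (mb : forall j, cmeasurable (b j)).
Variables (rho : 'I_k -> R) (rho0 : forall j, 0 < rho j).
Variables (mu lam : Rn -> R) (mmu : measurable_fun setT mu) (mlam : measurable_fun setT lam).
Variables (Mb : R) (Mb0 : 0 <= Mb).

Let rot (z : 'I_k -> C) (x : Rn) : R := complex.Re (\sum_j z j * b j x).
Let s (x : Rn) : R := \sum_j rho j * cabs (b j x).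

Hypothesis bound_rot : forall z, (forall j, cabs (z j) <= rho j) -> forall g, D g ->
  (Y (fun x => T g x * (lam x * expR (rot z x))%:C%C)%R <=
   Mb%:E * X (fun x => g x * (mu x * expR (rot z x))%:C%C)%R)%E.
Hypothesis bound_dec : forall g, D g ->
  (Y (fun x => T g x * (lam x * expR (- s x))%:C%C)%R <=
   Mb%:E * X (fun x => g x * (mu x * expR (- s x))%:C%C)%R)%E.

Variables (f : Rn -> C) (hf : commutator_domain D b f).
Hypothesis mC : cmeasurable (commutator T b f).
Variables (xf : R) (hxf : X (fun x => f x * (mu x)%:C%C) = xf%:E).

Let mf : cmeasurable f. Proof. exact: hf.1. Qed.

Lemma decay_ge0 x : 0 <= s x.
Proof. by apply: sumr_ge0 => j _; rewrite mulr_ge0 ?cabs_ge0// ltW. Qed.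

Lemma measurable_decay : measurable_fun setT s.
Proof. by apply: measurable_sum => j; apply: measurable_funM => //; exact: measurable_cabs. Qed.

Lemma cabs_le_decay j x : cabs (b j x) <= s x * \sum_j (rho j)^-1.
Proof.
have r0 i : 0 <= (rho i)^-1 by rewrite invr_ge0 ltW.
have h1 : rho j * cabs (b j x) <= s x.
  rewrite /s (bigD1 j)//= lerDl; apply: sumr_ge0 => i _.
  by rewrite mulr_ge0 ?cabs_ge0// ltW.
have h2 : (rho j)^-1 <= \sum_j (rho j)^-1.
  by rewrite (bigD1 j)//= lerDl; apply: sumr_ge0.
apply: le_trans (_ : (rho j * cabs (b j x)) * (rho j)^-1 <= _).
  by rewrite mulrC mulKf// gt_eqF.
by apply: ler_pM => //; rewrite mulr_ge0 ?cabs_ge0// ltW.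
Qed.

Lemma measurable_rot z : measurable_fun setT (rot z).
Proof.
have [] : cmeasurable (fun x => \sum_j z j * b j x) => //.
apply: cmeasurable_sum => j; apply: cmeasurableM => //; exact: cmeasurable_cst.
Qed.

Let weighted (g : Rn -> C) (w : Rn -> R) : cmeasurable g -> measurable_fun setT w ->
  cmeasurable (fun x => g x * (w x)%:C%C).
Proof. by move=> mg mw; apply: cmeasurableM => //; exact: cmeasurable_real. Qed.

Let Dmeas g : D g -> cmeasurable g. Proof. by case: hD => H _ _ _; exact: H. Qed.

Let xf0 : 0 <= xf.
Proof. by rewrite -lee_fin -hxf; apply: bfs_ge0; exact: weighted. Qed.

Let X_le (g : Rn -> C) (w : Rn -> R) (c : R) : cmeasurable g -> measurable_fun setT w -> 0 <= c ->
  (forall x, 0 < w x) -> (forall x, cabs (g x) * w x <= c * cabs (f x)) ->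
  (X (fun x => g x * (mu x * w x)%:C%C)%R <= (c * xf)%:E)%E.
Proof.
move=> mg mw c0 w0 H; rewrite EFinM -hxf; apply: bfs_leZ => //.
- by apply: weighted => //; exact: measurable_funM.
- exact: weighted.
move=> x; rewrite !cabsM !cabs_real normrM (gtr0_norm (w0 x)).
by rewrite mulrCA [leRHS]mulrA [leRHS]mulrC; apply: ler_wpM2l.
Qed.

Let Y_sum (I : finType) (c : I -> R) (h : I -> Rn -> C) (B : R) :
  (forall i, cmeasurable (h i)) -> (forall i, 0 <= c i) -> (forall i, (Y (h i) <= B%:E)%E) ->
  (Y (fun x => (\sum_i c i * cabs (h i x))%:C%C)%R <= ((\sum_i c i) * B)%:E)%E.
Proof.
move=> mh c0 hB; apply: le_trans (bfs_sum_le _ _ mh c0) _.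
rewrite mulr_suml -sumEFin; apply: lee_sum => i _; rewrite EFinM.
by apply: lee_wpmul2l; rewrite ?lee_fin.
Qed.

Let transfer (g : Rn -> C) (w : Rn -> R) (c : R) : D g -> measurable_fun setT w -> 0 <= c ->
  (forall x, 0 < w x) -> (forall x, cabs (g x) * w x <= c * cabs (f x)) ->
  (Y (fun x => T g x * (lam x * w x)%:C%C)%R <=
   Mb%:E * X (fun x => g x * (mu x * w x)%:C%C)%R)%E ->
  (Y (fun x => T g x * (lam x * w x)%:C%C)%R <= (Mb * (c * xf))%:E)%E.
Proof.
move=> Dg mw c0 w0 H hY; apply: le_trans hY _; rewrite EFinM.
by apply: lee_wpmul2l; [rewrite lee_fin|exact: (X_le (Dmeas Dg))].
Qed.

(** [eta] is the fineness of the discretization and [del] the error of the quadrature.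
    On [s x <= K] the commutator is a sum of three terms ([calCf3]): the quadrature, whose
    terms are [cexp (sum_j z_j b_j(x)) * T (G l) x] with [G l] the discretization of
    [exp (- sum_j z_j b_j) f]; the error of the quadrature; and the images under [T] of
    the differences [d i] between [g i] and its discretization. *)
Lemma discretized_estimate (K : R) : exists2 K2 : R, 0 <= K2 & forall eta del : R, 0 < eta <= 1 -> 0 < del ->
  (Y (fun x => (commutator T b f x * (\1_[set x | s x <= K] x)%:C%C) * (lam x)%:C%C)%R <=
   (((\prod_j (rho j)^-1) * expR (eta * \sum_j rho j) + del + K2 * eta) * Mb * xf)%:E)%E.
Proof.
have [m [xs [a [ma aK aE]]]] := commutator_coeffs mb.
set R0 := \sum_j (rho j)^-1.
have R00 : 0 <= R0 by apply: sumr_ge0 => j _; rewrite invr_ge0 ltW.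
have [K1 HK1] := aK (Num.max 0 K * R0).
pose K' := Num.max 0 K1.
have K'0 : 0 <= K' by rewrite le_max lexx.
have aK' x i : s x <= K -> cabs (a i x) <= K'.
  move=> sK; rewrite le_max; apply/orP; right; apply: HK1 => j.
  apply: le_trans (cabs_le_decay j x) _; apply: ler_wpM2r => //.
  by rewrite le_max sK orbT.
pose g i := commutator_integrand b f (xs i).
have Dg i : D (g i) by exact: hf.2.
pose gt i y := \prod_j (b j (xs i) - b j y).
have gE i y : g i y = gt i y * f y by [].
have mgt i : cmeasurable (gt i).
  by apply: cmeasurable_prod => j; apply: cmeasurableB => //; exact: cmeasurable_cst.
have intE x : commutator_integrand b f x = fun y => \sum_i a i x * g i y.
  apply/funext => y; rewrite /commutator_integrand (aE x (fun j => b j y)) mulr_suml.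
  by apply: eq_bigr => i _; rewrite -mulrA.
have calCf x : calT (commutator_integrand b f x) x = \sum_i a i x *: calT (g i) x.
  by rewrite intE; exact: (domain_sum hD calT_linear (index_enum 'I_m) (fun i => a i x) Dg).2.
(* Growth of the kernels (b_j(xs i) - b_j(y)), dominated by e^(s y) *)
pose Bx := \sum_i \sum_j cabs (b j (xs i)).
have Bxle i j : cabs (b j (xs i)) <= Bx.
  rewrite /Bx (bigD1 i)//= (bigD1 j)//= -addrA lerDl addr_ge0//.
    by apply: sumr_ge0 => *; exact: cabs_ge0.
  by apply: sumr_ge0 => *; apply: sumr_ge0 => *; exact: cabs_ge0.
have Bx0 : 0 <= Bx by apply: sumr_ge0 => *; apply: sumr_ge0 => *; exact: cabs_ge0.
pose Q := 1 + Bx + R0.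
have Q1 : 1 <= Q by rewrite /Q; lra.
have [C1 C10 HC1] := pow_le_exp R k.
pose P i y j := 1 + cabs (b j (xs i)) + cabs (b j y).
have P1 i y j : 1 <= P i y j by rewrite /P; have := cabs_ge0 (b j (xs i)); have := cabs_ge0 (b j y); lra.
have Pprod i y : \prod_j P i y j <= Q ^+ k * (1 + s y) ^+ k.
  rewrite -exprMn -[k in X in _ <= X]card_ord -prodr_const.
  apply: ler_prod => j _; apply/andP; split; first by have := P1 i y j; lra.
  rewrite /P /Q; have := Bxle i j; have := cabs_le_decay j y; have := decay_ge0 y; rewrite -/R0 => s0.
  have : 0 <= s y * (1 + Bx) by rewrite mulr_ge0//; lra.
  lra.
have Pexp i y : (\prod_j P i y j) * expR (- s y) * (1 + s y) <= Q ^+ k * C1.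
  have s0 := decay_ge0 y.
  apply: le_trans (_ : Q ^+ k * (1 + s y) ^+ k * expR (- s y) * (1 + s y) <= _).
    by apply: ler_wpM2r; [lra|apply: ler_wpM2r => //; exact: expR_ge0].
  have -> : Q ^+ k * (1 + s y) ^+ k * expR (- s y) * (1 + s y) =
     Q ^+ k * ((1 + s y) ^+ k.+1 * expR (- s y)) by rewrite exprSr; ring.
  apply: ler_wpM2l; first by rewrite exprn_ge0//; lra.
  rewrite expRN ler_pdivrMr ?expR_gt0//; exact: HC1.
pose Cd := 1 + (k%:R + 1) * (Q ^+ k * C1).
have QC0 : 0 <= Q ^+ k * C1 by rewrite mulr_ge0 ?exprn_ge0 ?(ltW C10)//; lra.
have Cd0 : 0 <= Cd by rewrite addr_ge0// mulr_ge0.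
exists (K' * expR K * m%:R * Cd).
  by rewrite !mulr_ge0 ?expR_ge0.
move=> eta del /andP[eta0 eta1] del0.
(* On E the decay s is bounded, and one of the kernels gt i is not small, so that
   f restricted to E is a bounded combination of the g i and belongs to D. *)
pose M := eta^-1.
have M0 : 0 < M by rewrite invr_gt0.
pose q2 y := \sum_i cabs (gt i y) ^+ 2.
have mq2 : measurable_fun setT q2.
  by apply: measurable_sum => i; apply: measurable_funX; exact: measurable_cabs.
pose E := [set y | s y <= M] `&` [set y | eta ^+ 2 <= q2 y].
have mE : measurable E.
  apply: measurableI; first by apply: measurable_le => //; exact: measurable_decay.
  exact: measurable_le.
have ind01 (A : set Rn) y : 0 <= (\1_A y : R) <= 1.
  by rewrite indicE; case: (_ \in _); rewrite ?lexx ler01.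
have cind (A : set Rn) y : cabs ((\1_A y : R)%:C%C) <= 1.
  by rewrite cabs_real ger0_norm; case/andP: (ind01 A y).
pose fE y := (\1_E y)%:C%C * f y.
have DfE : D fE.
  pose h i y : C := (\1_E y)%:C%C * ((gt i y)^*%C * ((q2 y)^-1)%:C%C).
  have mh i : cmeasurable (h i).
    apply: cmeasurableM; first exact: cmeasurable_indic.
    apply: cmeasurableM; first exact: cmeasurable_conj.
    apply: cmeasurable_real; rewrite (_ : (fun y => _) = fun y => q2 y `^ (-1)); last first.
      apply/funext => y; rewrite powR_inv1//; apply: sumr_ge0 => *.
      by rewrite exprn_ge0 ?cabs_ge0.
    exact: measurable_fun_powR.
  have hM i y : cabs (h i y) <= M.
    rewrite /h cabsM cabs_real indicE; case: (boolP (y \in E)) => [|_]; last first.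
      by rewrite normr0 mul0r ltW.
    rewrite inE => -[_ /= etaq]; rewrite normr1 mul1r cabsM cabs_conj cabs_real.
    have qpos : 0 < q2 y by apply: lt_le_trans etaq; rewrite exprn_gt0.
    rewrite ger0_norm ?invr_ge0 ?(ltW qpos)// ler_pdivrMr// mulrC ler_pdivlMr//.
    have gi : cabs (gt i y) ^+ 2 <= q2 y.
      by rewrite /q2 (bigD1 i)//= lerDl; apply: sumr_ge0 => *; rewrite exprn_ge0 ?cabs_ge0.
    have g0 := cabs_ge0 (gt i y).
    have [ge|lt] := leP eta (cabs (gt i y)).
      by apply: le_trans gi; rewrite expr2; exact: ler_wpM2l.
    by apply: le_trans etaq; rewrite expr2; apply: ler_wpM2r; [exact: ltW|exact: ltW].
  have Dh i : D (fun y => h i y * g i y) by exact: (domain_bounded hD (mh i) (hM i) (Dg i)).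
  have [] := domain_sum hD calT_linear (index_enum 'I_m) (fun=> 1) Dh.
  suff -> : (fun y => \sum_i 1 * (h i y * g i y)) = fE by [].
  apply/funext => y; rewrite /fE /h; under eq_bigr => i _ do rewrite mul1r gE.
  rewrite indicE; case: (boolP (y \in E)) => [|_]; last first.
    by rewrite mul0r big1// => i _; rewrite !mul0r.
  rewrite inE => -[_ /= etaq].
  have qpos : 0 < q2 y by apply: lt_le_trans etaq; rewrite exprn_gt0.
  rewrite mul1r.
  rewrite (eq_bigr (fun i => ((q2 y)^-1 * cabs (gt i y) ^+ 2)%:C%C * f y)); last first.
    by move=> i _; rewrite mul1r rmorphM/= -mul_conjE; ring.
  rewrite -mulr_suml -rmorph_sum/= -mulr_sumr -/(q2 y) mulVf ?gt_eqF//.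
  by rewrite mul1r.
have [I [q [val [mq Hq]]]] := quantize mb eta0 (mulr_ge0 (ltW M0) R00).
have Hval y : E y -> forall j, cabs (b j y - val (q y) j) <= eta.
  move=> [sM _]; apply: Hq => j; apply: le_trans (cabs_le_decay j y) _.
  exact: ler_wpM2r.
pose gv (v : I) y := (\1_[set y | q y = v] y)%:C%C * fE y.
have Dgv v : D (gv v).
  have cm := cmeasurable_indic (mq v).
  have H := domain_bounded hD cm (cind [set y | q y = v]) DfE.
  exact: H.
have sum_gv (c : I -> C) y : \sum_v c v * gv v y = c (q y) * fE y.
  rewrite (bigD1 (q y))//= big1 ?addr0; last first.
    move=> v vq; rewrite /gv indicE memNset ?mul0r ?mulr0//=.
    by move=> qv; move: vq; rewrite qv eqxx.
  by rewrite /gv indicE mem_set// mul1r.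
pose gM x y := \sum_v (\prod_j (b j x - val v j)) * gv v y.
have DgM x : D (gM x) /\
  forall z, calT (gM x) z = \sum_v (\prod_j (b j x - val v j)) *: calT (gv v) z.
  exact: (domain_sum hD calT_linear (index_enum I) (fun v => \prod_j (b j x - val v j)) Dgv).
pose d i y := g i y - gM (xs i) y.
have Dd i : D (d i) /\ forall x, calT (d i) x = calT (g i) x - calT (gM (xs i)) x.
  exact: (domainB hD calT_linear (Dg i) (DgM (xs i)).1).
(* On E this is the fineness of val; elsewhere either gt i y is small or s y > M. *)
have dbound i y : cabs (d i y) * expR (- s y) <= Cd * eta * cabs (f y).
  have e0 := expR_gt0 (- s y); have s0 := decay_ge0 y.
  have e1 : expR (- s y) <= 1 by rewrite -expR0 ler_expR oppr_le0.
  have -> : d i y = (gt i y - (\1_E y)%:C%C * \prod_j (b j (xs i) - val (q y) j)) * f y.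
    by rewrite /d /gM sum_gv gE /fE; ring.
  rewrite cabsM mulrAC; apply: ler_wpM2r; first exact: cabs_ge0.
  have gP : cabs (gt i y) <= \prod_j P i y j.
    rewrite cabs_prod; apply: ler_prod => j _; rewrite cabs_ge0/=.
    by apply: le_trans (cabsB _ _) _; rewrite /P -addrA lerDr.
  have PP0 : 0 <= \prod_j P i y j by apply: prodr_ge0 => j _; exact: le_trans ler01 (P1 i y j).
  have PE1 : (\prod_j P i y j) * expR (- s y) <= Q ^+ k * C1.
    apply: le_trans (Pexp i y); rewrite ler_peMr ?lerDl//.
    by rewrite mulr_ge0// ltW.
  rewrite indicE; have [Ey|nE] := pselect (E y).
    rewrite mem_set// mul1r.
    have hv j := Hval y Ey j.
    have h1 j : cabs (b j (xs i) - b j y) <= P i y j.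
      by apply: le_trans (cabsB _ _) _; rewrite /P -addrA lerDr.
    have h2 j : cabs (b j (xs i) - val (q y) j) <= P i y j.
      have -> : b j (xs i) - val (q y) j = b j (xs i) - b j y + (b j y - val (q y) j) by ring.
      apply: le_trans (cabsD _ _) _; apply: le_trans (lerD (cabsB _ _) (hv j)) _.
      by rewrite /P addrC -[leRHS]addrA lerD2r.
    have h3 j : cabs (b j (xs i) - b j y - (b j (xs i) - val (q y) j)) <= eta.
      have -> : b j (xs i) - b j y - (b j (xs i) - val (q y) j) = - (b j y - val (q y) j) by ring.
      by rewrite cabsN.
    apply: le_trans (_ : eta * k%:R * (\prod_j P i y j) * expR (- s y) <= _).
      by apply: ler_wpM2r; [exact: ltW|exact: (prod_diff (ltW eta0) (P1 i y) h1 h2 h3)].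
    have -> : eta * k%:R * (\prod_j P i y j) * expR (- s y) =
       eta * (k%:R * ((\prod_j P i y j) * expR (- s y))) by ring.
    rewrite [leRHS]mulrC; apply: ler_wpM2l; first exact: ltW.
    apply: le_trans (_ : k%:R * (Q ^+ k * C1) <= _); first exact: ler_wpM2l.
    by rewrite /Cd mulrDl mul1r addrCA lerDl addr_ge0.
  rewrite memNset// mul0r subr0.
  have [sM|sM] := leP (s y) M.
    have q2small : q2 y < eta ^+ 2 by rewrite ltNge; apply/negP => h; apply: nE.
    have : cabs (gt i y) ^+ 2 <= q2 y.
      by rewrite /q2 (bigD1 i)//= lerDl; apply: sumr_ge0 => *; rewrite exprn_ge0 ?cabs_ge0.
    move=> /le_lt_trans/(_ q2small); rewrite ltr_pXn2r ?nnegrE ?cabs_ge0 ?(ltW eta0)// => gle.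
    apply: le_trans (_ : eta * 1 <= _).
      by apply: ler_pM; rewrite ?cabs_ge0 ?expR_ge0 ?(ltW gle).
    by rewrite mulr1 ler_peMl ?(ltW eta0)// /Cd lerDl mulr_ge0.
  apply: le_trans (_ : (\prod_j P i y j) * expR (- s y) <= _).
    by apply: ler_wpM2r => //; exact: ltW.
  have PE0 : 0 <= (\prod_j P i y j) * expR (- s y) by rewrite mulr_ge0// ltW.
  have : (\prod_j P i y j) * expR (- s y) * M <= Q ^+ k * C1.
    apply: le_trans (Pexp i y); apply: ler_wpM2l => //.
    by apply: ler_wpDl => //; exact: ltW.
  rewrite -ler_pdivlMr// /M invrK => /le_trans; apply.
  apply: ler_wpM2r; first exact: ltW.
  by rewrite /Cd mulrDl mul1r addrA lerDr addr_ge0// mulr_ge0.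
pose W := Num.max 0 K * R0 + \sum_v \sum_j cabs (val v j).
have W0 : 0 <= W.
  rewrite addr_ge0 ?mulr_ge0 ?le_max ?lexx//.
  by apply: sumr_ge0 => *; apply: sumr_ge0 => *; exact: cabs_ge0.
have Wle x v j : s x <= K -> cabs (b j x - val v j) <= W.
  move=> sK; apply: le_trans (cabsB _ _) _; apply: lerD.
    apply: le_trans (cabs_le_decay j x) _; apply: ler_wpM2r => //.
    by rewrite le_max sK orbT.
  rewrite (bigD1 v)//= (bigD1 j)//= -addrA lerDl addr_ge0//.
    by apply: sumr_ge0 => *; exact: cabs_ge0.
  by apply: sumr_ge0 => *; apply: sumr_ge0 => *; exact: cabs_ge0.
pose del' := del / (#|I|%:R + 1).
have cI0 : (0 : R) < #|I|%:R + 1 by rewrite ltr_wpDl.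
have del'0 : 0 < del' by rewrite divr_gt0.
have [L [Gam [z [Hz HGam Happ]]]] := product_cauchy rho0 W0 del'0.
pose G l y := \sum_v cexp (- \sum_j z l j * val v j) * gv v y.
have DG l : D (G l) /\
    forall x, calT (G l) x = \sum_v cexp (- \sum_j z l j * val v j) *: calT (gv v) x.
  exact: (domain_sum hD calT_linear (index_enum I) (fun v => cexp (- \sum_j z l j * val v j)) Dgv).
have calCf2 x : calT (commutator_integrand b f x) x =
    \sum_v (\prod_j (b j x - val v j)) *: calT (gv v) x + \sum_i a i x *: calT (d i) x.
  rewrite calCf.
  under [X in _ + X]eq_bigr => i _ do
    rewrite (Dd i).2 scalerBr (DgM (xs i)).2 scaler_sumr.
  rewrite sumrB addrCA -[LHS]addr0; congr (_ + _).
  rewrite exchange_big/= -sumrB big1// => v _.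
  by rewrite aE scaler_suml -sumrB big1// => i _; rewrite scalerA subrr.
pose err x v := \prod_j (b j x - val v j) -
  \sum_l Gam l * cexp (\sum_j z l j * (b j x - val v j)).
(* The weights err x v are small when s x <= K. *)
have calCf3 x : calT (commutator_integrand b f x) x =
    \sum_l (Gam l * cexp (\sum_j z l j * b j x)) *: calT (G l) x +
    \sum_v err x v *: calT (gv v) x + \sum_i a i x *: calT (d i) x.
  rewrite calCf2; congr (_ + _).
  under [X in _ = X + _]eq_bigr => l _ do rewrite (DG l).2 scaler_sumr.
  rewrite exchange_big/= -big_split/=; apply: eq_bigr => v _.
  under [X in _ = X + _]eq_bigr => l _ do rewrite scalerA.
  rewrite -scaler_suml -scalerDl; congr (_ *: _).
  rewrite /err addrC -[LHS]addr0 -addrA; congr (_ + _); apply/esym/eqP.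
  rewrite addrC subr_eq0; apply/eqP; apply: eq_bigr => l _.
  rewrite -mulrA -cexpD; congr (_ * cexp _).
  by rewrite -sumrB; apply: eq_bigr => j _; rewrite mulrBr.
have NT g0 x : D g0 -> N (calT g0 x) = cabs (T g0 x) by move=> Dg0; rewrite T_norm.
have pointwise x : s x <= K -> cabs (commutator T b f x) <=
    \sum_l cabs (Gam l) * (expR (rot (z l) x) * cabs (T (G l) x)) +
    \sum_v del' * cabs (T (gv v) x) + \sum_i K' * cabs (T (d i) x).
  move=> sK; rewrite /commutator T_norm; last exact: hf.2.
  rewrite calCf3; apply: le_trans (N_triangle _ _) _; apply: lerD.
    apply: le_trans (N_triangle _ _) _; apply: lerD.
      apply: le_trans (N_sum N_triangle N_scale _ _) _; apply: ler_sum => l _.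
      by rewrite N_scale cabsM cabs_cexp mulrA NT//; exact: (DG l).1.
    apply: le_trans (N_sum N_triangle N_scale _ _) _; apply: ler_sum => v _.
    rewrite N_scale NT//; apply: ler_wpM2r; first exact: cabs_ge0.
    by apply: Happ => j; exact: Wle.
  apply: le_trans (N_sum N_triangle N_scale _ _) _; apply: ler_sum => i _.
  rewrite N_scale NT; last exact: (Dd i).1.
  by apply: ler_wpM2r; [exact: cabs_ge0|exact: aK'].
pose h1 l x := T (G l) x * (lam x * expR (rot (z l) x))%:C%C.
pose h2 v x := T (gv v) x * (lam x * expR (rot (fun=> 0) x))%:C%C.
pose h3 i x := T (d i) x * (lam x * expR (- s x))%:C%C.
have mer z' : measurable_fun setT (fun x => expR (rot z' x)).
  by apply: measurableT_comp => //; exact: measurable_rot.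
have mes : measurable_fun setT (fun x => expR (- s x)).
  apply: measurableT_comp => //; apply: measurableT_comp => //; exact: measurable_decay.
have mh1 l : cmeasurable (h1 l).
  by apply: weighted; [exact: T_meas (DG l).1|exact: measurable_funM].
have mh2 v : cmeasurable (h2 v).
  by apply: weighted; [exact: T_meas|exact: measurable_funM].
have mh3 i : cmeasurable (h3 i).
  by apply: weighted; [exact: T_meas (Dd i).1|exact: measurable_funM].
have fEle y : cabs (fE y) <= cabs (f y).
  by rewrite /fE cabsM ler_piMl ?cabs_ge0.
have gvle v y : cabs (gv v y) <= cabs (f y).
  rewrite /gv cabsM; apply: le_trans (fEle y); by rewrite ler_piMl ?cabs_ge0.
(* The modulus of G l times e^(Re z.b) is |f| e^(Re z.(b - val)) on E. *)
have Y1 l : (Y (h1 l) <= (Mb * (expR (eta * \sum_j rho j) * xf))%:E)%E.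
  apply: transfer; [exact: (DG l).1|exact: mer|exact: expR_ge0|by move=> x; exact: expR_gt0| |].
    move=> y; rewrite /G sum_gv cabsM cabs_cexp.
    rewrite /fE indicE; have [Ey|nE] := pselect (E y); last first.
      by rewrite memNset// mul0r cabs0 mulr0 mul0r mulr_ge0 ?expR_ge0 ?cabs_ge0.
    rewrite mem_set// mul1r mulrAC; apply: ler_wpM2r; first exact: cabs_ge0.
    rewrite -expRD ler_expR /rot -(raddfD (@complex.Re R)) addrC -sumrB.
    apply: le_trans (le_trans (ler_norm _) (Re_le_cabs _)) _.
    apply: le_trans (cabs_sum _ _ _) _.
    rewrite mulr_sumr; apply: ler_sum => j _; rewrite -mulrBr cabsM mulrC.
    by apply: ler_pM; rewrite ?cabs_ge0//; exact: Hval.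
  exact: (bound_rot (Hz l) (DG l).1).
have rot0 x : rot (fun=> 0) x = 0.
  by rewrite /rot big1// => j _; rewrite mul0r.
have Y2 v : (Y (h2 v) <= (Mb * (1 * xf))%:E)%E.
  apply: transfer; [exact: Dgv|exact: mer|exact: ler01|by move=> x; exact: expR_gt0| |].
    by move=> y; rewrite rot0 expR0 mulr1 mul1r.
  by apply: bound_rot (Dgv v) => j; rewrite cabs0 ltW.
have Y3 i : (Y (h3 i) <= (Mb * (Cd * eta * xf))%:E)%E.
  apply: transfer; [exact: (Dd i).1|exact: mes| |by move=> x; exact: expR_gt0|exact: dbound|].
    by rewrite mulr_ge0// ltW.
  exact: (bound_dec (Dd i).1).
apply: (@le_trans _ _ (Y (fun x => (\sum_l cabs (Gam l) * cabs (h1 l x))%:C%C) +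
   Y (fun x => (\sum_v del' * cabs (h2 v x))%:C%C) +
   Y (fun x => (\sum_i (K' * expR K) * cabs (h3 i x))%:C%C))%E).
  apply: bfs_le3.
  - apply: weighted => //; apply: cmeasurableM => //; apply: cmeasurable_indic.
    by apply: measurable_le => //; exact: measurable_decay.
  - by apply: cmeasurable_real; apply: measurable_sum => l; apply: measurable_funM => //; exact: measurable_cabs.
  - by apply: cmeasurable_real; apply: measurable_sum => l; apply: measurable_funM => //; exact: measurable_cabs.
  - by apply: cmeasurable_real; apply: measurable_sum => l; apply: measurable_funM => //; exact: measurable_cabs.
  move=> x; have S1 : 0 <= \sum_l cabs (Gam l) * cabs (h1 l x).
    by apply: sumr_ge0 => *; rewrite mulr_ge0 ?cabs_ge0.
  have S2 : 0 <= \sum_v del' * cabs (h2 v x).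
    by apply: sumr_ge0 => *; rewrite mulr_ge0 ?cabs_ge0 ?(ltW del'0).
  have S3 : 0 <= \sum_i K' * expR K * cabs (h3 i x).
    by apply: sumr_ge0 => *; rewrite mulr_ge0 ?cabs_ge0 ?mulr_ge0 ?expR_ge0.
  rewrite [in leRHS]cabs_real [in leRHS]cabs_real [in leRHS]cabs_real !ger0_norm//.
  rewrite indicE; have [sK|nK] := pselect (s x <= K); last first.
    by rewrite memNset// mulr0 mul0r cabs0 !addr_ge0.
  rewrite mem_set// mulr1 cabsM cabs_real.
  apply: le_trans (ler_wpM2r (normr_ge0 _) (pointwise x sK)) _.
  rewrite !mulrDl !mulr_suml; apply: lerD; first apply: lerD.
  - apply: ler_sum => l _; rewrite /h1 cabsM cabs_real normrM (gtr0_norm (expR_gt0 _)).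
    by rewrite le_eqVlt; apply/orP; left; apply/eqP; ring.
  - apply: ler_sum => v _; rewrite /h2 cabsM cabs_real rot0 expR0 mulr1.
    by rewrite le_eqVlt; apply/orP; left; apply/eqP; ring.
  - apply: ler_sum => i _; rewrite /h3 cabsM cabs_real normrM (gtr0_norm (expR_gt0 _)).
    have -> : K' * expR K * (cabs (T (d i) x) * (`|lam x| * expR (- s x))) =
      (K' * cabs (T (d i) x) * `|lam x|) * expR (K - s x) by rewrite expRD; ring.
    rewrite ler_peMr//; first by rewrite !mulr_ge0 ?cabs_ge0.
    by rewrite -expR0 ler_expR subr_ge0.
apply: le_trans (leeD (leeD (Y_sum mh1 _ Y1) (Y_sum mh2 _ Y2)) (Y_sum mh3 _ Y3)) _.
- by move=> *; exact: cabs_ge0.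
- by move=> *; exact: ltW.
- by move=> *; rewrite mulr_ge0 ?expR_ge0.
rewrite -!EFinD lee_fin !sumr_const card_ord -[del' *+ _]mulr_natr -[(K' * _) *+ _]mulr_natr.
have Mx0 : 0 <= Mb * xf by rewrite mulr_ge0.
have B1 : (\sum_l cabs (Gam l)) * (Mb * (expR (eta * \sum_j rho j) * xf)) <=
   ((\prod_j (rho j)^-1) * expR (eta * \sum_j rho j)) * (Mb * xf).
  have -> : (\sum_l cabs (Gam l)) * (Mb * (expR (eta * \sum_j rho j) * xf)) =
    (\sum_l cabs (Gam l)) * expR (eta * \sum_j rho j) * (Mb * xf) by ring.
  by apply: ler_wpM2r => //; apply: ler_wpM2r => //; exact: expR_ge0.
have B2 : del' * #|I|%:R * (Mb * (1 * xf)) <= del * (Mb * xf).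
  rewrite mul1r; apply: ler_wpM2r => //.
  rewrite /del' mulrAC ler_pdivrMr// mulrDr mulr1 lerDl; exact: ltW.
apply: le_trans (lerD (lerD B1 B2) (lexx _)) _.
by rewrite le_eqVlt; apply/orP; left; apply/eqP; ring.
Qed.

(** The left-hand side is independent of the discretization, whose error tends to 0. *)
Lemma truncated_estimate (K : R) :
  (Y (fun x => (commutator T b f x * (\1_[set x | s x <= K] x)%:C%C) * (lam x)%:C%C)%R <=
   ((\prod_j (rho j)^-1) * Mb * xf)%:E)%E.
Proof.
have [K2 K20 HK] := discretized_estimate K; apply/lee_addgt0Pr => e e0; rewrite -EFinD.
set P := \prod_j _ in HK *; set Sr := \sum_j _ in HK.
have P0 : 0 <= P by apply: prodr_ge0 => j _; rewrite invr_ge0 ltW.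
have Sr0 : 0 <= Sr by apply: sumr_ge0 => j _; exact: ltW.
have Mx0 : 0 <= Mb * xf by rewrite mulr_ge0.
pose c := (2 * P * Sr + K2 + 1) * (Mb * xf).
have PS0 := mulr_ge0 P0 Sr0.
have c0 : 0 <= c by rewrite /c mulr_ge0//; lra.
pose eta := Num.min 1 (Num.min (2 * Sr + 1)^-1 (e / (c + 1))).
have eta0 : 0 < eta by rewrite !lt_min ltr01 invr_gt0 divr_gt0//; lra.
have eta1 : eta <= 1 by rewrite ge_min lexx.
have etaS : eta * Sr <= 2^-1.
  apply: le_trans (_ : (2 * Sr + 1)^-1 * Sr <= _).
    by apply: ler_wpM2r => //; rewrite !ge_min lexx orbT.
  by rewrite mulrC ler_pdivrMr; lra.
have etac : eta * c <= e.
  apply: le_trans (_ : e / (c + 1) * c <= _).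
    by apply: ler_wpM2r => //; rewrite !ge_min lexx !orbT.
  rewrite mulrAC ler_pdivrMr; last by lra.
  by rewrite mulrDr mulr1 lerDl ltW.
apply: le_trans (HK eta eta _ eta0) _; first by rewrite eta0.
rewrite lee_fin -!mulrA.
have x0 : 0 <= eta * Sr by rewrite mulr_ge0 ?(ltW eta0).
have ex : expR (eta * Sr) <= 1 + 2 * (eta * Sr).
  have := @expR_sub_1D R (eta * Sr); rewrite ger0_norm// => /(_ etaS)/ler_normlP[_].
  have : 2 * (eta * Sr) ^+ 2 <= eta * Sr.
    rewrite expr2 mulrA ler_piMl//; lra.
  lra.
have PE : P * expR (eta * Sr) <= P + eta * (2 * P * Sr).
  apply: le_trans (_ : P * (1 + 2 * (eta * Sr)) <= _); first exact: ler_wpM2l.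
  by rewrite le_eqVlt; apply/orP; left; apply/eqP; ring.
apply: le_trans (_ : (P + eta * (2 * P * Sr + K2 + 1)) * (Mb * xf) <= _).
  apply: ler_wpM2r => //; have -> : eta * (2 * P * Sr + K2 + 1) = eta * (2 * P * Sr) + eta * K2 + eta by ring.
  by rewrite [K2 * eta]mulrC; lra.
by rewrite mulrDl -[X in _ + X]mulrA; apply: lerD.
Qed.

(** The sets [s x <= i] increase to the whole space. *)
Lemma main_estimate :
  (Y (fun x => commutator T b f x * (lam x)%:C%C)%R <= ((\prod_j (rho j)^-1) * Mb * xf)%:E)%E.
Proof.
pose F (i : nat) x := (commutator T b f x * (\1_[set x | s x <= i%:R] x)%:C%C) * (lam x)%:C%C.
have mF i : cmeasurable (F i).
  apply: weighted => //; apply: cmeasurableM => //; apply: cmeasurable_indic.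
  by apply: measurable_le => //; exact: measurable_decay.
have Flim x : nondecreasing_seq (fun i => cabs (F i x)) /\
    (fun i => cabs (F i x)) @ \oo --> cabs (commutator T b f x * (lam x)%:C%C).
  have FE (i : nat) : cabs (F i x) = cabs (commutator T b f x * (lam x)%:C%C) * (\1_[set x | s x <= i%:R] x : R).
    by rewrite /F mulrAC [LHS]cabsM [X in _ * X = _]cabs_real ger0_norm ?indicE ?ler0n.
  split.
    move=> i j ij; rewrite !FE; apply: ler_wpM2l; first exact: cabs_ge0.
    rewrite !indicE; have [si|si] := pselect (s x <= i%:R); last by rewrite memNset.
    by rewrite !mem_set//=; apply: le_trans si _; rewrite ler_nat.
  apply: cvg_near_cst; near=> i; rewrite FE indicE mem_set ?mulr1//=.
  apply: le_trans (ltW (truncnS_gt (s x))) _; rewrite ler_nat; near: i.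
  exact: nbhs_infty_ge.
have [_ H] := bfs_fatou Y mF (weighted mC mlam) (aeW _ Flim).
rewrite -(cvg_lim _ H)//; apply: lime_le; first by apply/cvg_ex; eexists; exact: H.
by apply: nearW => i; exact: truncated_estimate.
Unshelve. all: by end_near.
Qed.

End MainEstimate.

(** * Linear and linearizable operators *)

Section CommutatorEstimate.
Variables (R : realType) (n : nat).
Local Notation Rn := (Rn R n).
Local Notation C := R[i].

Lemma norm_of_linearization (B : completeNormedModType C) (N := fun v : B => complex.Re `|v|) :
  [/\ forall v, (N v)%:C%C = `|v|, forall v w, N (v + w) <= N v + N w &
      forall (c : C) v, N (c *: v) = cabs c * N v].
Proof.
have NE v : (N v)%:C%C = `|v| by apply: RRe_real; exact: ger0_real.
split => // [v w|c v]; last by apply: (@complexI R); rewrite rmorphM/= !NE cabsE normrZ.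
by rewrite -lecR rmorphD/= !NE ler_normD.
Qed.

Lemma measurable_commutator (D : set (Rn -> C)) (T : (Rn -> C) -> Rn -> C)
    (k : nat) (b : 'I_k -> Rn -> C) (f : Rn -> C) :
  operator_domain D -> linear_operator D T \/ linearizable D T ->
  (forall j, cmeasurable (b j)) -> commutator_domain D b f -> cmeasurable (commutator T b f).
Proof.
move=> hD hT mb hf; have [m [xs [a [ma _ aE]]]] := commutator_coeffs mb.
have Dg i : D (commutator_integrand b f (xs i)) by exact: hf.2.
have intE x : commutator_integrand b f x = fun y => \sum_i a i x * commutator_integrand b f (xs i) y.
  apply/funext => y; rewrite /commutator_integrand (aE x (fun j => b j y)) mulr_suml.
  by apply: eq_bigr => i _; rewrite -mulrA.
case: hT => [[Tm Tl]|[Tm [B [calT [calT_linear TE]]]]].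
  have -> : commutator T b f = fun x => \sum_i a i x * T (commutator_integrand b f (xs i)) x.
    apply/funext => x; rewrite {1}/commutator intE.
    exact: (domain_sum (V := C^o) hD Tl (index_enum 'I_m) (fun i => a i x) Dg).2.
  by apply: cmeasurable_sum => i; apply: cmeasurableM => //; exact: Tm.
have [NE N_triangle N_scale] := norm_of_linearization B.
have T_norm g : D g -> forall x, cabs (T g x) = complex.Re `|calT g x|.
  by move=> Dg' x; rewrite TE// /cabs normr_id.
rewrite (_ : commutator T b f = fun x =>
    (complex.Re `|\sum_i a i x *: calT (commutator_integrand b f (xs i)) x|)%:C%C).
  apply: cmeasurable_real.
  exact: (measurable_N_comb hD N_triangle N_scale calT_linear Tm T_norm Dg ma).
apply/funext => x; rewrite NE /commutator TE; last exact: hf.2.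
rewrite intE; congr `|_|.
exact: (domain_sum hD calT_linear (index_enum 'I_m) (fun i => a i x) Dg).2.
Qed.

Lemma commutator_estimate (sigma : Rn -> R) (X Y : banach_function_space sigma)
    (D : set (Rn -> C)) (T : (Rn -> C) -> Rn -> C)
    (k : nat) (b : 'I_k -> Rn -> C) (rho : 'I_k -> R) (mu lam : Rn -> R) (Mb xf : R) (f : Rn -> C) :
  operator_domain D -> linear_operator D T \/ linearizable D T ->
  (forall j, cmeasurable (b j)) -> (forall j, 0 < rho j) ->
  measurable_fun setT mu -> measurable_fun setT lam -> 0 <= Mb ->
  (forall z, (forall j, cabs (z j) <= rho j) -> forall g, D g ->
    (Y (fun x => T g x * (lam x * expR (complex.Re (\sum_j z j * b j x)))%:C%C)%R <=
     Mb%:E * X (fun x => g x * (mu x * expR (complex.Re (\sum_j z j * b j x)))%:C%C)%R)%E) ->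
  (forall g, D g ->
    (Y (fun x => T g x * (lam x * expR (- \sum_j rho j * cabs (b j x)))%:C%C)%R <=
     Mb%:E * X (fun x => g x * (mu x * expR (- \sum_j rho j * cabs (b j x)))%:C%C)%R)%E) ->
  commutator_domain D b f -> X (fun x => f x * (mu x)%:C%C) = xf%:E ->
  (Y (fun x => commutator T b f x * (lam x)%:C%C)%R <= ((\prod_j (rho j)^-1) * Mb * xf)%:E)%E.
Proof.
move=> hD hT mb rho0 mmu mlam Mb0 bound_rot bound_dec hf hxf.
have mC := measurable_commutator hD hT mb hf.
case: hT => [[Tm Tl]|[Tm [B [calT [calT_linear TE]]]]].
  exact: (@main_estimate R n sigma X Y D hD C^o (@cabs R) (@cabsD R) (@cabsM R) T T Tl Tm
    (fun _ _ _ => erefl) k b mb rho rho0 mu lam mmu mlam Mb Mb0 bound_rot bound_dec f hf mC xf hxf).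
have [NE N_triangle N_scale] := norm_of_linearization B.
have T_norm g : D g -> forall x, cabs (T g x) = complex.Re `|calT g x|.
  by move=> Dg' x; rewrite TE// /cabs normr_id.
exact: (@main_estimate R n sigma X Y D hD B _ N_triangle N_scale calT T calT_linear Tm T_norm
    k b mb rho rho0 mu lam mmu mlam Mb Mb0 bound_rot bound_dec f hf mC xf hxf).
Qed.

End CommutatorEstimate.

(** * Monotonicity in several variables *)

Section Psi.
Variables (R : realType) (Psi : ('I_4 -> R) -> R).

Lemma increasing_ge1_le u v : increasing_ge1 Psi -> (forall i, 1 <= u i <= v i) -> Psi u <= Psi v.
Proof.
move=> [_ Psi_inc] uv.
pose w (j : nat) (i : 'I_4) := if (i < j)%N then v i else u i.
have w1 j i : 1 <= w j i.
  rewrite /w; have /andP[u1 u_le_v] := uv i; case: ifP => // _; exact: le_trans u_le_v.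
have H (j : nat) : (j <= 4)%N -> Psi u <= Psi (w j).
  elim: j => [|j IH] j4; first by rewrite (_ : w 0 = u).
  apply: le_trans (IH (ltnW j4)) _; apply: (Psi_inc (Ordinal j4)) => //.
    by move=> i; rewrite -val_eqE/= /w ltnS [(i <= j)%N]leq_eqVlt => /negbTE ->.
  by rewrite /w/= ltnn leqnn; have /andP[] := uv (Ordinal j4).
rewrite (_ : v = w 4); first exact: H.
by apply/funext => i; rewrite /w ltn_ord.
Qed.

End Psi.

(** * Functions with zero oscillation *)

Section BmoZero.
Variables (R : realType) (n : nat).
Local Notation Rn := (Rn R n).
Local Notation leb := (@lebesgue_Rn R n).
Local Notation C := R[i].

Lemma expL_norm_ge0 (Q : set Rn) (f : Rn -> C) : (0 <= expL_norm Q f)%E.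
Proof. by apply: le_ereal_inf_tmp => _ [l [l0 _] <-]; rewrite lee_fin ltW. Qed.

Lemma bmo_norm_ge0 (f : Rn -> C) : (0 <= bmo_norm f)%E.
Proof.
apply: le_trans (expL_norm_ge0 (ccube (fun=> 0) 1) (fun x => f x - cmean (ccube (fun=> 0) 1) f)) _.
by apply: ereal_sup_ubound; exists (ccube (fun=> 0) 1) => //; exact: is_cube_ccube.
Qed.

(** By [bmo_exp] the mean of [|f - m|] is at most [2 * B] for every [B > 0]. *)
Lemma bmo_norm0_cube (f : Rn -> C) a l : cmeasurable f -> bmo_norm f = 0%E -> 0 < l ->
  {ae leb, forall x, hcube a l x -> f x = cmean (ccube a l) f}.
Proof.
move=> mf f0 l0; set m := cmean _ _.
have mH : measurable (hcube a l : set Rn) by exact: measurable_hcube.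
have mg : measurable_fun setT (fun x => cabs (f x - m)).
  by apply: measurable_cabs; apply: cmeasurableB => //; exact: cmeasurable_cst.
have ln0 : 0 < l ^+ n by rewrite exprn_gt0.
have small (B : R) : 0 < B ->
    (\int[leb]_(x in hcube a l) (cabs (f x - m))%:E <= (B * (2 * l ^+ n))%:E)%E.
  move=> B0; have fB : (bmo_norm f < B%:E)%E by rewrite f0 lte_fin.
  have H := bmo_exp a mf fB l0.
  have me : measurable_fun setT (fun x => expR (cabs (f x - m) / B)).
    by apply: measurableT_comp => //; exact: measurable_funM.
  rewrite EFinM; apply: le_trans (lee_wpmul2l _ H); last by rewrite lee_fin ltW.
  rewrite -nintZ ?(ltW B0)//.
  apply: nint_le => //.
  - exact: measurable_funM.
  - by move=> x; exact: cabs_ge0.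
  - move=> x _; rewrite mulrC -ler_pdivrMr//.
    by have := expR_ge1Dx (cabs (f x - m) / B); lra.
have I0 : (\int[leb]_(x in hcube a l) (cabs (f x - m))%:E = 0)%E.
  apply/eqP; rewrite eq_le; apply/andP; split; last first.
    by apply: integral_ge0 => x _; rewrite lee_fin; exact: cabs_ge0.
  apply/lee_addgt0Pr => e e0; rewrite add0e.
  have e'0 : 0 < e / (2 * l ^+ n) by rewrite divr_gt0// mulr_gt0.
  by apply: le_trans (small _ e'0) _; rewrite divfK// gt_eqF// mulr_gt0.
have /(ae_eq_integral_abs leb mH)[H _] : measurable_fun (hcube a l : set Rn) (fun x => (cabs (f x - m))%:E).
  by apply: measurable_funTS; exact: measurableT_comp.
have {H} : ae_eq leb (hcube a l) (fun x => (cabs (f x - m))%:E) (cst 0%E).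
  apply: H; rewrite -[RHS]I0; apply: eq_integral => x _.
  by rewrite gee0_abs// lee_fin; exact: cabs_ge0.
apply: filterS => x H /H/= [] /eqP; rewrite cabs_eq0 subr_eq0 => /eqP; exact.
Qed.

(** On nested cubes exhausting the space, the means of [f] agree because the smallest cube
    has positive measure. *)
Lemma bmo_norm0 (f : Rn -> C) : cmeasurable f -> bmo_norm f = 0%E ->
  exists c, {ae leb, forall x, f x = c}.
Proof.
move=> mf f0.
pose a (i : nat) : 'I_n -> R := fun=> - i.+1%:R; pose l (i : nat) : R := 2 * i.+1%:R.
have l0 i : 0 < l i by rewrite mulr_gt0.
pose H i : set Rn := hcube (a i) (l i).
have mH i : measurable (H i) by exact: measurable_hcube.
pose c i := cmean (ccube (a i) (l i)) f.
have Hc i : {ae leb, forall x, H i x -> f x = c i} by exact: bmo_norm0_cube.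
have H0 i : H 0%N `<=` H i.
  move=> x Hx j; have := Hx j; rewrite /a /l; have : (1 : R) <= i.+1%:R by rewrite ler1n.
  by move=> i1 /andP[h1 h2]; apply/andP; split; lra.
have c0 i : c i = c 0%N.
  apply: contrapT => ne.
  have : {ae leb, forall x, ~ H 0%N x}.
    apply: filterS2 (Hc 0%N) (Hc i) => x E0 Ei Hx.
    by apply: ne; rewrite -(E0 Hx) -(Ei (H0 i x Hx)).
  have -> : {ae leb, forall x, ~ H 0%N x} = leb.-negligible (H 0%N).
    congr (leb.-negligible _); apply/seteqP; split => x /=; last by move=> Hx; apply.
    exact: contrapT.
  move=> /(measure_negligible (mH _)); rewrite [X in X = _ -> _](leb_hcube (a 0%N) (ltW (l0 _))) => -[] /eqP.
  by rewrite gt_eqF// exprn_gt0.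
exists (c 0%N); have : {ae leb, forall x i, H i x -> f x = c i} by exact/ae_foralln.
apply: filterS => x Hx; pose i := Num.truncn (\sum_j `|tnth x j : R|).
rewrite (Hx i) ?c0//= => j.
have : `|tnth x j : R| < i.+1%:R.
  apply: le_lt_trans (truncnS_gt _); rewrite (bigD1 j)//= lerDl; exact: sumr_ge0.
by move=> /ltr_normlP[h1 h2]; rewrite /a /l; apply/andP; split; lra.
Qed.

End BmoZero.


(** * Passage to the limit in the product of the norms *)

(** Used to let the bounds B_j = x_j + d tend to the norms x_j. *)
Lemma prod_add_le (R : realType) (k : nat) (x : 'I_k -> R) (d : R) : (forall j, 0 <= x j) ->
  0 <= d <= 1 -> \prod_j (x j + d) <= \prod_j x j + d * (k%:R * \prod_j (x j + 1 + 1)).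
Proof.
move=> x0 /andP[d0 d1].
have cr (y : R) : 0 <= y -> cabs y%:C%C = y by move=> y0; rewrite cabs_real ger0_norm.
have := @prod_diff R k (fun j => (x j + d)%:C%C) (fun j => (x j)%:C%C) (fun j => x j + 1 + 1) d d0.
rewrite -!rmorph_prod -rmorphB/= cabs_real => H.
have : `|\prod_j (x j + d) - \prod_j x j| <= d * k%:R * \prod_j (x j + 1 + 1).
  apply: H => j; have xj := x0 j; first by lra.
  - by rewrite cr; lra.
  - by rewrite cr; lra.
  - by rewrite -rmorphB/= cr; lra.
by move=> /ler_normlP[_]; rewrite -mulrA; lra.
Qed.

(** * The choice of the radii *)

Section Assembly.
Variables (R : realType) (n : nat).
Local Notation Rn := (Rn R n).
Local Notation leb := (@lebesgue_Rn R n).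
Local Notation C := R[i].
Variables (s theta : 'I_4 -> R) (hs : forall i, 1 < s i) (htheta : forall i, 1 < theta i).
Variables (sigma nu : Rn -> R) (X Y : banach_function_space sigma).
Variables (D : set (Rn -> C)) (hD : operator_domain D).
Variables (T : (Rn -> C) -> Rn -> C) (hT : linear_operator D T \/ linearizable D T).
Variables (Psi : ('I_4 -> R) -> R) (hPsi : increasing_ge1 Psi).
Hypothesis hbound : forall mu lambda : Rn -> R, admissible s theta nu mu lambda ->
    forall f, D f ->
      (Y (fun x => T f x * (lambda x)%:C%C)%R <=
       (Psi (Ap_consts s theta mu lambda))%:E *
         X (fun x => f x * (mu x)%:C%C)%R)%E.
Variables (k : nat) (hk : (1 <= k)%N) (b : 'I_k -> Rn -> C) (hb : forall j, bmo (b j)).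
Variables (mu lambda : Rn -> R) (hml : admissible s theta nu mu lambda).
Let S := \big[Num.max/0]_(i < 4) Num.max (s i) (dual_exponent (s i)).
Let m := \big[Num.min/1]_(i < 4) Num.min 1 (s i - 1).
Let thetamax := \big[Num.max/0]_(i < 4) theta i.
Let A := Ap_consts s theta mu lambda.
Let maxA := \big[Num.max/0]_(i < 4) (A i `^ Num.max 1 (1 / (s i - 1))).
Let Mb := Psi (fun i => 2 `^ (s i + 2 * Num.min 1 (s i - 1)) * A i).
Let K := 2 `^ (n%:R + 2 + 2 * S) * thetamax * maxA.

Let A1 i : 1 <= A i. Proof. exact (Ap_consts_ge1 hs hml i). Qed.

Let mmu : measurable_fun setT mu. Proof. by have [[]] := hml. Qed.
Let mlam : measurable_fun setT lambda. Proof. by have [_ []] := hml. Qed.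

Let mb j : cmeasurable (b j). Proof. by have [[]] := hb j. Qed.

Lemma pow2A_ge1 i : 1 <= 2 `^ (s i + 2 * Num.min 1 (s i - 1)) * A i.
Proof.
have s1 := hs i; have h : 0 <= Num.min 1 (s i - 1) by rewrite le_min ler01; lra.
have p1 : 1 <= 2 `^ (s i + 2 * Num.min 1 (s i - 1)).
  by rewrite -[leLHS](powRr0 2); apply: ler_powR; [rewrite ler1n|lra].
by rewrite -[leLHS]mulr1; apply: ler_pM.
Qed.

Lemma Mb_ge1 : 1 <= Mb.
Proof. by apply: hPsi.1; exact: pow2A_ge1. Qed.

Lemma m_gt0 : 0 < m.
Proof.
rewrite /m; elim/big_ind : _ => //; first by move=> x y x0 y0; rewrite lt_min x0.
by move=> i _; rewrite lt_min ltr01 subr_gt0; exact: hs.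
Qed.

Lemma thetamax_gt0 : 0 < thetamax.
Proof. by apply: lt_le_trans (le_bigmax _ _ (ord0 : 'I_4)); apply: lt_trans (htheta ord0). Qed.

Lemma maxA_gt0 : 0 < maxA.
Proof.
apply: lt_le_trans (le_bigmax _ _ (ord0 : 'I_4)); apply: powR_gt0.
exact: lt_le_trans (A1 ord0).
Qed.

Lemma K_gt0 : 0 < K.
Proof. by rewrite !mulr_gt0 ?thetamax_gt0 ?maxA_gt0 ?powR_gt0. Qed.

Lemma perturbed_bound (phi : Rn -> R) (eps : R) : measurable_fun setT phi -> 0 < eps -> exp_osc phi eps ->
  K * eps <= m -> forall g, D g ->
  (Y (fun x => T g x * (lambda x * expR (phi x))%:C%C)%R <=
   Mb%:E * X (fun x => g x * (mu x * expR (phi x))%:C%C)%R)%E.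
Proof.
move=> mphi eps0 osc small g Dg.
have [adm le2] := admissible_perturb hs htheta hml mphi eps0 osc small.
apply: le_trans (hbound adm Dg) _; apply: lee_wpmul2r; last first.
  by rewrite lee_fin; exact: increasing_ge1_le.
apply: bfs_ge0; apply: cmeasurableM; first by case: hD => H _ _ _; exact: H.
apply: cmeasurable_real; apply: measurable_funM => //.
exact: measurableT_comp.
Qed.

(** The radii are [rho j = eps / (k * B j)], where [eps = m / K] is the largest scale that
    [admissible_perturb] allows. *)
Lemma bound_of_bmo_lt (B : 'I_k -> R) (f : Rn -> C) (xf : R) :
  (forall j, (bmo_norm (b j) < (B j)%:E)%E) -> (forall j, 0 < B j) ->
  commutator_domain D b f -> X (fun x => f x * (mu x)%:C%C) = xf%:E ->
  (Y (fun x => commutator T b f x * (lambda x)%:C%C)%R <=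
   ((K * k%:R / m) ^+ k * (\prod_j B j) * Mb * xf)%:E)%E.
Proof.
move=> hB B0 hf hxf.
have K0 := K_gt0; have m0 := m_gt0; have k0 : (0 : R) < k%:R by rewrite ltr0n.
pose eps := m / K.
have eps0 : 0 < eps by rewrite divr_gt0.
have small : K * eps <= m by rewrite /eps mulrC divfK// gt_eqF.
pose rho j := eps / (k%:R * B j).
have rho0 j : 0 < rho j by rewrite divr_gt0// mulr_gt0.
pose kap := eps / k%:R.
have kap0 : 0 < kap by rewrite divr_gt0.
have kapE : k%:R * kap = eps by rewrite mulrC divfK// gt_eqF.
have rB j : rho j * B j = kap.
  by rewrite /rho /kap; field; rewrite !gt_eqF.
have osc (psi : 'I_k -> Rn -> R) : (forall j, measurable_fun setT (psi j)) ->
    (forall j m, exists c, forall x, `|psi j x - c| <= rho j * cabs (b j x - m)) ->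
    exp_osc (fun x => \sum_j psi j x) eps.
  by move=> mpsi Hpsi; rewrite -kapE; exact: (bmo_exp_osc hk kap0 mb hB B0 mpsi rB Hpsi).
have rE : \prod_j (rho j)^-1 = (K * k%:R / m) ^+ k * \prod_j B j.
  have -> : (K * k%:R / m) ^+ k = \prod_(j < k) (K * k%:R / m) by rewrite prodr_const card_ord.
  rewrite -big_split/=; apply: eq_bigr => j _.
  by rewrite /rho /eps; field; rewrite !gt_eqF.
rewrite -rE.
apply: (commutator_estimate hD hT mb rho0 mmu mlam (le_trans ler01 Mb_ge1) _ _ hf hxf).
- move=> z hz g Dg.
  pose psi j x := complex.Re (z j * b j x).
  have mpsi j : measurable_fun setT (psi j).
    by have [] : cmeasurable (fun x => z j * b j x) by apply: cmeasurableM => //; exact: cmeasurable_cst.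
  have E : (fun x => complex.Re (\sum_j z j * b j x)) = (fun x => \sum_j psi j x).
    by apply/funext => x; rewrite raddf_sum.
  have := @perturbed_bound (fun x => complex.Re (\sum_j z j * b j x)) eps _ eps0 _ small g Dg.
  rewrite E; apply; first exact: measurable_sum.
  apply: osc => // j c; exists (complex.Re (z j * c)) => x.
  rewrite /psi -raddfB -mulrBr; apply: le_trans (Re_le_cabs _) _; rewrite cabsM.
  by apply: ler_wpM2r; [exact: cabs_ge0|exact: hz].
- move=> g Dg; pose psi j x := - (rho j * cabs (b j x)).
  have mpsi j : measurable_fun setT (psi j).
    apply: measurableT_comp => //; apply: measurable_funM => //; exact: measurable_cabs.
  have E : (fun x => - \sum_j rho j * cabs (b j x)) = (fun x => \sum_j psi j x).
    by apply/funext => x; rewrite sumrN.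
  have := @perturbed_bound (fun x => - \sum_j rho j * cabs (b j x)) eps _ eps0 _ small g Dg.
  rewrite E; apply; first exact: measurable_sum.
  apply: osc => // j c; exists (- (rho j * cabs c)) => x.
  rewrite /psi opprK addrC -mulrBr normrM (gtr0_norm (rho0 j)) ler_pM2l//.
  rewrite ler_norml; have h1 := cabsD (b j x - c) c; have h2 := cabsB (b j x) (b j x - c).
  rewrite subrK in h1; rewrite opprB addrC subrK in h2.
  by apply/andP; split; lra.
Qed.

Let beta j := fine (bmo_norm (b j)).

Lemma beta_ge0 j : 0 <= beta j. Proof. by apply: fine_ge0; exact: bmo_norm_ge0. Qed.

Lemma betaE j : bmo_norm (b j) = (beta j)%:E.
Proof.
rewrite /beta fineK// ge0_fin_numE; last exact: bmo_norm_ge0.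
by have [] := hb j.
Qed.

Lemma bound_finite (f : Rn -> C) (xf : R) :
  commutator_domain D b f -> X (fun x => f x * (mu x)%:C%C) = xf%:E ->
  (Y (fun x => commutator T b f x * (lambda x)%:C%C)%R <=
   ((K * k%:R / m) ^+ k * (\prod_j beta j) * Mb * xf)%:E)%E.
Proof.
move=> hf hxf.
have c0 : 0 <= (K * k%:R / m) ^+ k.
  by rewrite exprn_ge0// divr_ge0 ?(ltW m_gt0)// mulr_ge0 ?(ltW K_gt0).
have xf0 : 0 <= xf.
  rewrite -lee_fin -hxf; apply: bfs_ge0; apply: cmeasurableM; first exact: hf.1.
  exact: cmeasurable_real.
set c := (K * k%:R / m) ^+ k in c0 *.
have Mb0 : 0 <= Mb := le_trans ler01 Mb_ge1.
pose P := k%:R * \prod_j (beta j + 1 + 1).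
have P0 : 0 <= P.
  by rewrite mulr_ge0//; apply: prodr_ge0 => j _; have := beta_ge0 j; lra.
pose q := c * P * Mb * xf; have q0 : 0 <= q by exact: (mulr_ge0 (mulr_ge0 (mulr_ge0 c0 P0) Mb0) xf0).
apply/lee_addgt0Pr => e e0; rewrite -EFinD.
pose d := Num.min 1 (e / (q + 1)).
have d0 : 0 < d by rewrite lt_min ltr01 divr_gt0//; lra.
have d1 : d <= 1 by rewrite ge_min lexx.
have dq : d * q <= e.
  apply: le_trans (_ : e / (q + 1) * q <= _).
    by apply: ler_wpM2r => //; rewrite ge_min lexx orbT.
  rewrite mulrAC ler_pdivrMr; last by lra.
  by rewrite mulrDr mulr1 lerDl ltW.
apply: le_trans (bound_of_bmo_lt (B := fun j => beta j + d) _ _ hf hxf) _.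
- by move=> j; rewrite betaE lte_fin ltrDl.
- by move=> j; have := beta_ge0 j; lra.
rewrite lee_fin -/c; apply: le_trans (_ : c * (\prod_j beta j + d * P) * Mb * xf <= _).
  do 2 apply: ler_wpM2r => //; apply: ler_wpM2l => //.
  by apply: prod_add_le; [exact: beta_ge0|rewrite (ltW d0)].
rewrite (_ : _ * xf = c * \prod_j beta j * Mb * xf + d * q); last by rewrite /q; ring.
by rewrite lerD2l.
Qed.

(** [b j0] equals a constant [c] almost everywhere.  At a point [x] with [b j0 x = c] the
    factor [b j0 x - b j0 y] vanishes unless [y] lies in the null set [E]; hence [f] may be
    multiplied by the indicator of [E], which makes its norm 0. *)
Lemma bound_zero (f : Rn -> C) j0 : commutator_domain D b f -> beta j0 = 0 ->
  (Y (fun x => commutator T b f x * (lambda x)%:C%C)%R <= 0)%E.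
Proof.
move=> hf b0.
have [c Hc] : exists c, {ae leb, forall x, b j0 x = c}.
  by apply: bmo_norm0 => //; rewrite betaE b0.
pose E := [set x | (b j0 x <> c)].
have mE : measurable E.
  have mc : measurable_fun setT (fun x => cabs (b j0 x - c)).
    by apply: measurable_cabs; apply: cmeasurableB => //; exact: cmeasurable_cst.
  have -> : E = ~` [set x | cabs (b j0 x - c) <= 0].
    apply/seteqP; split => x /= h1 h2; apply: h1.
      by apply/eqP; rewrite -subr_eq0 -cabs_eq0 eq_le h2 cabs_ge0.
    by rewrite h2 subrr cabs0.
  by apply: measurableC; exact: measurable_le.
pose h x : C := (\1_E x)%:C%C.
have mh : cmeasurable h by exact: cmeasurable_indic.
have h1 x : cabs (h x) <= 1 by rewrite /h cabs_real indicE; case: (_ \in _); rewrite ?normr1 ?normr0.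
pose f' x := h x * f x.
have intE x : commutator_integrand b f' x = fun y => h y * commutator_integrand b f x y.
  by apply/funext => y; rewrite /commutator_integrand /f' mulrCA.
have hf' : commutator_domain D b f'.
  split; first by apply: cmeasurableM => //; exact: hf.1.
  by move=> x; rewrite intE; exact: (domain_bounded hD mh h1 (hf.2 x)).
have mfm : cmeasurable (fun x => f' x * (mu x)%:C%C).
  by apply: cmeasurableM; [exact: hf'.1|exact: cmeasurable_real].
have X0 : X (fun x => f' x * (mu x)%:C%C) = 0%:E.
  apply/bfs_eq0 => //; apply: filterS Hc => x bx.
  by rewrite /f' /h indicE memNset ?mul0r// => -[].
have := bound_finite hf' X0; rewrite mulr0; apply: le_trans.
have mC g : commutator_domain D b g -> cmeasurable (fun x => commutator T b g x * (lambda x)%:C%C).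
  move=> hg; apply: cmeasurableM; first exact: (measurable_commutator hD hT mb hg).
  exact: cmeasurable_real.
apply: bfs_monotone; [exact: mC|exact: mC|].
apply: filterS Hc => x bx.
rewrite (_ : commutator T b f' x = commutator T b f x)// /commutator intE; congr (T _ x).
apply/funext => y; rewrite /h indicE; have [Ey|Ey] := pselect (E y).
  by rewrite mem_set// mul1r.
rewrite memNset// mul0r /commutator_integrand (bigD1 j0)//=.
have by_ : b j0 y = c by exact: contrapT Ey.
by rewrite bx by_ subrr !mul0r.
Qed.

Lemma commutator_bound (f : Rn -> C) : commutator_domain D b f ->
  (Y (fun x => commutator T b f x * (lambda x)%:C%C)%R <=
   ((2 `^ (n%:R + 2 + 2 * S) * thetamax * k%:R / m) ^+ k * maxA ^+ k * Mb * \prod_j beta j)%:E *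
   X (fun x => f x * (mu x)%:C%C)%R)%E.
Proof.
move=> hf.
have -> : (2 `^ (n%:R + 2 + 2 * S) * thetamax * k%:R / m) ^+ k * maxA ^+ k = (K * k%:R / m) ^+ k.
  by rewrite -exprMn /K; congr (_ ^+ _); ring.
have mfm : cmeasurable (fun x => f x * (mu x)%:C%C).
  by apply: cmeasurableM; [exact: hf.1|exact: cmeasurable_real].
have := bfs_ge0 X mfm; case E : (X _) => [xf| |]// xf0.
  apply: le_trans (bound_finite hf E) _; rewrite -EFinM lee_fin le_eqVlt.
  by apply/orP; left; apply/eqP; ring.
have [P0|P0] := eqVneq (\prod_j beta j) 0.
  rewrite P0 mulr0 mul0e; move/eqP: P0 => /prodf_eq0[j _ /eqP bj].
  exact: bound_zero bj.
rewrite gt0_muley ?leey// lte_fin !mulr_gt0//.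
- by rewrite exprn_gt0// divr_gt0 ?m_gt0// mulr_gt0 ?K_gt0 ?ltr0n.
- exact: lt_le_trans Mb_ge1.
- by rewrite lt_neqAle eq_sym P0; apply: prodr_ge0 => j _; exact: beta_ge0.
Qed.

End Assembly.
Theorem theorem5p1 (R : realType) (n : nat) (hn : (0 < n)%N)
  (s theta : 'I_4 -> R) (hs : forall i, 1 < s i) (htheta : forall i, 1 < theta i)
  (sigma nu : Rn R n -> R) (hsigma : weight sigma) (hnu : weight nu)
  (X Y : banach_function_space sigma)
  (D : set (Rn R n -> R[i])) (hD : operator_domain D)
  (T : (Rn R n -> R[i]) -> Rn R n -> R[i])
  (hT : linear_operator D T \/ linearizable D T)
  (Psi : ('I_4 -> R) -> R) (hPsi : increasing_ge1 Psi)
  (hbound : forall mu lambda : Rn R n -> R, admissible s theta nu mu lambda ->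
    forall f, D f ->
      (Y (fun x => T f x * (lambda x)%:C%C)%R <=
       (Psi (Ap_consts s theta mu lambda))%:E *
         X (fun x => f x * (mu x)%:C%C)%R)%E) :
  let S := \big[Num.max/0]_(i < 4) Num.max (s i) (dual_exponent (s i)) in
  let m := \big[Num.min/1]_(i < 4) Num.min 1 (s i - 1) in
  let thetamax := \big[Num.max/0]_(i < 4) theta i in
  let r := fun i : 'I_4 => Num.max 1 (1 / (s i - 1)) in
  let t := fun i : 'I_4 => s i + 2 * Num.min 1 (s i - 1) in
  forall (k : nat) (hk : (1 <= k)%N)
    (b : 'I_k -> Rn R n -> R[i]) (hb : forall j, bmo (b j))
    (mu lambda : Rn R n -> R) (hml : admissible s theta nu mu lambda)
    (f : Rn R n -> R[i]) (hf : commutator_domain D b f),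
    let A := Ap_consts s theta mu lambda in
    (Y (fun x => commutator T b f x * (lambda x)%:C%C)%R <=
     ((2 `^ (n%:R + 2 + 2 * S) * thetamax * k%:R / m) ^+ k *
      (\big[Num.max/0]_(i < 4) (A i `^ r i)) ^+ k *
      Psi (fun i => 2 `^ t i * A i) *
      \prod_(j < k) fine (bmo_norm (b j)))%:E *
     X (fun x => f x * (mu x)%:C%C)%R)%E.
Proof.
move=> S m thetamax r t k hk b hb mu lambda hml f hf.
exact: (commutator_bound hs htheta hD hT hPsi hbound hk hb hml hf).
Qed.
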